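(* Let $M$ be a $7$-manifold with a $G_2$-structure $\varphi$ inducing the Riemannian metric $g$ on $M$, and let $\psi=*\varphi$. Let $\{\varphi_t\}_{t\in(-\varepsilon,\varepsilon)}$ be a (smooth) family of $G_2$-structures on $M$ such that $\varphi_0=\varphi$ and $$\left.\frac{d}{dt}\right|_{t=0}\varphi_t=h\diamond\varphi+X\lrcorner\psi$$ for some symmetric $2$-tensor $h$ and $1$-form $X$. Then $$\left.\frac{d}{dt}\right|_{t=0}\left(\tfrac16\mathrm{Scal}-\tfrac16(\mathrm{tr}\,T)^2-\tfrac13|T|^2\right)=\langle h,\hat P_1\rangle+\langle X,P_2\rangle+\mathrm{div}\,A,$$ where $$\hat P_1=-\mathrm{Ric}-\tfrac13\mathcal L_{\mathsf VT}g-\tfrac23\bigl(T\circ(\mathsf VT\lrcorner\varphi)\bigr)_{\mathrm{sym}}+\mathrm{tr}\,T\;T_{\mathrm{sym}},$$ $$P_2=\tfrac23\,\mathrm{div}\,T+\tfrac13\nabla\mathrm{tr}\,T+\tfrac13\,\mathrm{tr}\,T\;\mathsf VT,$$ $$A=-\tfrac13\nabla\mathrm{tr}\,h+\tfrac13\,\mathrm{div}\,h-\tfrac23\mathsf V(h\circ T)-\tfrac23T(X)-\tfrac13\,\mathrm{tr}\,T\;X .$$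
   Context: Abstract index notation; repeated indices are contracted with the metric. A $G_2$-structure on $M^7$ is a $3$-form $\varphi$ inducing an orientation and a Riemannian metric $g$ by $(V\lrcorner\varphi)\wedge(W\lrcorner\varphi)\wedge\varphi=-6g(V,W)\,d\mu_g$; $\psi=*\varphi$; $\nabla$ is the Levi-Civita connection. For a symmetric $2$-tensor $h$ and a $1$-form $X$: $(h\diamond\varphi)_{ijk}=h_{ip}\varphi_{pjk}+h_{jp}\varphi_{ipk}+h_{kp}\varphi_{ijp}$ and $(X\lrcorner\psi)_{ijk}=X_m\psi_{mijk}$. The torsion $T$ is the $2$-tensor with $\nabla_p\varphi_{ijk}=T_{pl}\psi_{lijk}$. For $2$-tensors: $(\mathsf VA)_k=A_{ij}\varphi_{ijk}$, $(A\circ B)_{ij}=A_{ip}B_{pj}$, $A_{\mathrm{sym}}=\frac12(A+A^t)$, $(\mathrm{div}\,A)_k=\nabla_aA_{ak}$, $A(X)_i=A_{ij}X_j$; $(\mathsf VT\lrcorner\varphi)_{jk}=(\mathsf VT)_i\varphi_{ijk}$. Inner products and norms of tensors are full contractions, e.g. $|T|^2=T_{ij}T_{ij}$. In the differentiated quantity, $\mathrm{Scal}$, $T$, traces and norms are those of $\varphi_t$ and its metric; the right-hand side is evaluated at $\varphi$. *)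

(* Defs.v *)
From HB Require Import structures.
From mathcomp Require Import all_boot all_order all_algebra.
From mathcomp Require Import all_classical all_reals all_analysis.

Set Implicit Arguments.
Unset Strict Implicit.
Unset Printing Implicit Defensive.

Import Order.TTheory GRing.Theory Num.Theory.
Import numFieldNormedType.Exports.

Local Open Scope classical_set_scope.
Local Open Scope ring_scope.

(* C^k on the open set [U]: all iterated directional derivatives of order at
   most [k] exist and are continuous on [U].  In finite dimension this is the
   usual notion. *)
Fixpoint class_C (R : realType) (W : normedModType R) (k : nat)
    (U : set W) (f : W -> R^o) : Prop :=
  (forall x, U x -> {for x, continuous f}) /\
  (if k is k'.+1 then
     forall v, (forall x, U x -> derivable f x v) /\ class_C k' U ('D_v f)
   else True).

Definition smooth_on (R : realType) (W : normedModType R)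
    (U : set W) (f : W -> R^o) : Prop :=
  forall k, class_C k U f.

Section Manifold.
Variables (R : realType) (M : topologicalType).

Definition pd (a : 'I_7) (f : 'rV[R]_7 -> R) (x : 'rV[R]_7) : R :=
  'D_(delta_mx ord0 a) (f : 'rV[R]_7 -> R^o) x.

(* The values of [chart_map] outside [chart_dom] and of [chart_inv] outside
   [chart_img] are irrelevant. *)
Record chart := Chart {
  chart_dom : set M;
  chart_img : set 'rV[R]_7;
  chart_map : M -> 'rV[R]_7;
  chart_inv : 'rV[R]_7 -> M;
  chart_dom_open : open chart_dom;
  chart_img_open : open chart_img;
  chart_map_img : forall p, chart_dom p -> chart_img (chart_map p);
  chart_inv_dom : forall x, chart_img x -> chart_dom (chart_inv x);
  chart_mapK : forall p, chart_dom p -> chart_inv (chart_map p) = p;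
  chart_invK : forall x, chart_img x -> chart_map (chart_inv x) = x;
  chart_map_cont : forall p, chart_dom p -> {for p, continuous chart_map};
  chart_inv_cont : forall x, chart_img x -> {for x, continuous chart_inv} }.

Definition overlap (c d : chart) : set 'rV[R]_7 :=
  [set x | chart_img c x /\ chart_dom d (chart_inv c x)].

Definition transition (c d : chart) (x : 'rV[R]_7) : 'rV[R]_7 :=
  chart_map d (chart_inv c x).

(* [jac c d x b a] is the partial derivative of the b-th d-coordinate with
   respect to the a-th c-coordinate. *)
Definition jac (c d : chart) (x : 'rV[R]_7) (b a : 'I_7) : R :=
  pd a (fun y => transition c d y ord0 b) x.

Record smooth_structure := SmoothStructure {
  atlas_hausdorff : hausdorff_space M;
  atlas_countable : @second_countable M;
  atlas_index : Type;
  atlas_chart :> atlas_index -> chart;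
  atlas_cover : forall p, exists i, chart_dom (atlas_chart i) p;
  atlas_smooth : forall i j (b : 'I_7),
    smooth_on (overlap (atlas_chart i) (atlas_chart j))
      (fun x => transition (atlas_chart i) (atlas_chart j) x ord0 b) }.

(* A smooth covariant tensor field is given by its components in every chart;
   the values outside [chart_img] are irrelevant. *)
Section Fields.
Variable A : smooth_structure.

Record tensor1 := Tensor1 {
  comp1 :> atlas_index A -> 'rV[R]_7 -> 'I_7 -> R;
  smooth1 : forall i a, smooth_on (chart_img (A i)) (fun x => comp1 i x a);
  change1 : forall i j x, overlap (A i) (A j) x -> forall a,
    comp1 i x a =
    \sum_b jac (A i) (A j) x b a * comp1 j (transition (A i) (A j) x) b }.

Record tensor2 := Tensor2 {
  comp2 :> atlas_index A -> 'rV[R]_7 -> 'I_7 -> 'I_7 -> R;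
  smooth2 : forall i a b,
    smooth_on (chart_img (A i)) (fun x => comp2 i x a b);
  change2 : forall i j x, overlap (A i) (A j) x -> forall a1 a2,
    comp2 i x a1 a2 =
    \sum_b1 \sum_b2
      jac (A i) (A j) x b1 a1 * jac (A i) (A j) x b2 a2 *
      comp2 j (transition (A i) (A j) x) b1 b2 }.

Record tensor3 := Tensor3 {
  comp3 :> atlas_index A -> 'rV[R]_7 -> 'I_7 -> 'I_7 -> 'I_7 -> R;
  smooth3 : forall i a b c,
    smooth_on (chart_img (A i)) (fun x => comp3 i x a b c);
  change3 : forall i j x, overlap (A i) (A j) x -> forall a1 a2 a3,
    comp3 i x a1 a2 a3 =
    \sum_b1 \sum_b2 \sum_b3
      jac (A i) (A j) x b1 a1 * jac (A i) (A j) x b2 a2 *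
      jac (A i) (A j) x b3 a3 *
      comp3 j (transition (A i) (A j) x) b1 b2 b3 }.

(* A smooth 7-form; [top_comp] is its coefficient on dx^1 /\ ... /\ dx^7. *)
Record top_form := TopForm {
  top_comp :> atlas_index A -> 'rV[R]_7 -> R;
  smooth_top : forall i, smooth_on (chart_img (A i)) (top_comp i);
  change_top : forall i j x, overlap (A i) (A j) x ->
    top_comp i x =
    \det (\matrix_(b, a) jac (A i) (A j) x b a) *
    top_comp j (transition (A i) (A j) x) }.

Definition symmetric_tensor (h : tensor2) : Prop :=
  forall i x, chart_img (A i) x -> forall a b, h i x a b = h i x b a.

End Fields.
End Manifold.

Section Pointwise.
Variable R : realType.

Notation ten1 := ('I_7 -> R).
Notation ten2 := ('I_7 -> 'I_7 -> R).
Notation ten3 := ('I_7 -> 'I_7 -> 'I_7 -> R).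
Notation ten4 := ('I_7 -> 'I_7 -> 'I_7 -> 'I_7 -> R).

Definition levi_civita (a b c d e f g : 'I_7) : R :=
  \det (\matrix_(m < 7, n < 7)
          (tnth [tuple a; b; c; d; e; f; g] m == n)%:R).

(* Coefficient of al /\ be /\ ga on dx^1 /\ ... /\ dx^7. *)
Definition wedge223 (al be : ten2) (ga : ten3) : R :=
  (2 * 2 * 6)^-1 *
  \sum_a \sum_b \sum_c \sum_d \sum_e \sum_f \sum_g
    levi_civita a b c d e f g * al a b * be c d * ga e f g.

Definition metric_inv (g : ten2) : ten2 :=
  fun i j => invmx (\matrix_(a < 7, b < 7) g a b) i j.

(* Contraction of a pair of indices with the metric [g]: a pair of repeated
   indices of the index notation becomes one [ctr]. *)
Definition ctr (g F : ten2) : R := \sum_p \sum_q metric_inv g p q * F p q.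

Definition trace2 (g A : ten2) : R := ctr g A.

Definition inner1 (g : ten2) (X Y : ten1) : R := ctr g (fun i i' => X i * Y i').

Definition inner2 (g A B : ten2) : R :=
  ctr g (fun i i' => ctr g (fun j j' => A i j * B i' j')).

Definition compose2 (g A B : ten2) : ten2 :=
  fun i j => ctr g (fun p q => A i p * B q j).

Definition sym_part (A : ten2) : ten2 := fun i j => (A i j + A j i) / 2.

Definition apply2 (g A : ten2) (X : ten1) : ten1 :=
  fun i => ctr g (fun j j' => A i j * X j').

Definition diamond (g h : ten2) (phi : ten3) : ten3 := fun i j k =>
  ctr g (fun p q => h i p * phi q j k) +
  ctr g (fun p q => h j p * phi i q k) +
  ctr g (fun p q => h k p * phi i j q).

Definition hook3 (g : ten2) (X : ten1) (phi : ten3) : ten2 :=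
  fun j k => ctr g (fun i i' => X i * phi i' j k).

Definition hook4 (g : ten2) (X : ten1) (psi : ten4) : ten3 :=
  fun i j k => ctr g (fun m m' => X m * psi m' i j k).

Definition vecV (g : ten2) (phi : ten3) (A : ten2) : ten1 :=
  fun k => ctr g (fun i i' => ctr g (fun j j' => A i j * phi i' j' k)).

(* Hodge star of a 3-form, for the metric [g] and the volume form
   vol dx^1 /\ ... /\ dx^7. *)
Definition hodge3 (g : ten2) (vol : R) (phi : ten3) : ten4 := fun i j k l =>
  6^-1 * ctr g (fun a a' => ctr g (fun b b' => ctr g (fun c c' =>
    phi a b c * (vol * levi_civita a' b' c' i j k l)))).

End Pointwise.

Section Local.
Variable R : realType.

Notation V := 'rV[R]_7.
Notation field1 := (V -> 'I_7 -> R).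
Notation field2 := (V -> 'I_7 -> 'I_7 -> R).
Notation field3 := (V -> 'I_7 -> 'I_7 -> 'I_7 -> R).

(* [christoffel g x k i j] is Gamma^k_ij. *)
Definition christoffel (g : field2) : field3 := fun x k i j =>
  2^-1 * \sum_l metric_inv (g x) k l *
    (pd i (fun y => g y j l) x + pd j (fun y => g y i l) x
     - pd l (fun y => g y i j) x).

(* In the covariant derivatives the first index is that of differentiation. *)
Definition nabla1 (g : field2) (X : field1) : field2 := fun x a k =>
  pd a (fun y => X y k) x - \sum_m christoffel g x m a k * X x m.

Definition nabla2 (g A : field2) : field3 := fun x a i j =>
  pd a (fun y => A y i j) x
  - \sum_m christoffel g x m a i * A x m j
  - \sum_m christoffel g x m a j * A x i m.

Definition nabla3 (g : field2) (phi : field3) :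
    V -> 'I_7 -> 'I_7 -> 'I_7 -> 'I_7 -> R := fun x a i j k =>
  pd a (fun y => phi y i j k) x
  - \sum_m christoffel g x m a i * phi x m j k
  - \sum_m christoffel g x m a j * phi x i m k
  - \sum_m christoffel g x m a k * phi x i j m.

Definition div1 (g : field2) (X : field1) (x : V) : R :=
  ctr (g x) (fun a b => nabla1 g X x a b).

Definition div2 (g A : field2) : field1 := fun x k =>
  ctr (g x) (fun a b => nabla2 g A x a b k).

Definition grad (f : V -> R) : field1 := fun x k => pd k f x.

(* With this sign the round sphere has positive Ricci curvature. *)
Definition ricci (g : field2) : field2 := fun x j k =>
  \sum_i (pd i (fun y => christoffel g y i j k) x
          - pd j (fun y => christoffel g y i i k) x
          + \sum_m (christoffel g x i i m * christoffel g x m j k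
                    - christoffel g x i j m * christoffel g x m i k)).

Definition scalar_curvature (g : field2) (x : V) : R :=
  trace2 (g x) (ricci g x).

(* Lie derivative of the metric along the vector field metrically dual to [Y]. *)
Definition lie_metric (g : field2) (Y : field1) : field2 := fun x i j =>
  let Yup (k : 'I_7) (y : V) := \sum_l metric_inv (g y) k l * Y y l in
  \sum_k (Yup k x * pd k (fun y => g y i j) x
          + g x k j * pd i (Yup k) x + g x i k * pd j (Yup k) x).

End Local.

Section G2.
Variables (R : realType) (M : topologicalType) (A : smooth_structure R M).

(* The identity [g2_compat] determines [g2_metric] and [g2_vol] from
   [g2_form]: taking determinants in it gives the ninth power of the
   coefficient of [g2_vol].  [g2_vol], which orients M, is the Riemannian volume
   form of [g2_metric] for that orientation, so in a chart which is not
   positively oriented its coefficient is - sqrt (det g). *)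
Record G2_structure := G2Structure {
  g2_form :> tensor3 A;
  g2_metric : tensor2 A;
  g2_vol : top_form A;
  g2_alt12 : forall i x, chart_img (A i) x -> forall a b c,
    g2_form i x a b c = - g2_form i x b a c;
  g2_alt23 : forall i x, chart_img (A i) x -> forall a b c,
    g2_form i x a b c = - g2_form i x a c b;
  g2_metric_sym : symmetric_tensor g2_metric;
  g2_metric_pos : forall i x, chart_img (A i) x -> forall v : 'I_7 -> R,
    (exists a, v a != 0) ->
    0 < \sum_a \sum_b g2_metric i x a b * v a * v b;
  g2_vol_unit : forall i x, chart_img (A i) x ->
    g2_vol i x ^+ 2 = \det (\matrix_(a < 7, b < 7) g2_metric i x a b);
  g2_compat : forall i x, chart_img (A i) x -> forall a b,
    wedge223 (g2_form i x a) (g2_form i x b) (g2_form i x)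
    = - 6 * g2_metric i x a b * g2_vol i x }.

Definition g2_psi (phi : G2_structure) (i : atlas_index A) (x : 'rV[R]_7) :=
  hodge3 (g2_metric phi i x) (g2_vol phi i x) (phi i x).

Definition is_torsion (phi : G2_structure) (T : tensor2 A) : Prop :=
  forall i x, chart_img (A i) x -> forall p a b c,
    nabla3 (g2_metric phi i) (phi i) x p a b c =
    ctr (g2_metric phi i x) (fun l m => T i x p l * g2_psi phi i x m a b c).

(* Joint smoothness on ]-eps, eps[ x M; the values of [Phi] outside
   ]-eps, eps[ are irrelevant. *)
Definition smooth_family (eps : R) (Phi : R -> G2_structure) : Prop :=
  forall i (a b c : 'I_7),
    smooth_on [set tx : R^o * 'rV[R]_7 | `|tx.1| < eps /\ chart_img (A i) tx.2]
      (fun tx : R^o * 'rV[R]_7 => Phi tx.1 i tx.2 a b c).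

Definition VT (phi : G2_structure) (T : tensor2 A) (i : atlas_index A)
    (x : 'rV[R]_7) : 'I_7 -> R :=
  vecV (g2_metric phi i x) (phi i x) (T i x).

Definition trT (phi : G2_structure) (T : tensor2 A) (i : atlas_index A)
    (x : 'rV[R]_7) : R :=
  trace2 (g2_metric phi i x) (T i x).

Definition lagrangian (phi : G2_structure) (T : tensor2 A)
    (i : atlas_index A) (x : 'rV[R]_7) : R :=
  1 / 6 * scalar_curvature (g2_metric phi i) x
  - 1 / 6 * trT phi T i x ^+ 2
  - 1 / 3 * inner2 (g2_metric phi i x) (T i x) (T i x).

Definition P1_hat (phi : G2_structure) (T : tensor2 A) (i : atlas_index A)
    (x : 'rV[R]_7) : 'I_7 -> 'I_7 -> R := fun a b =>
  let g := g2_metric phi i in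
  - ricci g x a b
  - 1 / 3 * lie_metric g (VT phi T i) x a b
  - 2 / 3 * sym_part
      (compose2 (g x) (T i x) (hook3 (g x) (VT phi T i x) (phi i x))) a b
  + trT phi T i x * sym_part (T i x) a b.

Definition P2 (phi : G2_structure) (T : tensor2 A) (i : atlas_index A)
    (x : 'rV[R]_7) : 'I_7 -> R := fun k =>
  2 / 3 * div2 (g2_metric phi i) (T i) x k
  + 1 / 3 * grad (trT phi T i) x k
  + 1 / 3 * (trT phi T i x * VT phi T i x k).

Definition divergence_form (phi : G2_structure) (T h : tensor2 A)
    (X : tensor1 A) (i : atlas_index A) (x : 'rV[R]_7) : 'I_7 -> R := fun k =>
  let g := g2_metric phi i in
  - (1 / 3 * grad (fun y => trace2 (g y) (h i y)) x k)
  + 1 / 3 * div2 g (h i) x k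
  - 2 / 3 * vecV (g x) (phi i x) (compose2 (g x) (h i x) (T i x)) k
  - 2 / 3 * apply2 (g x) (T i x) (X i x) k
  - 1 / 3 * (trT phi T i x * X i x k).

End G2.

(* Main.v *)
Require Import Defs.
From HB Require Import structures.
From mathcomp Require Import all_boot all_order all_algebra all_fingroup.
From mathcomp Require Import all_classical all_reals all_analysis.
From mathcomp Require Import ssrZ zify ring lra.
From Stdlib Require BinNums BinInt.

Import Order.TTheory GRing.Theory Num.Theory.
Import numFieldNormedType.Exports.

Local Open Scope classical_set_scope.
Local Open Scope ring_scope.

(** Work in a chart and treat the parameter of the family as one more
    coordinate, so that all components are functions on an open subset of
    [R * R^7].  The metric and the volume form are smooth there: taking
    determinants in the compatibility identity gives [(-6)^7 vol^9] as a
    polynomial in [phi] ([vol_smooth], [G_smooth]).  Derivatives in time and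
    space therefore exist and commute ([schwarz]).

    In the direction of time, use the connection whose matrix is [h] with one
    index raised.  The metric is parallel for it, because the variation of the
    metric is [2 h] ([met_time]), and the derivative of [phi] is [X _| psi]
    ([phi_cov_time]); in the directions of space the derivative of [phi] is
    [T _| psi].  Since [psi = g g - g g - phi phi] ([ctr_phi_phi]), [psi] has in
    both cases the derivative [- X /\ phi], respectively [- T /\ phi]
    ([cov_psi]).  Covariant derivatives of contractions of tensors then follow
    a Leibniz rule on index expressions ([leibniz]), and the formula becomes an
    identity between contractions of [g], [phi], [psi], [T], [h], [X] and their
    covariant derivatives as soon as three quantities are known.

    - The variation of [T].  The torsion is a contraction of [nabla phi] with
      [psi], and the derivatives in time and in space of [phi] commute up to the
      curvature of the spacetime connection, which is the antisymmetrised
      [nabla h] ([dphi_cov_time], [tor_cov_time]).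
    - The Ricci tensor.  The commutator of two covariant derivatives of [phi] is
      expressed both by the curvature and, as [nabla phi = T _| psi], by
      [nabla T] and [T]; one contraction with [phi] and the first Bianchi
      identity give the Ricci tensor ([jet_ricci]).
    - The variation of the Ricci tensor, a divergence of the variation of the
      Levi-Civita connection ([Gam_time], [ricci_time]).

    What remains are pointwise tensor identities.  At each point there is a
    frame in which the metric is the identity and [phi] is a fixed model form
    ([adapted_frame]).  A tensor identity may be verified in such a frame
    ([tensor_identity]); there both sides are explicit polynomials in the
    components of the independent tensors, and they are compared by computation
    ([final_check] and the other checks).

    The adapted frame comes from the cross product defined by [phi].  For a unit
    vector [u], write [phi = u /\ Om + rho]; that the compatibility form is a
    multiple of the metric forces the square of [Om] to be a nonzero multiple of
    the identity on the orthogonal complement of [u] ([hitchin]).  Polarising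
    this, cross products of orthonormal vectors multiply like imaginary
    octonions, up to a common length ([cross_triple], [cross_polar]), and the
    frame generated by [e0], [e1] and a third vector [e3] is the one of the
    model ([normal_form]); the compatibility identity then gives the length [1]
    and the orientation. *)

Set Implicit Arguments.
Unset Strict Implicit.
Unset Printing Implicit Defensive.

(** * Sparse polynomials with integer coefficients *)

(** A variable stands for a component of a tensor: the list of its indices,
    followed by the identifier of the tensor when there are several. *)
Definition var := seq nat.
Definition mono := seq var.
Definition spoly := seq (BinNums.Z * mono).

Fixpoint ncmp (a b : nat) : comparison :=
  match a, b with
  | O, O => Eq | O, _ => Lt | _, O => Gt | S a, S b => ncmp a b
  end.

Section Lex.
Variables (T : Type) (cmp : T -> T -> comparison).
Fixpoint lexcmp (u v : seq T) : comparison :=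
  match u, v with
  | [::], [::] => Eq | [::], _ => Lt | _, [::] => Gt
  | x :: u', y :: v' =>
      match cmp x y with Eq => lexcmp u' v' | c => c end
  end.
End Lex.

Definition vcmp : var -> var -> comparison := lexcmp ncmp.
Definition mcmp : mono -> mono -> comparison := lexcmp vcmp.

Fixpoint mmul (m : mono) : mono -> mono :=
  fix aux (n : mono) : mono :=
    match m, n with
    | [::], _ => n
    | _, [::] => m
    | x :: m', y :: n' =>
        match vcmp x y with Gt => y :: aux n' | _ => x :: mmul m' n end
    end.

(** Polynomials are kept sorted by monomial without zero coefficients, so that a
    polynomial identity is proved by obtaining the empty list. *)
Fixpoint padd (p : spoly) : spoly -> spoly :=
  fix aux (q : spoly) : spoly :=
    match p, q with
    | [::], _ => q
    | _, [::] => p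
    | (c, m) :: p', (d, n) :: q' =>
        match mcmp m n with
        | Lt => (c, m) :: padd p' q
        | Gt => (d, n) :: aux q'
        | Eq => match (BinInt.Z.add c d) with
                | BinNums.Z0 => padd p' q'
                | e => (e, m) :: padd p' q'
                end
        end
    end.

Fixpoint ppairs (l : seq spoly) : seq spoly :=
  match l with
  | p :: q :: l' => padd p q :: ppairs l'
  | _ => l
  end.

(** Merge sort: the first argument bounds the number of passes. *)
Fixpoint psum (n : nat) (l : seq spoly) : spoly :=
  match l with
  | [::] => [::]
  | [:: p] => p
  | _ => if n is n'.+1 then psum n' (ppairs l) else foldr padd [::] l
  end.

Definition pscale (c : BinNums.Z) (p : spoly) : spoly :=
  match c with
  | BinNums.Z0 => [::]
  | _ => [seq ((BinInt.Z.mul c t.1), t.2) | t <- p]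
  end.

Definition pmul (p q : spoly) : spoly :=
  match p, q with
  | [::], _ => [::]
  | _, [::] => [::]
  | [:: (c, [::])], _ => pscale c q
  | _, [:: (c, [::])] => pscale c p
  | _, _ => psum 30 [seq [:: ((BinInt.Z.mul t.1 u.1), mmul t.2 u.2)] | t <- p, u <- q]
  end.

Definition pconst (c : BinNums.Z) : spoly := if c is BinNums.Z0 then [::] else [:: (c, [::])].
Definition pvar (v : var) : spoly := [:: (BinInt.Z.one, [:: v])].

Section Eval.
Variables (R : comNzRingType) (val : var -> R).

Definition zr (c : BinNums.Z) : R := (int_of_Z c)%:~R.
Definition meval (m : mono) : R := \prod_(v <- m) val v.
Definition peval (p : spoly) : R := \sum_(t <- p) zr t.1 * meval t.2.

Lemma zrD c d : zr (BinInt.Z.add c d) = zr c + zr d.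
Proof. by rewrite /zr -intrD; congr (_%:~R); lia. Qed.

Lemma zrM c d : zr (BinInt.Z.mul c d) = zr c * zr d.
Proof. by rewrite /zr -intrM; congr (_%:~R); lia. Qed.

Lemma ncmp_eq a b : ncmp a b = Eq -> a = b.
Proof. by elim: a b => [|a IH] [|b] //= /IH ->. Qed.

Lemma lexcmp_eq (T : Type) (cmp : T -> T -> comparison) :
  (forall x y, cmp x y = Eq -> x = y) ->
  forall u v, lexcmp cmp u v = Eq -> u = v.
Proof.
move=> cmpP; elim=> [|x u IH] [|y v] //=.
by case E: (cmp x y) => // /IH ->; rewrite (cmpP _ _ E).
Qed.

Lemma mcmp_eq m n : mcmp m n = Eq -> m = n.
Proof. exact/lexcmp_eq/lexcmp_eq/ncmp_eq. Qed.

Lemma meval_mul m n : meval (mmul m n) = meval m * meval n.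
Proof.
elim: m n => [|x m IHm] n; first by rewrite /meval big_nil mul1r; case: n.
elim: n => [|y n IHn]; first by rewrite /meval big_nil mulr1.
rewrite [mmul _ _]/=; case: (vcmp x y); rewrite /meval !big_cons -/(meval _) -/(meval _).
- by rewrite IHm /meval big_cons; ring.
- by rewrite IHm /meval big_cons; ring.
- by move: IHn; rewrite /= => ->; rewrite /meval big_cons; ring.
Qed.

Lemma peval_nil : peval [::] = 0.
Proof. by rewrite /peval big_nil. Qed.

Lemma peval_cons t p : peval (t :: p) = zr t.1 * meval t.2 + peval p.
Proof. by rewrite /peval big_cons. Qed.

Lemma peval_add p q : peval (padd p q) = peval p + peval q.
Proof.
elim: p q => [|[c m] p IHp] q; first by rewrite peval_nil add0r; case: q.
elim: q => [|[d n] q IHq]; first by rewrite peval_nil addr0.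
rewrite [padd _ _]/=; case E: (mcmp m n).
- have <- := mcmp_eq E.
  have H : peval ((c, m) :: p) + peval ((d, m) :: q)
         = zr (BinInt.Z.add c d) * meval m + (peval p + peval q).
    by rewrite !peval_cons /= zrD; ring.
  rewrite H -IHp; case: (BinInt.Z.add c d) => [|e|e].
  + by rewrite /zr /= mulr0z mul0r add0r.
  + by rewrite peval_cons.
  + by rewrite peval_cons.
- by rewrite peval_cons IHp [peval ((c, m) :: p)]peval_cons addrA.
- by rewrite peval_cons; move: IHq => /= ->; rewrite !peval_cons /=; ring.
Qed.

Lemma peval_sum n l : peval (psum n l) = \sum_(p <- l) peval p.
Proof.
have pairs : forall k l, (size l <= k)%N ->
    \sum_(p <- ppairs l) peval p = \sum_(p <- l) peval p.
  elim=> [|k IH] [|p [|q s]] //= lek.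
  by rewrite !big_cons peval_add IH ?addrA //; apply: ltnW.
elim: n l => [|n IH] [|p [|q l]];
  rewrite /= ?big_nil ?big_seq1 ?(pairs _ _ (leqnn _)) //; first by rewrite /peval big_nil.
- rewrite -[RHS]/(\sum_(i <- [:: p, q & l]) peval i).
  rewrite -[padd _ _]/(foldr padd [::] [:: p, q & l]).
  by elim: [:: p, q & l] => [|x s IHs]; rewrite /= ?big_nil ?big_cons ?peval_add ?IHs // /peval big_nil.
- by rewrite /peval big_nil.
- by rewrite -[_ :: ppairs l]/(ppairs [:: p, q & l]) IH (pairs _ _ (leqnn _)).
Qed.

Lemma peval_scale c p : peval (pscale c p) = zr c * peval p.
Proof.
have H : peval [seq ((BinInt.Z.mul c t.1), t.2) | t <- p] = zr c * peval p.
  rewrite /peval big_map mulr_sumr; apply: eq_bigr => t _ /=.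
  by rewrite zrM mulrA.
case: c H => [|c|c] // _.
by rewrite /peval big_nil /zr /= mulr0z mul0r.
Qed.

Lemma peval_const c : peval (pconst c) = zr c.
Proof.
by case: c => [|c|c]; rewrite /peval ?big_nil ?big_seq1 /= ?/meval ?big_nil ?mulr1.
Qed.

Lemma peval_var v : peval (pvar v) = val v.
Proof. by rewrite /peval big_seq1 /meval big_seq1 /zr /= mul1r. Qed.

Lemma peval_mul p q : peval (pmul p q) = peval p * peval q.
Proof.
have gen : peval (psum 30 [seq [:: ((BinInt.Z.mul t.1 u.1), mmul t.2 u.2)] | t <- p, u <- q])
    = peval p * peval q.
  rewrite peval_sum big_allpairs_dep /= /peval mulr_suml.
  apply: eq_bigr => t _; rewrite mulr_sumr; apply: eq_bigr => u _.
  by rewrite big_seq1 /= zrM meval_mul; ring.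
have c1 c : peval [:: (c, [::])] = zr c.
  by rewrite /peval big_seq1 /meval big_nil mulr1.
case: p gen => [|[c [|x m]] p] gen; first by rewrite /peval big_nil mul0r.
  case: p gen => [|t p] gen.
    by case: q gen => [|u q] _ ; rewrite c1 ?peval_scale //= /peval big_nil mulr0.
  case: q gen => [|[d [|y n]] [|u q]] gen //; first by rewrite /peval big_nil mulr0.
  by rewrite [pmul _ _]/pmul peval_scale c1 mulrC.
case: q gen => [|[d [|y n]] [|u q]] gen; do ?[exact: gen].
- by rewrite [RHS]mulrC peval_nil mul0r; case: p gen => [|? ?] _; rewrite ?peval_nil.
- have -> : pmul ((c, x :: m) :: p) [:: (d, [::])] = pscale d ((c, x :: m) :: p).
    by case: p gen.
  by rewrite peval_scale c1 mulrC.
Qed.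

End Eval.

(** * Tensor expressions and frames *)

(** Index expressions: [At id args] is the component of the tensor [id] at the
    indices named in [args], and [Ctr p q e] contracts the index names [p] and
    [q] of [e] with the metric. *)
Inductive texp :=
  | At of nat & seq nat
  | Cst of BinNums.Z
  | Opp of texp
  | Add of texp & texp
  | Mul of texp & texp
  | Ctr of nat & nat & texp.

Definition upd (T : Type) (r : nat -> T) (n : nat) (x : T) : nat -> T :=
  fun m => if eqn m n then x else r m.

Lemma updE (T : Type) (r : nat -> T) n x m :
  upd r n x m = if m == n then x else r m.
Proof. by []. Qed.

Fixpoint fv (e : texp) : seq nat :=
  match e with
  | At _ args => args
  | Cst _ => [::]
  | Opp a => fv a
  | Add a _ => fv a
  | Mul a b => fv a ++ fv b
  | Ctr p q a => [seq n <- fv a | (n != p) && (n != q)]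
  end.

(** Every index name occurs once in each product, and the terms of a sum have the
    same free indices.  This makes the value linear in each free index. *)
Fixpoint wf (e : texp) : bool :=
  match e with
  | At _ args => uniq args
  | Cst _ => true
  | Opp a => wf a
  | Add a b => [&& wf a, wf b & perm_eq (fv a) (fv b)]
  | Mul a b => [&& wf a, wf b & uniq (fv a ++ fv b)]
  | Ctr p q a => [&& wf a, p != q, p \in fv a & q \in fv a]
  end.

Lemma wf_uniq e : wf e -> uniq (fv e).
Proof.
elim: e => //= [a IHa b IHb /andP[/IHa] //|a _ b _ /and3P[] //|p q a IH].
by case/and4P => /IH u *; rewrite filter_uniq.
Qed.

Section Denotation.
Variable R : realType.
Notation ten1 := ('I_7 -> R).
Notation ten2 := ('I_7 -> 'I_7 -> R).
Implicit Types (env : nat -> seq 'I_7 -> R) (v : nat -> ten1).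

Fixpoint den (g : ten2) env (r : nat -> 'I_7) (e : texp) : R :=
  match e with
  | At id args => env id [seq r n | n <- args]
  | Cst c => zr R c
  | Opp a => - den g env r a
  | Add a b => den g env r a + den g env r b
  | Mul a b => den g env r a * den g env r b
  | Ctr p q a => ctr g (fun i j => den g env (upd (upd r p i) q j) a)
  end.

(** Multilinear extension: the value of the tensor with components [A] on
    vectors. *)
Fixpoint ext (A : seq 'I_7 -> R) (vs : seq ten1) : R :=
  if vs is v :: vs' then \sum_i v i * ext (fun s => A (i :: s)) vs'
  else A [::].

Definition evec (i : 'I_7) : ten1 := fun j => (j == i)%:R.

Fixpoint vden (E : 'I_7 -> ten1) env v (e : texp) : R :=
  match e with
  | At id args => ext (env id) [seq v n | n <- args]
  | Cst c => zr R c
  | Opp a => - vden E env v a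
  | Add a b => vden E env v a + vden E env v b
  | Mul a b => vden E env v a * vden E env v b
  | Ctr p q a => \sum_s vden E env (upd (upd v p (E s)) q (E s)) a
  end.

Lemma ext_evec A s : ext A [seq evec i | i <- s] = A s.
Proof.
elim: s A => //= i s IH A.
rewrite (bigD1 i) //= /evec eqxx mul1r IH big1 ?addr0 // => j ji.
by rewrite (negbTE ji) mul0r.
Qed.

Lemma ext_eq A B vs : A =1 B -> ext A vs = ext B vs.
Proof.
elim: vs A B => [|v vs IH] A B AB /=; first exact: AB.
by apply: eq_bigr => i _; congr (_ * _); apply: IH => s; apply: AB.
Qed.

Lemma ext_sum (c : 'I_7 -> R) (B : 'I_7 -> seq 'I_7 -> R) vs :
  ext (fun s => \sum_i c i * B i s) vs = \sum_i c i * ext (B i) vs.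
Proof.
elim: vs B => [|v vs IH] B //=.
under eq_bigr do rewrite IH mulr_sumr.
rewrite exchange_big /=; apply: eq_bigr => i _; rewrite mulr_sumr.
by apply: eq_bigr => j _; rewrite mulrCA.
Qed.

Lemma ext_lin A v n args (c : 'I_7 -> R) (u : 'I_7 -> ten1) :
  uniq args -> n \in args -> v n =1 (fun i => \sum_s c s * u s i) ->
  ext A [seq v m | m <- args] =
  \sum_s c s * ext A [seq upd v n (u s) m | m <- args].
Proof.
move=> + + vn; elim: args A => [//|m args IH] A /= /andP[mN uargs].
rewrite inE => /predU1P[mn|nargs].
  rewrite -{m}mn in mN *.
  under eq_bigr do rewrite vn mulr_suml.
  rewrite exchange_big; apply: eq_bigr => s _ /=.
  rewrite mulr_sumr; apply: eq_bigr => i _; rewrite {1}updE eqxx mulrA.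
  congr (_ * ext _ _); apply/eq_in_map => k kargs.
  by rewrite !updE; case: eqP kargs mN => // -> ->.
have mn : m != n by apply: contraNneq mN => ->.
under eq_bigr do rewrite IH // mulr_sumr.
rewrite exchange_big; apply: eq_bigr => s _; rewrite mulr_sumr.
by apply: eq_bigr => i _; rewrite [upd v n _ m]updE (negbTE mn) mulrCA.
Qed.

Lemma den_eq g env r r' e : wf e ->
  {in fv e, r =1 r'} -> den g env r e = den g env r' e.
Proof.
elim: e r r' => //= [id args|a IH|a IHa b IHb|a IHa b IHb|p q a IH] r r'.
- by move=> _ rr; congr env; apply/eq_in_map.
- by move=> wa rr; rewrite (IH _ r').
- case/and3P => wa wb ab rr; rewrite (IHa _ r') ?(IHb _ r') // => n nb.
  by apply: rr; rewrite (perm_mem ab).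
- case/and3P => wa wb _ rr; rewrite (IHa _ r') ?(IHb _ r') // => n nb;
  by apply: rr; rewrite mem_cat nb ?orbT.
- case/and4P => wa _ _ _ rr; apply: eq_bigr => i _; apply: eq_bigr => j _.
  congr (_ * _); apply: IH => // n na.
  rewrite !updE; case: eqP => // /eqP nq; case: eqP => // /eqP np.
  by apply: rr; rewrite mem_filter np nq.
Qed.

Lemma vden_eq E env v v' e : wf e ->
  {in fv e, v =1 v'} -> vden E env v e = vden E env v' e.
Proof.
elim: e v v' => //= [id args|a IH|a IHa b IHb|a IHa b IHb|p q a IH] v v'.
- by move=> _ vv; congr ext; apply/eq_in_map.
- by move=> wa vv; rewrite (IH _ v').
- case/and3P => wa wb ab vv; rewrite (IHa _ v') ?(IHb _ v') // => n nb.
  by apply: vv; rewrite (perm_mem ab).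
- case/and3P => wa wb _ vv; rewrite (IHa _ v') ?(IHb _ v') // => n nb;
  by apply: vv; rewrite mem_cat nb ?orbT.
- case/and4P => wa _ _ _ vv; apply: eq_bigr => s _; apply: IH => // n na.
  rewrite !updE; case: eqP => // /eqP nq; case: eqP => // /eqP np.
  by apply: vv; rewrite mem_filter np nq.
Qed.

(** Linearity in one free index: the index occurs in one factor of a product only,
    and the contraction indices are different from it. *)
Lemma vden_lin E env v e n (c : 'I_7 -> R) (u : 'I_7 -> ten1) :
  wf e -> n \in fv e -> v n =1 (fun i => \sum_s c s * u s i) ->
  vden E env v e = \sum_s c s * vden E env (upd v n (u s)) e.
Proof.
elim: e v => //= [id args|a IH|a IHa b IHb|a IHa b IHb|p q a IH] v.
- exact: ext_lin.
- move=> wa na vn; rewrite IH // -sumrN; apply: eq_bigr => s _.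
  by rewrite mulrN.
- case/and3P => wa wb ab na vn; rewrite IHa // IHb // -?(perm_mem ab) //.
  by rewrite -big_split; apply: eq_bigr => s _; rewrite mulrDr.
- case/and3P => wa wb; rewrite cat_uniq => /and3P[_ /hasPn ab _].
  rewrite mem_cat => /orP[] nn vn.
  + rewrite IHa // mulr_suml; apply: eq_bigr => s _; rewrite mulrA.
    congr (_ * _); apply: vden_eq => // m /ab mb; rewrite !updE.
    by case: eqP => // mn; case/negP: mb; rewrite mn.
  + rewrite IHb // mulr_sumr; apply: eq_bigr => s _; rewrite mulrCA.
    congr (_ * (_ * _)); apply: vden_eq => // m ma; rewrite !updE.
    by case: eqP => // mn; case/negP: (ab _ nn); rewrite -mn.
- case/and4P => wa pq pa qa; rewrite mem_filter => /andP[/andP[np nq] na] vn.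
  have step t := IH (upd (upd v p (E t)) q (E t)) wa na.
  under eq_bigr => t _.
    rewrite step; first over.
    by move=> i; rewrite !updE (negbTE np) (negbTE nq) vn.
  rewrite exchange_big; apply: eq_bigr => s _; rewrite mulr_sumr.
  apply: eq_bigr => t _; congr (_ * _); apply: vden_eq => // m _.
  rewrite !updE; case: (eqVneq m n) => [->|]; first by rewrite (negbTE nq) (negbTE np).
  by [].
Qed.

Lemma evec_sum (u : ten1) : u =1 (fun i => \sum_s u s * evec s i).
Proof.
move=> i; rewrite (bigD1 i) //= /evec eqxx mulr1 big1 ?addr0 // => j ji.
by rewrite eq_sym (negbTE ji) mulr0.
Qed.

(** Writing the inverse metric as a sum of squares of frame vectors turns each
    contraction into a sum over the frame, evaluated on coordinate vectors. *)
Lemma den_vden g E env r e : wf e ->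
  (forall p q, metric_inv g p q = \sum_s E s p * E s q) ->
  den g env r e = vden E env (fun n => evec (r n)) e.
Proof.
move=> + gE; elim: e r => //= [id args|a IH|a IHa b IHb|a IHa b IHb|p q a IH] r.
- by move=> _; rewrite -ext_evec -map_comp.
- by move=> /IH ->.
- by case/and3P => /IHa -> /IHb ->.
- by case/and3P => /IHa -> /IHb ->.
- case/and4P => wa pq pa qa.
  have lin s : vden E env (upd (upd (fun n => evec (r n)) p (E s)) q (E s)) a =
      \sum_i \sum_j E s i * E s j *
        vden E env (fun n => evec (upd (upd r p i) q j n)) a.
    rewrite (@vden_lin _ _ _ _ q (E s) evec) //; last first.
      by move=> i; rewrite !updE eqxx -evec_sum.
    rewrite exchange_big; apply: eq_bigr => j _ /=.
    rewrite (@vden_lin _ _ _ _ p (E s) evec) //; last first.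
      by move=> i; rewrite !updE eqxx (negbTE pq) -evec_sum.
    rewrite mulr_sumr; apply: eq_bigr => i _.
    rewrite mulrA [E s j * _]mulrC; congr (_ * _); apply: vden_eq => // m _.
    rewrite !updE; case: (eqVneq m p) => [->|mp]; first by rewrite (negbTE pq).
    by case: eqP.
  under [RHS]eq_bigr do rewrite lin.
  rewrite exchange_big; apply: eq_bigr => i _ /=.
  rewrite exchange_big; apply: eq_bigr => j _ /=.
  by rewrite -mulr_suml gE IH.
Qed.

(** A tensor expression vanishes identically as soon as it vanishes on all
    tuples of vectors of one basis, being linear in each free index. *)
Lemma vden_multilinear0 E env e (B : 'I_7 -> ten1) (C : 'I_7 -> 'I_7 -> R) :
  wf e -> (forall i j, evec i j = \sum_s C i s * B s j) ->
  (forall s : nat -> 'I_7, vden E env (fun n => B (s n)) e = 0) ->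
  forall v, vden E env v e = 0.
Proof.
move=> we BC B0 v.
pose c n s := \sum_i v n i * C i s.
have vB n : v n =1 (fun j => \sum_s c n s * B s j).
  move=> j; rewrite {1}evec_sum /c.
  under eq_bigr do rewrite BC mulr_sumr.
  rewrite exchange_big; apply: eq_bigr => s _ /=; rewrite mulr_suml.
  by apply: eq_bigr => i _; rewrite mulrA.
pose mix (ns : seq nat) s n := if n \in ns then v n else B (s n).
suff mix0 ns s : uniq ns -> {subset ns <= fv e} -> vden E env (mix ns s) e = 0.
  have := mix0 (fv e) (fun=> ord0) (wf_uniq we) (fun n => id).
  by rewrite (@vden_eq _ _ _ v) // => n ne; rewrite /mix ne.
elim: ns s => [|n ns IH] s /=; first by move=> _ _; apply: B0.
case/andP => nns uns sub.
rewrite (@vden_lin _ _ _ _ n (c n) B) ?sub ?mem_head //; last first.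
  by move=> i; rewrite /mix mem_head vB.
rewrite big1 // => t _.
rewrite (@vden_eq _ _ _ (mix ns (upd s n t))) ?IH ?mulr0 //.
  by move=> m mns; apply: sub; rewrite inE mns orbT.
move=> m _; rewrite /mix !updE inE; case: eqP => [->|//] /=.
by rewrite (negbTE nns).
Qed.

(** In an orthonormal frame contractions become plain sums over the frame. *)
Fixpoint fden (env : nat -> seq 'I_7 -> R) (s : nat -> 'I_7) (e : texp) : R :=
  match e with
  | At id args => env id [seq s n | n <- args]
  | Cst c => zr R c
  | Opp a => - fden env s a
  | Add a b => fden env s a + fden env s b
  | Mul a b => fden env s a * fden env s b
  | Ctr p q a => \sum_t fden env (upd (upd s p t) q t) a
  end.

Definition frame_env (E : 'I_7 -> ten1) env : nat -> seq 'I_7 -> R :=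
  fun id s => ext (env id) [seq E i | i <- s].

Lemma vden_frame E env s e :
  vden E env (fun n => E (s n)) e = fden (frame_env E env) s e.
Proof.
have ve v v' e' : v =1 v' -> vden E env v e' = vden E env v' e'.
  elim: e' v v' => //= [id args|a IH|a IHa b IHb|a IHa b IHb|p q a IH] v v' vv.
  - by congr ext; apply: eq_map.
  - by rewrite (IH _ _ vv).
  - by rewrite (IHa _ _ vv) (IHb _ _ vv).
  - by rewrite (IHa _ _ vv) (IHb _ _ vv).
  - by apply: eq_bigr => t _; apply: IH => n; rewrite !updE vv.
elim: e s => //= [id args|a IH|a IHa b IHb|a IHa b IHb|p q a IH] s.
- by rewrite /frame_env -map_comp.
- by rewrite IH.
- by rewrite IHa IHb.
- by rewrite IHa IHb.
- apply: eq_bigr => t _; rewrite -IH; apply: ve => n.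
  by rewrite !updE; case: eqP => // _; case: eqP.
Qed.

Definition idx7 := iota 0 7.

(** The value in a frame as a polynomial; the case of a vanishing left factor is
    decided before the right factor is computed, which pays off because the
    components of the model form are sparse. *)
Fixpoint pev (penv : nat -> seq nat -> spoly) (s : nat -> nat) (e : texp) : spoly :=
  match e with
  | At id args => penv id [seq s n | n <- args]
  | Cst c => pconst c
  | Opp a => pscale (BinInt.Z.opp BinInt.Z.one) (pev penv s a)
  | Add a b => padd (pev penv s a) (pev penv s b)
  | Mul a b =>
      let p := pev penv s a in
      if p is [::] then [::] else pmul p (pev penv s b)
  | Ctr p q a =>
      psum 3 [seq pev penv (upd (upd s p t) q t) a | t <- idx7]
  end.

Lemma pevE penv s :
  ((forall id args, pev penv s (At id args) = penv id [seq s n | n <- args]) *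
   (forall c, pev penv s (Cst c) = pconst c) *
   (forall a, pev penv s (Opp a) =
      pscale (BinInt.Z.opp BinInt.Z.one) (pev penv s a)) *
   (forall a b, pev penv s (Add a b) = padd (pev penv s a) (pev penv s b)) *
   (forall a b, pev penv s (Mul a b) =
      if pev penv s a is [::] then [::]
      else pmul (pev penv s a) (pev penv s b)) *
   (forall p q a, pev penv s (Ctr p q a) =
      psum 3 [seq pev penv (upd (upd s p t) q t) a | t <- idx7]))%type.
Proof. by []. Qed.

Lemma pev_eq penv s s' e : s =1 s' -> pev penv s e = pev penv s' e.
Proof.
elim: e s s' => [id args|c|a IH|a IHa b IHb|a IHa b IHb|p q a IH] s s' ss;
  rewrite !pevE.
- by congr penv; apply: eq_map.
- by [].
- by rewrite (IH _ _ ss).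
- by rewrite (IHa _ _ ss) (IHb _ _ ss).
- by rewrite (IHa _ _ ss) (IHb _ _ ss).
- congr psum; apply: eq_map => n.
  by apply: IH => k; rewrite !updE; case: eqP => // _; case: eqP.
Qed.

Lemma big_iota7 (F : nat -> R) : \sum_(t <- idx7) F t = \sum_(t < 7) F t.
Proof. by rewrite -(big_mkord xpredT) /index_iota subn0. Qed.

Lemma fden_pev (val : var -> R) penv env s e :
  (forall id idx, env id idx = peval val (penv id [seq nat_of_ord i | i <- idx])) ->
  fden env s e = peval val (pev penv (fun n => nat_of_ord (s n)) e).
Proof.
move=> H; elim: e s => [id args|c|a IH|a IHa b IHb|a IHa b IHb|p q a IH] s;
  rewrite !pevE [fden _ _ _]/fden -/fden.
- by rewrite H -map_comp.
- by rewrite peval_const.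
- by rewrite peval_scale IH /zr /= mulN1r.
- by rewrite peval_add IHa IHb.
- rewrite IHa IHb; case: (pev _ _ a) => [|t p]; first by rewrite peval_nil mul0r.
  by rewrite peval_mul.
- rewrite peval_sum big_map big_iota7.
  apply: eq_bigr => t _; rewrite IH; congr peval; apply: pev_eq => n.
  by rewrite !updE; case: eqP => // _; case: eqP.
Qed.

Fixpoint vanishes penv (ns : seq nat) (s : nat -> nat) (e : texp) : bool :=
  if ns is n :: ns' then
    all (fun t => vanishes penv ns' (upd s n t) e) idx7
  else if pev penv s e is [::] then true else false.

Lemma vanishesP (val : var -> R) penv env ns s0 (s : nat -> 'I_7) e :
  (forall id idx, env id idx = peval val (penv id [seq nat_of_ord i | i <- idx])) ->
  vanishes penv ns s0 e -> (forall n, n \notin ns -> s0 n = s n :> nat) ->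
  fden env s e = 0.
Proof.
move=> H; elim: ns s0 => [|n ns IH] s0.
  rewrite /vanishes => + s0s; rewrite (fden_pev _ _ H) (@pev_eq _ _ s0) => [|n]; last by rewrite s0s.
  by case: (pev _ _ _) => // _; rewrite peval_nil.
rewrite [vanishes _ _ _ _]/vanishes -/vanishes => /seq.allP all0 s0s.
have /all0 /IH : nat_of_ord (s n) \in idx7 by rewrite mem_iota add0n ltn_ord.
apply.
move=> m mns; rewrite !updE; case: eqP => [->//|/eqP mn]; apply: s0s.
by rewrite inE negb_or mn.
Qed.

End Denotation.

(** * The Leibniz rule for tensor expressions *)

Section DirectionalDerivative.
Variables (R : realType) (V : normedModType R) (z w : V).

Definition dder (f : V -> R) (df : R) := is_derive z w (f : V -> R^o) (df : R^o).

Lemma dder_eq f df df' : dder f df -> df = df' -> dder f df'.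
Proof. by move=> ? <-. Qed.

Lemma dder_val f df : dder f df -> 'D_w (f : V -> R^o) z = df.
Proof. by case. Qed.

Lemma dder_cst c : dder (fun=> c) 0.
Proof. exact: is_derive_cst. Qed.

Lemma dderD f g df dg : dder f df -> dder g dg ->
  dder (fun y => f y + g y) (df + dg).
Proof. exact: is_deriveD. Qed.

Lemma dderN f df : dder f df -> dder (fun y => - f y) (- df).
Proof. exact: is_deriveN. Qed.

Lemma dderM f g df dg : dder f df -> dder g dg ->
  dder (fun y => f y * g y) (df * g z + f z * dg).
Proof.
move=> Hf Hg; apply: (dder_eq (is_deriveM Hf Hg)).
by rewrite addrC /GRing.scale /= [g z * _]mulrC.
Qed.

Lemma dder_sum (I : eqType) (s : seq I) (f : I -> V -> R) (df : I -> R) :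
  (forall i, i \in s -> dder (f i) (df i)) ->
  dder (fun y => \sum_(i <- s) f i y) (\sum_(i <- s) df i).
Proof.
elim: s => [|i s IH] H.
  rewrite big_nil; have -> : (fun y => \sum_(i <- [::]) f i y) = (fun=> 0).
    by apply/funext => y; rewrite big_nil.
  exact: dder_cst.
rewrite big_cons; have -> : (fun y => \sum_(j <- i :: s) f j y) =
    (fun y => f i y + \sum_(j <- s) f j y).
  by apply/funext => y; rewrite big_cons.
apply: dderD; first by apply: H; rewrite mem_head.
by apply: IH => j js; apply: H; rewrite inE js orbT.
Qed.

Lemma dder_sum_ord n (f : 'I_n -> V -> R) (df : 'I_n -> R) :
  (forall i, dder (f i) (df i)) ->
  dder (fun y => \sum_i f i y) (\sum_i df i).
Proof. by move=> H; apply: dder_sum. Qed.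

End DirectionalDerivative.

Section Leibniz.
Variables (R : realType) (V : normedModType R) (z w : V).
Notation ten2 := ('I_7 -> 'I_7 -> R).
Variables (g : V -> ten2) (env : V -> nat -> seq 'I_7 -> R).
Variable env1 : nat -> seq 'I_7 -> R.
Variables (Gam : ten2) (dd : nat -> nat) (extra : seq nat) (xs : seq 'I_7).

(** Action of the connection matrix on the components of a covariant tensor. *)
Fixpoint act (G : ten2) (A : seq 'I_7 -> R) (s : seq 'I_7) : R :=
  if s is i :: s' then
    \sum_m G m i * A (m :: s') + act G (fun t => A (i :: t)) s'
  else 0.

Lemma act_upd G A r args : uniq args ->
  act G A [seq r n | n <- args] =
  \sum_(n <- args) \sum_m G m (r n) * A [seq upd r n m k | k <- args].
Proof.
elim: args A => [|n args IH] A; first by rewrite big_nil.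
rewrite [uniq _]/= => /andP[nN u]; rewrite big_cons /= IH //; congr (_ + _).
  apply: eq_bigr => m _; congr (_ * A (_ :: _)); first by rewrite !updE eqxx.
  by apply/eq_in_map => k ka; rewrite !updE; case: eqP ka nN => // -> ->.
rewrite !big_seq; apply: eq_bigr => k ka; apply: eq_bigr => m _.
congr (_ * A (_ :: _)); rewrite !updE; case: eqP ka nN => // -> -> //.
Qed.

Fixpoint ids (e : texp) : seq nat :=
  match e with
  | At id _ => [:: id]
  | Cst _ => [::]
  | Opp a => ids a
  | Add a b => ids a ++ ids b
  | Mul a b => ids a ++ ids b
  | Ctr p q a => ids a
  end.

Fixpoint bound (e : texp) : seq nat :=
  match e with
  | At id _ => [::]
  | Cst _ => [::]
  | Opp a => bound a
  | Add a b => bound a ++ bound b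
  | Mul a b => bound a ++ bound b
  | Ctr p q a => [:: p, q & bound a]
  end.

(** The differentiated expression: [dd] renames a tensor to its derivative, and
    [extra] is the index of differentiation, absent for derivatives in time. *)
Fixpoint der (e : texp) : texp :=
  match e with
  | At id args => At (dd id) (extra ++ args)
  | Cst _ => Cst BinNums.Z0
  | Opp a => Opp (der a)
  | Add a b => Add (der a) (der b)
  | Mul a b =>
      if a is Cst _ then Mul a (der b)
      else Add (Mul (der a) b) (Mul a (der b))
  | Ctr p q a => Ctr p q (der a)
  end.

Hypothesis inv_der : forall p q,
  dder z w (fun y => metric_inv (g y) p q)
    (- \sum_m (Gam p m * metric_inv (g z) m q + Gam q m * metric_inv (g z) p m)).

Definition compatible (e : texp) := forall id s, id \in ids e ->
  env1 id s = env z id s /\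
  dder z w (fun y => env y id s) (env1 (dd id) (xs ++ s) + act Gam (env z id) s).

Lemma den_env1 e r : compatible e -> den (g z) env1 r e = den (g z) (env z) r e.
Proof.
elim: e r => [id args|c|a IH|a IHa b IHb|a IHa b IHb|p q a IH] r He /=.
- by apply: (He _ _ _).1; rewrite mem_head.
- by [].
- by rewrite IH.
- by rewrite IHa ?IHb // => id s ids; apply: He; rewrite /= mem_cat ids ?orbT.
- by rewrite IHa ?IHb // => id s ids; apply: He; rewrite /= mem_cat ids ?orbT.
- by apply: eq_bigr => i _; apply: eq_bigr => j _; rewrite IH.
Qed.

(** The terms with the connection matrix that come from the inverse metric cancel
    those of the two contracted indices; those of the free indices remain. *)
Lemma leibniz e r :
  wf e -> [seq r n | n <- extra] = xs ->
  (forall n, n \in extra -> n \notin bound e) -> compatible e ->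
  dder z w (fun y => den (g y) (env y) r e)
    (den (g z) env1 r (der e) +
     \sum_(n <- fv e) \sum_m Gam m (r n) * den (g z) (env z) (upd r n m) e).
Proof.
elim: e r => [id args|c|a IH|a IHa b IHb|a IHa b IHb|p q a IH] r.
- move=> u rx _ He; have [_ H] := He id [seq r n | n <- args] (mem_head _ _).
  by apply: (dder_eq H); rewrite /= map_cat rx act_upd.
- by move=> _ _ _ _ /=; rewrite big_nil addr0 /zr /= mulr0z; exact: dder_cst.
- move=> /= wa rx fr He; apply: (dder_eq (dderN (IH r wa rx fr He))).
  rewrite opprD; congr (_ + _); rewrite -sumrN; apply: eq_bigr => n _.
  by rewrite -sumrN; apply: eq_bigr => m _; rewrite mulrN.
- move=> /= /and3P[wa wb ab] rx fr He.
  have Ha : compatible a.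
    by move=> id s ia; apply: He; rewrite /= mem_cat ia.
  have Hb : compatible b.
    by move=> id s ia; apply: He; rewrite /= mem_cat ia orbT.
  have fra n : n \in extra -> n \notin bound a.
    by move=> /fr; rewrite mem_cat negb_or => /andP[].
  have frb n : n \in extra -> n \notin bound b.
    by move=> /fr; rewrite mem_cat negb_or => /andP[].
  apply: (dder_eq (dderD (IHa r wa rx fra Ha) (IHb r wb rx frb Hb))).
  rewrite addrACA; congr (_ + _); rewrite -(perm_big _ ab) -big_split /=.
  apply: eq_bigr => n _; rewrite -big_split; apply: eq_bigr => m _ /=.
  by rewrite mulrDr.
- move=> /= /and3P[wa wb uab] rx fr He.
  have Ha : compatible a.
    by move=> id s ia; apply: He; rewrite /= mem_cat ia.
  have Hb : compatible b.
    by move=> id s ia; apply: He; rewrite /= mem_cat ia orbT.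
  have fra n : n \in extra -> n \notin bound a.
    by move=> /fr; rewrite mem_cat negb_or => /andP[].
  have frb n : n \in extra -> n \notin bound b.
    by move=> /fr; rewrite mem_cat negb_or => /andP[].
  apply: (dder_eq (dderM (IHa r wa rx fra Ha) (IHb r wb rx frb Hb))).
  have -> : den (g z) env1 r
      (if a is Cst _ then Mul a (der b) else Add (Mul (der a) b) (Mul a (der b))) =
      den (g z) env1 r (der a) * den (g z) (env z) r b +
      den (g z) (env z) r a * den (g z) env1 r (der b).
    case: {IHa wa uab He fra fr} a Ha => [id args|c|a|a a'|a a'|p q a] Ha;
      rewrite -(den_env1 _ Hb) -(den_env1 _ Ha) //=.
    by rewrite /zr /= mulr0z mul0r add0r.
  move: uab; rewrite cat_uniq => /and3P[_ /hasPn ab _].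
  rewrite big_cat /= mulrDl mulrDr addrACA; congr (_ + (_ + _)).
    rewrite mulr_suml !big_seq; apply: eq_bigr => n na.
    rewrite mulr_suml; apply: eq_bigr => m _; rewrite -mulrA; congr (_ * (_ * _)).
    apply: den_eq => // k kb; rewrite !updE; case: eqP => // kn.
    by case/negP: (ab _ kb); rewrite kn.
  rewrite mulr_sumr !big_seq; apply: eq_bigr => n nb.
  rewrite mulr_sumr; apply: eq_bigr => m _; rewrite mulrCA; congr (_ * (_ * _)).
  apply: den_eq => // k ka; rewrite !updE; case: eqP => // kn.
  by case/negP: (ab _ nb); rewrite -kn.
- move=> /= /and4P[wa pq pa qa] rx fr He.
  set rest := [seq n <- fv a | _].
  pose F i j r := den (g z) (env z) (upd (upd r p i) q j) a.
  have fvE : perm_eq (fv a) [:: p, q & rest].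
    apply: uniq_perm; first exact: wf_uniq.
      rewrite /= !inE !mem_filter !eqxx /= andbF orbF pq /=.
      by rewrite filter_uniq ?wf_uniq.
    move=> n; rewrite !inE mem_filter; case: (eqVneq n p) => [->|np] //=.
    by case: (eqVneq n q) => [->|].
  have frpq n : n \in extra -> [/\ n != p, n != q & n \notin bound a].
    by move=> /fr; rewrite !inE !negb_or => /and3P[].
  have IH' i j : dder z w
      (fun y => den (g y) (env y) (upd (upd r p i) q j) a)
      (den (g z) env1 (upd (upd r p i) q j) (der a) +
       (\sum_m Gam m i * F m j r + \sum_m Gam m j * F i m r +
        \sum_(n <- rest) \sum_m Gam m (r n) * F i j (upd r n m))).
    have Hx : [seq upd (upd r p i) q j n | n <- extra] = xs.
      rewrite -rx; apply/eq_in_map => n /frpq[np nq _].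
      by rewrite !updE (negbTE np) (negbTE nq).
    apply: (dder_eq (IH _ wa Hx _ He)); first by move=> n /frpq[].
    congr (_ + _); rewrite (perm_big _ fvE) !big_cons /= addrA.
    congr (_ + _ + _).
    + apply: eq_bigr => m _; rewrite {1}updE (negbTE pq) {1}updE eqxx.
      congr (_ * _); apply: den_eq => // k _; rewrite !updE.
      by case: (eqVneq k p) => [->|//]; rewrite (negbTE pq).
    + apply: eq_bigr => m _; rewrite {1}updE eqxx; congr (_ * _).
      by apply: den_eq => // k _; rewrite !updE; case: eqP.
    + rewrite !big_seq; apply: eq_bigr => n.
      rewrite mem_filter => /andP[/andP[np nq] _]; apply: eq_bigr => m _.
      rewrite {1}updE (negbTE nq) {1}updE (negbTE np); congr (_ * _).
      apply: den_eq => // k _; rewrite !updE.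
      case: (eqVneq k n) => [->|//]; by rewrite (negbTE nq) (negbTE np).
  rewrite /ctr.
  apply: dder_eq.
    apply: dder_sum_ord => i; apply: dder_sum_ord => j.
    exact: (dderM (inv_der i j) (IH' i j)).
  have -> : \sum_(n <- rest) \sum_m Gam m (r n) *
        (\sum_i \sum_j metric_inv (g z) i j * F i j (upd r n m)) =
      \sum_i \sum_j metric_inv (g z) i j *
        (\sum_(n <- rest) \sum_m Gam m (r n) * F i j (upd r n m)).
    under [RHS]eq_bigr do under eq_bigr do rewrite mulr_sumr.
    rewrite [RHS](eq_bigr _ (fun i _ => exchange_big _ _ _ _ _ _)) /=.
    rewrite [RHS]exchange_big; apply: eq_bigr => n _ /=.
    under [RHS]eq_bigr do under eq_bigr do rewrite mulr_sumr.
    rewrite [RHS](eq_bigr _ (fun i _ => exchange_big _ _ _ _ _ _)) /=.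
    rewrite [RHS]exchange_big; apply: eq_bigr => m _ /=.
    rewrite mulr_sumr; apply: eq_bigr => i _; rewrite mulr_sumr.
    by apply: eq_bigr => j _; rewrite mulrCA.
  set G := metric_inv (g z).
  set D := fun i j => den (g z) env1 (upd (upd r p i) q j) (der a).
  set Q := fun i j => \sum_(n <- rest) \sum_m Gam m (r n) * F i j (upd r n m).
  have c1 : \sum_i \sum_j (\sum_m Gam i m * G m j) * F i j r =
            \sum_i \sum_j G i j * (\sum_m Gam m i * F m j r).
    under eq_bigr do under eq_bigr do rewrite mulr_suml.
    under [RHS]eq_bigr do under eq_bigr do rewrite mulr_sumr.
    under eq_bigr do rewrite exchange_big.
    rewrite exchange_big; apply: eq_bigr => m _ /=.
    rewrite exchange_big; apply: eq_bigr => j _ /=.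
    by apply: eq_bigr => i _; rewrite mulrA [G _ _ * _]mulrC.
  have c2 : \sum_i \sum_j (\sum_m Gam j m * G i m) * F i j r =
            \sum_i \sum_j G i j * (\sum_m Gam m j * F i m r).
    apply: eq_bigr => i _.
    under eq_bigr do rewrite mulr_suml.
    under [RHS]eq_bigr do rewrite mulr_sumr.
    rewrite exchange_big; apply: eq_bigr => m _ /=.
    by apply: eq_bigr => j _; rewrite mulrA [G _ _ * _]mulrC.
  rewrite -/G.
  transitivity (\sum_i \sum_j (G i j * D i j + G i j * Q i j) +
     ((\sum_i \sum_j G i j * (\sum_m Gam m i * F m j r)) -
      \sum_i \sum_j (\sum_m Gam i m * G m j) * F i j r) +
     ((\sum_i \sum_j G i j * (\sum_m Gam m j * F i m r)) -
      \sum_i \sum_j (\sum_m Gam j m * G i m) * F i j r)).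
    rewrite -!sumrB -!big_split; apply: eq_bigr => i _ /=.
    rewrite -!sumrB -!big_split; apply: eq_bigr => j _ /=.
    rewrite -/(D i j) -/(F i j r) -/(Q i j) big_split /=.
    by ring.
  rewrite c1 c2 !subrr !addr0.
  rewrite -big_split; apply: eq_bigr => i _ /=.
  by rewrite -big_split.
Qed.

End Leibniz.

(** * The quadratic relation for a 3-form on a 7-dimensional space *)

Definition zsgn (n : nat) : BinNums.Z :=
  if odd n then BinInt.Z.opp BinInt.Z.one else BinInt.Z.one.

(** Alternating sum over the choice of one element of [av]; iterated, it is the
    expansion of a wedge product over all orderings. *)
Definition asum (av : seq nat) (F : nat -> seq nat -> spoly) : spoly :=
  psum 3 [seq pscale (zsgn (index a av)) (F a (rem a av)) | a <- av].

Definition alt3 (i j k : nat) : spoly :=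
  if [|| eqn i j, eqn j k | eqn i k] then [::] else
  let p c a b d := [:: (zsgn c, [:: [:: a; b; d]])] in
  if (i < j)%N then
    (if (j < k)%N then p 0%N i j k else if (i < k)%N then p 1%N i k j else p 0%N k i j)
  else
    (if (i < k)%N then p 1%N j i k else if (j < k)%N then p 0%N j k i else p 1%N k j i).

(** The coefficient of [(u _| phi) /\ (v _| phi) /\ phi], times 24. *)
Definition Bpoly j k : spoly :=
  asum idx7 (fun a s => asum s (fun b s => pmul (alt3 j a b)
    (asum s (fun c s => asum s (fun d s => pmul (alt3 k c d)
      (asum s (fun e s => asum s (fun f s => asum s (fun g _ => alt3 e f g))))))))).

Definition idx6 := iota 1 6.

(** The endomorphism that Hitchin attaches to a 3-form on a 6-dimensional space,
    here the part of [phi] on the indices 1 to 6; for [j = 0] the same expression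
    with the 2-form [phi_0ab] instead. *)
Definition Kpoly j l : spoly :=
  pscale (zsgn (index l idx6))
    (asum (rem l idx6) (fun a s => asum s (fun b s => pmul (alt3 j a b)
      (asum s (fun c s => asum s (fun d s => asum s (fun e _ => alt3 c d e))))))).

(** The adjugate of the 2-form [phi_0ab], up to a factor. *)
Definition Apoly l m : spoly :=
  if eqn l m then [::] else
  let s := rem l idx6 in
  pscale (zsgn (index l idx6)) (pscale (zsgn (index m s))
    (asum (rem m s) (fun a s => asum s (fun b s => pmul (alt3 0 a b)
      (asum s (fun c s => asum s (fun d _ => alt3 0 c d))))))).

(** A multiple of the Pfaffian of the 2-form [phi_0ab]. *)
Definition Pfpoly : spoly :=
  asum idx6 (fun a s => asum s (fun b s => pmul (alt3 0 a b)
    (asum s (fun c s => asum s (fun d s => pmul (alt3 0 c d)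
      (asum s (fun e s => asum s (fun f _ => alt3 0 e f)))))))).

Definition Lpoly : spoly := psum 3 [seq pmul (Kpoly 1 l) (Kpoly l 1) | l <- idx6].

Definition six := BinInt.Z.of_nat 6.
Definition dpoly (i j : nat) (p : spoly) := if eqn i j then p else [::].
Definition is0 (p : spoly) := if p is [::] then true else false.

(** The relations between these polynomials: the first three decompose the
   compatibility form, the fourth inverts the 2-form, and the last is the fact
   that the square of the endomorphism is scalar. *)
Lemma chk_B00P : is0 (padd (Bpoly 0 0) (pscale (BinInt.Z.opp (BinInt.Z.of_nat 3)) Pfpoly)). Proof. vm_cast_no_check (erefl true). Qed.
Lemma chk_B0jP : all (fun j => is0 (padd (Bpoly 0 j)
   (pscale six (psum 3 [seq pmul (alt3 0 j l) (Kpoly 0 l) | l <- idx6])))) idx6. Proof. vm_cast_no_check (erefl true). Qed.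
Lemma chk_BjkP : all (fun j => all (fun k => is0 (padd (Bpoly j k)
   (pscale six (psum 3 [seq padd (pmul (alt3 0 j l) (Kpoly k l))
      (pscale (BinInt.Z.opp BinInt.Z.one) (pmul (alt3 j k l) (Kpoly 0 l))) | l <- idx6])))) idx6) idx6. Proof. vm_cast_no_check (erefl true). Qed.
Lemma chk_AP : all (fun j => all (fun m => is0 (padd (dpoly j m Pfpoly)
   (pscale six (psum 3 [seq pmul (alt3 0 j l) (Apoly l m) | l <- idx6])))) idx6) idx6. Proof. vm_cast_no_check (erefl true). Qed.
Lemma chk_KP : all (fun j => all (fun m => is0 (padd
   (pscale (BinInt.Z.opp BinInt.Z.one) (dpoly j m Lpoly))
   (psum 3 [seq pmul (Kpoly j l) (Kpoly l m) | l <- idx6]))) idx6) idx6. Proof. vm_cast_no_check (erefl true). Qed.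

Section Hitchin.
Variables (R : realFieldType) (f : 'I_7 -> 'I_7 -> 'I_7 -> R).
Hypothesis f12 : forall a b c, f a b c = - f b a c.
Hypothesis f23 : forall a b c, f a b c = - f a c b.

Definition val3 (v : var) : R :=
  if v is [:: i; j; k] then f (inord i) (inord j) (inord k) else 0.
Notation ev := (peval val3).
Let F (i j k : nat) := f (inord i) (inord j) (inord k).

Lemma zr_zsgn n : zr R (zsgn n) = (-1) ^+ n.
Proof. by rewrite -signr_odd /zsgn; case: (odd n); rewrite /zr /= ?expr1 ?expr0. Qed.

Lemma alt3E i j k : ev (alt3 i j k) = F i j k.
Proof.
have term c a b d : ev [:: (zsgn c, [:: [:: a; b; d]])] = (-1) ^+ c * F a b d.
  by rewrite /peval big_seq1 /meval big_seq1 zr_zsgn.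
have eq0 (x : R) : x = - x -> x = 0 by lra.
have C a b c : f b c a = f a b c by rewrite (f23 b c a) (f12 b a c) opprK.
have T a b c : f c b a = - f a b c by rewrite (f12 c b a) C.
rewrite /alt3; case: ifP => [/or3P[] /eqnP ->|_].
- by rewrite peval_nil [RHS]eq0 // /F [LHS]f12.
- by rewrite peval_nil [RHS]eq0 // /F [LHS]f23.
- by rewrite peval_nil [RHS]eq0 // /F [LHS]T.
rewrite /F; do ![case: ifP => _]; rewrite term /F ?expr0 ?expr1 ?mul1r ?mulN1r //.
Qed.

Definition rsum (av : seq nat) (G : nat -> seq nat -> R) : R :=
  \sum_(a <- av) (-1) ^+ index a av * G a (rem a av).

Lemma asumE av G : ev (asum av G) = rsum av (fun a s => ev (G a s)).
Proof.
rewrite /asum peval_sum big_map; apply: eq_bigr => a _.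
by rewrite peval_scale zr_zsgn.
Qed.

Lemma is0P p : is0 p -> ev p = 0.
Proof. by case: p => // _; rewrite peval_nil. Qed.

Lemma sum_idx6 (G : nat -> R) : \sum_(l <- idx6) G l = \sum_(l < 6) G l.+1.
Proof.
rewrite (_ : idx6 = [seq n.+1 | n <- iota 0 6]) // big_map.
by rewrite -(big_mkord xpredT (fun n => G n.+1)) /index_iota subn0.
Qed.

Lemma all_idx6 (P : nat -> bool) : all P idx6 -> forall i : 'I_6, P i.+1.
Proof.
move=> /seq.allP H i; apply: H.
by rewrite mem_iota; have := ltn_ord i; lia.
Qed.

Lemma ev_dpoly i j p : ev (dpoly i j p) = (i == j)%:R * ev p.
Proof.
by rewrite /dpoly; case: eqnP => [->|/eqP/negbTE ->]; rewrite ?eqxx ?mul1r // mul0r peval_nil.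
Qed.

Lemma zr_six : zr R six = 6.
Proof. by []. Qed.

Opaque asum alt3 padd psum pmul pscale idx6 idx7 Bpoly Kpoly Apoly Pfpoly Lpoly dpoly six.

Lemma Bpoly_00 : ev (Bpoly 0 0) = 3 * ev Pfpoly.
Proof.
have := is0P chk_B00P; rewrite peval_add peval_scale (_ : zr R _ = -3) //; lra.
Qed.

Lemma Bpoly_0j (j : 'I_6) : ev (Bpoly 0 j.+1) =
  - 6 * \sum_(l < 6) F 0 j.+1 l.+1 * ev (Kpoly 0 l.+1).
Proof.
have := is0P (all_idx6 chk_B0jP j).
rewrite peval_add peval_scale peval_sum big_map sum_idx6 zr_six.
under eq_bigr do rewrite peval_mul alt3E.
by move=> H; lra.
Qed.

Lemma Bpoly_jk (j k : 'I_6) : ev (Bpoly j.+1 k.+1) =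
  - 6 * \sum_(l < 6) (F 0 j.+1 l.+1 * ev (Kpoly k.+1 l.+1)
                      - F j.+1 k.+1 l.+1 * ev (Kpoly 0 l.+1)).
Proof.
have := is0P (all_idx6 (all_idx6 chk_BjkP j) k).
rewrite peval_add peval_scale peval_sum big_map sum_idx6 zr_six.
under eq_bigr => l _.
  rewrite peval_add (peval_mul _ (alt3 0 _ _)) (alt3E 0) peval_scale.
  rewrite (peval_mul _ (alt3 j.+1 _ _)) (alt3E j.+1) (_ : zr R _ = -1) // mulN1r.
  over.
by move=> H; lra.
Qed.

Lemma Apoly_inv (j m : 'I_6) :
  \sum_(l < 6) F 0 j.+1 l.+1 * ev (Apoly l.+1 m.+1) = - ((j == m)%:R * ev Pfpoly) / 6.
Proof.
have := is0P (all_idx6 (all_idx6 chk_AP j) m).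
rewrite peval_add peval_scale ev_dpoly eqSS (inj_eq (@ord_inj _)).
rewrite peval_sum big_map sum_idx6 zr_six.
under eq_bigr do rewrite peval_mul alt3E.
by move=> H; lra.
Qed.

Lemma Kpoly_sq (j m : 'I_6) :
  \sum_(l < 6) ev (Kpoly j.+1 l.+1) * ev (Kpoly l.+1 m.+1) = (j == m)%:R * ev Lpoly.
Proof.
have := is0P (all_idx6 (all_idx6 chk_KP j) m).
rewrite peval_add peval_scale ev_dpoly eqSS (inj_eq (@ord_inj _)).
rewrite peval_sum big_map sum_idx6 (_ : zr R _ = -1) //.
under eq_bigr do rewrite peval_mul.
by move=> H; lra.
Qed.

(** [Om] is invertible, so [Om P = 0] gives [P = 0]; then [Om K^T] is a multiple
    of the identity, and [K^2] being scalar makes [Om^2] scalar. *)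
Lemma scalar_endo (b Pf la : R) (Om A K : 'M[R]_6) (P : 'cV[R]_6)
    (rho : 'I_6 -> 'I_6 -> 'I_6 -> R) :
  b != 0 -> b = 3 * Pf -> Om *m P = 0 -> Om *m A = (- (Pf / 6))%:M ->
  (forall j k, - 6 * \sum_l (Om j l * K k l - rho j k l * P l 0) = b * (j == k)%:R) ->
  K *m K = la%:M -> exists2 c, c != 0 & Om *m Om = c%:M.
Proof.
move=> b0 bP OP OA OK KK.
have Pf0 : Pf != 0 by apply: contraNneq b0 => Pf0; rewrite bP Pf0 mulr0.
have P0 : P = 0.
  have c0 : - (Pf / 6) != 0 by rewrite oppr_eq0 mulf_neq0 // invr_eq0 pnatr_eq0.
  have E : Om *m ((- (Pf / 6))^-1 *: A) = 1%:M.
    by rewrite -scalemxAr OA scale_scalar_mx mulVf.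
  have := mulmx1C E; rewrite -scalemxAl => AO.
  by rewrite -[P]mul1mx -AO -scalemxAl -mulmxA OP mulmx0 scaler0.
have OKT : Om *m K^T = (- (b / 6))%:M.
  apply/matrixP => j k; rewrite !mxE; have := OK j k.
  rewrite (eq_bigr (fun l => Om j l * K^T l k)); last first.
    by move=> l _; rewrite P0 !mxE mulr0 subr0.
  by case: (j == k); rewrite ?mulr1n ?mulr0n => H; lra.
have O2 : la *: (Om *m Om) = ((b / 6) ^+ 2)%:M.
  have KKT : K^T *m K^T = la%:M by rewrite -trmx_mul KK tr_scalar_mx.
  rewrite -mul_mx_scalar -KKT -mulmxA [(Om *m (K^T *m _))]mulmxA OKT.
  rewrite mul_scalar_mx -scalemxAr OKT scale_scalar_mx.
  by congr (_%:M); ring.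
have b2 : (b / 6) ^+ 2 != 0.
  by rewrite sqrf_eq0 mulf_neq0 // invr_eq0 pnatr_eq0.
have la0 : la != 0.
  apply/eqP => la0; move: O2; rewrite la0 scale0r => /matrixP/(_ 0 0).
  by rewrite !mxE eqxx mulr1n => /eqP; rewrite eq_sym (negbTE b2).
exists (la^-1 * (b / 6) ^+ 2); first by rewrite mulf_neq0 // invr_eq0.
by rewrite -scale_scalar_mx -O2 scalerA mulVf // scale1r.
Qed.

(** The case [u = e_0] of the relation [(u x v) . (u x w) = K v . w] for [v] and
    [w] orthogonal to [u]; the constant may depend on [u]. *)
Lemma hitchin b : b != 0 ->
  (forall j k : 'I_7, ev (Bpoly j k) = b * (j == k)%:R) ->
  exists2 K, K != 0 & forall j l : 'I_6,
    \sum_(k < 6) F 0 j.+1 k.+1 * F 0 l.+1 k.+1 = K * (j == l)%:R.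
Proof.
move=> b0 B.
have Bn j k : (j < 7)%N -> (k < 7)%N -> ev (Bpoly j k) = b * (j == k)%:R.
  by move=> jn kn; exact: (B (Ordinal jn) (Ordinal kn)).
have lt7 (i : 'I_6) : (i.+1 < 7)%N by rewrite ltnS ltn_ord.
have [//||||||c c0 O2] := @scalar_endo b (ev Pfpoly) (ev Lpoly)
  (\matrix_(j, l) F 0 j.+1 l.+1) (\matrix_(j, l) ev (Apoly j.+1 l.+1))
  (\matrix_(j, l) ev (Kpoly j.+1 l.+1)) (\col_l ev (Kpoly 0 l.+1))
  (fun j k l => F j.+1 k.+1 l.+1).
- by rewrite -Bpoly_00 Bn // mulr1.
- apply/matrixP => j m; rewrite !mxE.
  rewrite (eq_bigr (fun l : 'I_6 => F 0 j.+1 l.+1 * ev (Kpoly 0 l.+1))); last first.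
    by move=> l _; rewrite !mxE.
  by have := Bpoly_0j j; rewrite Bn ?lt7 // mulr0 => H; lra.
- apply/matrixP => j m; rewrite !mxE.
  rewrite (eq_bigr (fun l : 'I_6 => F 0 j.+1 l.+1 * ev (Apoly l.+1 m.+1))); last first.
    by move=> l _; rewrite !mxE.
  by rewrite Apoly_inv; case: (j == m); rewrite ?mulr1n ?mulr0n; lra.
- move=> j k; rewrite -(inj_eq (@ord_inj _)) -eqSS -Bn ?lt7 // Bpoly_jk; congr (_ * _).
  by apply: eq_bigr => l _; rewrite !mxE.
- apply/matrixP => j m; rewrite !mxE.
  rewrite (eq_bigr (fun l : 'I_6 => ev (Kpoly j.+1 l.+1) * ev (Kpoly l.+1 m.+1))); last first.
    by move=> l _; rewrite !mxE.
  by rewrite Kpoly_sq; case: (j == m); rewrite ?mulr1n ?mulr0n ?mul1r ?mul0r.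
exists (- c); first by rewrite oppr_eq0.
move=> j l; have := congr1 (fun M : 'M[R]_6 => M j l) O2; rewrite !mxE.
rewrite (eq_bigr (fun k : 'I_6 => - (F 0 j.+1 k.+1 * F 0 l.+1 k.+1))); last first.
  by move=> k _; rewrite !mxE /F [f _ (inord k.+1) _]f23 mulrN.
by rewrite sumrN; case: (j == l); rewrite ?mulr1n ?mulr0n ?mulr1 ?mulr0 => H; lra.
Qed.

End Hitchin.

(** * The Levi-Civita symbol under a change of frame *)

(** Sign of [s] as a rearrangement of [av], by expansion along the first row:
    zero when [s] is not one. *)
Fixpoint lev (av s : seq nat) : BinNums.Z :=
  match s with
  | [::] => BinInt.Z.one
  | a :: s' => if a \in av then BinInt.Z.mul (zsgn (index a av)) (lev (rem a av) s')
               else BinNums.Z0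
  end.

Section Levi.
Variable R : realType.
Notation ten1 := ('I_7 -> R).

Lemma det_lev n (av s : seq nat) : size av = n -> size s = n -> uniq av ->
  \det (\matrix_(m < n, k < n) ((nth 0%N s m == nth 0%N av k)%:R : R)) =
  zr R (lev av s).
Proof.
elim: n av s => [|n IH] av [|a s] // sav ss uav.
  by rewrite det_mx00 /zr.
rewrite [lev _ _]/=; case: ifP => aav; last first.
  rewrite (expand_det_row _ ord0) big1 // => k _; rewrite !mxE /=.
  rewrite (_ : (a == _) = false) ?mul0r //; apply: contraFF aav => /eqP ->.
  by rewrite mem_nth // sav.
have ia : (index a av < n.+1)%N by rewrite -sav index_mem.
rewrite (expand_det_row _ ord0) (bigD1 (Ordinal ia)) //= big1 ?addr0; last first.
  move=> k; rewrite !mxE -val_eqE /= => ki.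
  rewrite (_ : (a == _) = false) ?mul0r //; apply: contraNF ki => /eqP ->.
  by rewrite index_uniq ?sav.
rewrite mxE /= nth_index // eqxx mul1r zrM zr_zsgn.
rewrite /cofactor add0n; congr (_ * _); rewrite -(IH (rem a av) s).
- congr (\det _); apply/matrixP => i j; rewrite !mxE /=; congr ((_ == _)%:R).
  rewrite remE -/(take _ _) nth_cat size_take index_mem aav /bump.
  case: (ltnP j (index a av)) => [ja|aj]; first by rewrite nth_take // leqNgt ja.
  by rewrite nth_drop addSn subnKC // aj add1n.
- by rewrite size_rem // sav.
- by case: ss.
- exact: rem_uniq.
Qed.

Lemma levi_lev a b c d e f g : levi_civita R a b c d e f g =
  zr R (lev idx7 [seq nat_of_ord i | i <- [:: a; b; c; d; e; f; g]]).
Proof.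
rewrite -(@det_lev 7) //; congr (\det _); apply/matrixP => i j; rewrite !mxE.
congr (nat_of_bool _)%:R; rewrite /idx7 nth_iota // add0n.
by rewrite (nth_map ord0) // (tnth_nth ord0).
Qed.

Fixpoint nsum (k : nat) (Y : seq 'I_7 -> R) : R :=
  if k is k'.+1 then \sum_a nsum k' (fun t => Y (a :: t)) else Y [::].

Lemma nsum_eq k X Y : (forall t, size t = k -> X t = Y t) -> nsum k X = nsum k Y.
Proof.
elim: k X Y => [|k IH] X Y H /=; first exact: H.
by apply: eq_bigr => a _; apply: IH => t st; apply: H; rewrite /= st.
Qed.

Lemma nsum_lin k (c : 'I_7 -> R) (X : 'I_7 -> seq 'I_7 -> R) :
  nsum k (fun t => \sum_i c i * X i t) = \sum_i c i * nsum k (X i).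
Proof.
elim: k X => [|k IH] X //=.
under eq_bigr do rewrite IH.
by rewrite exchange_big; apply: eq_bigr => i _; rewrite mulr_sumr.
Qed.

Lemma nsumZ k c X : nsum k (fun t => c * X t) = c * nsum k X.
Proof.
elim: k X => [|k IH] X //=.
by rewrite mulr_sumr; apply: eq_bigr => i _; rewrite IH.
Qed.

Fixpoint lsum (k : nat) (av : seq nat) (X : seq nat -> R) : R :=
  if k is k'.+1 then rsum av (fun a s => lsum k' s (fun t => X (a :: t)))
  else X [::].

Lemma rsumZ av c (G : nat -> seq nat -> R) :
  rsum av (fun a s => c * G a s) = c * rsum av G.
Proof. by rewrite /rsum mulr_sumr; apply: eq_bigr => a _; rewrite mulrCA. Qed.

(** A sum against the sign over all index tuples only sees the orderings of [av]. *)
Lemma lsumE k av (X : seq nat -> R) : size av = k -> uniq av -> all (ltn^~ 7) av ->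
  nsum k (fun t => let s := [seq nat_of_ord i | i <- t] in zr R (lev av s) * X s) =
  lsum k av X.
Proof.
elim: k av X => [|k IH] av X sav uav lav; first by rewrite /= /zr /= mul1r.
rewrite [LHS]/= [RHS]/= /rsum.
have H (a : 'I_7) : nsum k (fun t => zr R (lev av [seq nat_of_ord i | i <- a :: t]) *
     X [seq nat_of_ord i | i <- a :: t]) =
     if nat_of_ord a \in av then
       (-1) ^+ index (nat_of_ord a) av * lsum k (rem (nat_of_ord a) av) (fun t => X (nat_of_ord a :: t))
     else 0.
  case: ifP => aav; last first.
    rewrite -[RHS](mul0r (nsum k (fun=> 0))) -nsumZ; apply: nsum_eq => t _.
    by rewrite /= aav /zr /= mulr0z !mul0r.
  rewrite -IH ?size_rem ?sav ?rem_uniq //; last first.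
    by apply/seq.allP => x /mem_rem xav; exact: (seq.allP lav).
  rewrite -nsumZ; apply: nsum_eq => t _.
  by rewrite [lev _ _]/= aav zrM zr_zsgn mulrA.
under eq_bigr do rewrite H.
rewrite -big_mkcond /=.
rewrite -(big_mkord (fun a => a \in av) (fun a => (-1) ^+ index a av * lsum k (rem a av) (fun t => X (a :: t)))).
rewrite -big_filter; apply: perm_big; apply: uniq_perm => //.
  by rewrite filter_uniq // iota_uniq.
move=> x; rewrite mem_filter mem_index_iota /=.
by case: (boolP (x \in av)) => //= xav; exact: (seq.allP lav).
Qed.

Definition detv (vs : seq ten1) : R :=
  \det (\matrix_(m < 7, n < 7) nth (fun=> 0) vs m n).

Lemma detv_slot us v ws : (size us < 7)%N ->
  detv (us ++ v :: ws) = \sum_i v i * detv (us ++ evec R i :: ws).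
Proof.
move=> su; pose i0 := Ordinal su; rewrite /detv (expand_det_row _ i0).
apply: eq_bigr => i _; rewrite mxE nth_cat ltnn subnn; congr (_ * _).
rewrite [RHS](expand_det_row _ i0) (bigD1 i) //= big1 ?addr0; last first.
  by move=> j ji; rewrite mxE nth_cat ltnn subnn /= /evec (negbTE ji) mul0r.
rewrite mxE nth_cat ltnn subnn /= /evec eqxx mul1r; congr (_ * \det _).
apply/matrixP => a b; rewrite !mxE !nth_cat /=.
case: ltnP => // sua; case E: (_ - _)%N => [|k] //.
by have := neq_lift i0 a; rewrite -val_eqE /= => /eqP; lia.
Qed.

Lemma ext_detv us vs : size us + size vs = 7%N ->
  ext (fun s => detv (us ++ [seq evec R i | i <- s])) vs = detv (us ++ vs).
Proof.
elim: vs us => [|v vs IH] us //= s7.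
rewrite detv_slot; last by lia.
apply: eq_bigr => i _; congr (_ * _).
rewrite -cat_rcons -IH; last by rewrite size_rcons; lia.
by apply: ext_eq => s; rewrite cat_rcons.
Qed.

Lemma detv_evec (s : seq 'I_7) : size s = 7%N ->
  detv [seq evec R i | i <- s] = zr R (lev idx7 [seq nat_of_ord i | i <- s]).
Proof.
move=> ss; rewrite -(@det_lev 7) ?size_map //; congr (\det _).
apply/matrixP => i j; rewrite !mxE (nth_map ord0) ?ss // (nth_map ord0) ?ss //.
by rewrite /idx7 nth_iota // add0n /evec eq_sym.
Qed.

Lemma detv_frame (E : 'I_7 -> ten1) (s : seq 'I_7) : size s = 7%N ->
  detv [seq E i | i <- s] =
  zr R (lev idx7 [seq nat_of_ord i | i <- s]) * \det (\matrix_(a, i) E a i).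
Proof.
move=> ss; rewrite -detv_evec // /detv -det_mulmx; congr (\det _).
apply/matrixP => i j; rewrite !mxE (nth_map ord0) ?ss // (bigD1 (nth ord0 s i)) //=.
rewrite !mxE (nth_map ord0) ?ss // /evec eqxx mul1r big1 ?addr0 // => k ks.
by rewrite !mxE (nth_map ord0) ?ss // /evec (negbTE ks) mul0r.
Qed.

Definition leviS (s : seq 'I_7) : R :=
  if s is [:: a; b; c; d; e; f; g] then levi_civita R a b c d e f g else 0.

Lemma leviSE s : size s = 7%N ->
  leviS s = zr R (lev idx7 [seq nat_of_ord i | i <- s]).
Proof.
by case: s => [|a [|b [|c [|d [|e [|f [|g [|? ?]]]]]]]] // _; rewrite -levi_lev.
Qed.

Lemma ext_size A B (vs : seq ten1) :
  (forall s, size s = size vs -> A s = B s) -> ext A vs = ext B vs.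
Proof.
elim: vs A B => [|v vs IH] A B AB /=; first exact: AB.
by apply: eq_bigr => i _; congr (_ * _); apply: IH => s ss; apply: AB; rewrite /= ss.
Qed.

(** The determinant is multiplicative. *)
Lemma ext_levi (E : 'I_7 -> ten1) (s : seq 'I_7) : size s = 7%N ->
  ext leviS [seq E i | i <- s] = leviS s * \det (\matrix_(a, i) E a i).
Proof.
move=> ss; rewrite leviSE // -detv_frame //.
rewrite -[RHS](@ext_detv [::]) ?size_map //; apply: ext_size => t.
by rewrite size_map ss => st; rewrite /= detv_evec // leviSE.
Qed.

Lemma ext_mul (A B : seq 'I_7 -> R) us vs :
  ext (fun s => A (take (size us) s) * B (drop (size us) s)) (us ++ vs) =
  ext A us * ext B vs.
Proof.
elim: us A => [|u us IH] A /=.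
  rewrite -[RHS]/(A [::] * _) (ext_eq (B := fun s => A [::] * B s)); last first.
    by move=> s; rewrite take0 drop0.
  elim: vs B => [|v vs IHv] B //=; rewrite mulr_sumr; apply: eq_bigr => i _.
  by rewrite IHv mulrCA.
rewrite mulr_suml; apply: eq_bigr => i _; rewrite -mulrA; congr (_ * _).
by rewrite -IH.
Qed.

Lemma nsum_adj k (A X : seq 'I_7 -> R) (E : 'I_7 -> ten1) :
  nsum k (fun s => A s * ext X [seq E i | i <- s]) =
  nsum k (fun t => X t * ext A [seq (fun a => E a i) | i <- t]).
Proof.
elim: k A X => [|k IH] A X /=; first by rewrite mulrC.
transitivity (\sum_a \sum_i E a i *
   nsum k (fun s => A (a :: s) * ext (fun t => X (i :: t)) [seq E i | i <- s])).
  apply: eq_bigr => a _; rewrite -nsum_lin; apply: nsum_eq => s _.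
  by rewrite mulr_sumr; apply: eq_bigr => i _; rewrite mulrCA.
rewrite exchange_big; apply: eq_bigr => i _ /=.
under eq_bigr do rewrite IH.
rewrite -nsum_lin; apply: nsum_eq => s _.
by rewrite mulr_sumr; apply: eq_bigr => a _; rewrite mulrCA.
Qed.

(** Move the frame from [X] to the symbol, whose extension to the frame is the
    symbol times a determinant. *)
Lemma levi_frame (X : seq 'I_7 -> R) (E : 'I_7 -> ten1) :
  nsum 7 (fun s => leviS s * ext X [seq E i | i <- s]) =
  \det (\matrix_(a, i) E a i) * nsum 7 (fun s => leviS s * X s).
Proof.
rewrite nsum_adj -nsumZ; apply: nsum_eq => t st; rewrite ext_levi //.
rewrite -[X in _ * (_ * X)]det_tr.
rewrite (_ : (\matrix_(a, i) E i a)^T = \matrix_(a, i) E a i); first by ring.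
by apply/matrixP => a i; rewrite !mxE.
Qed.

Definition prod223 (al be : 'I_7 -> 'I_7 -> R) (ga : 'I_7 -> 'I_7 -> 'I_7 -> R)
    (s : seq 'I_7) : R :=
  if s is [:: a; b; c; d; e; f; g] then al a b * be c d * ga e f g else 0.

Lemma wedge_nsum al be ga : wedge223 al be ga =
  24^-1 * nsum 7 (fun s => leviS s * prod223 al be ga s).
Proof.
rewrite /wedge223; congr (_ * _); first by congr (_^-1); ring.
do 7 (apply: eq_bigr => ? _); by rewrite /= !mulrA.
Qed.

Definition ten_seq1 (A : 'I_7 -> R) (s : seq 'I_7) : R :=
  if s is [:: a] then A a else 0.
Definition ten_seq2 (A : 'I_7 -> 'I_7 -> R) (s : seq 'I_7) : R :=
  if s is [:: a; b] then A a b else 0.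
Definition ten_seq3 (A : 'I_7 -> 'I_7 -> 'I_7 -> R) (s : seq 'I_7) : R :=
  if s is [:: a; b; c] then A a b c else 0.
Definition ten_seq4 (A : 'I_7 -> 'I_7 -> 'I_7 -> 'I_7 -> R) (s : seq 'I_7) : R :=
  if s is [:: a; b; c; d] then A a b c d else 0.

Lemma ext_prod223 al be ga (v1 v2 v3 v4 v5 v6 v7 : ten1) :
  ext (prod223 al be ga) [:: v1; v2; v3; v4; v5; v6; v7] =
  ext (ten_seq2 al) [:: v1; v2] * ext (ten_seq2 be) [:: v3; v4] *
  ext (ten_seq3 ga) [:: v5; v6; v7].
Proof.
rewrite -(ext_mul _ _ [:: v1; v2] [:: v3; v4]) -(ext_mul _ _ [:: v1; v2; v3; v4] [:: v5; v6; v7]).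
apply: ext_size; by case=> [|a [|b [|c [|d [|e [|f [|g [|? ?]]]]]]]].
Qed.

Section WedgeFrame.
Variables (phi : 'I_7 -> 'I_7 -> 'I_7 -> R) (E : 'I_7 -> ten1).

Definition fr3 (i j k : 'I_7) : R := ext (ten_seq3 phi) [:: E i; E j; E k].

Hypothesis phi12 : forall a b c, phi a b c = - phi b a c.
Hypothesis phi23 : forall a b c, phi a b c = - phi a c b.

Lemma fr3E i j k :
  fr3 i j k = \sum_a \sum_b \sum_c E i a * E j b * E k c * phi a b c.
Proof.
apply: eq_bigr => a _; rewrite mulr_sumr; apply: eq_bigr => b _.
by rewrite !mulr_sumr; apply: eq_bigr => c _ /=; rewrite !mulrA.
Qed.

Lemma fr3_12 a b c : fr3 a b c = - fr3 b a c.
Proof.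
rewrite !fr3E exchange_big -sumrN; apply: eq_bigr => i _ /=.
rewrite -sumrN; apply: eq_bigr => j _; rewrite -sumrN; apply: eq_bigr => k _.
by rewrite phi12; ring.
Qed.

Lemma fr3_23 a b c : fr3 a b c = - fr3 a c b.
Proof.
rewrite !fr3E -sumrN; apply: eq_bigr => i _ /=.
rewrite exchange_big -sumrN; apply: eq_bigr => j _ /=.
rewrite -sumrN; apply: eq_bigr => k _.
by rewrite phi23; ring.
Qed.

(** The frame enters once through each of the seven slots of the symbol, hence the
    determinant. *)
Lemma wedge_frame (j k : 'I_7) :
  peval (val3 fr3) (Bpoly j k) =
  24 * \det (\matrix_(a, i) E a i) *
    (\sum_a \sum_b E j a * E k b * wedge223 (phi a) (phi b) phi).
Proof.
pose X := prod223 (fun b c => \sum_a E j a * phi a b c)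
                  (fun b c => \sum_a E k a * phi a b c) phi.
transitivity (nsum 7 (fun s => leviS s * ext X [seq E i | i <- s])).
  pose Y s := if s is [:: a; b; c; d; e; f; g] then
     fr3 (inord j) (inord a) (inord b) * fr3 (inord k) (inord c) (inord d) * fr3 (inord e) (inord f) (inord g) else 0.
  transitivity (lsum 7 idx7 Y).
    rewrite /Bpoly !asumE; apply: eq_bigr => a _; congr (_ * _).
    rewrite asumE; apply: eq_bigr => b _; congr (_ * _).
    rewrite peval_mul (alt3E fr3_12 fr3_23) asumE -rsumZ.
    apply: eq_bigr => c _; congr (_ * _); rewrite asumE -rsumZ.
    apply: eq_bigr => d _; congr (_ * _).
    rewrite peval_mul (alt3E fr3_12 fr3_23) mulrA asumE -rsumZ.
    apply: eq_bigr => e _; congr (_ * _); rewrite asumE -rsumZ.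
    apply: eq_bigr => f _; congr (_ * _); rewrite asumE -rsumZ.
    apply: eq_bigr => g _; congr (_ * _).
    by rewrite (alt3E fr3_12 fr3_23).
  rewrite -lsumE //; apply: nsum_eq => s ss; rewrite leviSE //.
  congr (_ * _).
  case: s ss => [|a [|b [|c [|d [|e [|f [|g [|? ?]]]]]]]] // _.
  etransitivity; last exact/esym/ext_prod223.
  have H u v w : ext (ten_seq2 (fun b c => \sum_a E u a * phi a b c)) [:: v; w] =
     ext (ten_seq3 phi) [:: E u; v; w].
    etransitivity; last exact: (ext_sum (E u) (fun a s => ten_seq3 phi (a :: s)) [:: v; w]).
    by apply: ext_size; case=> [|? [|? []]].
  by rewrite !H /Y /= !inord_val.
rewrite levi_frame -mulrA mulrCA; congr (_ * _).
have W a b : nsum 7 (fun s => leviS s * prod223 (phi a) (phi b) phi s) =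
    24 * wedge223 (phi a) (phi b) phi.
  by rewrite wedge_nsum mulrA mulfV ?mul1r // pnatr_eq0.
rewrite mulr_sumr.
transitivity (\sum_a E j a * \sum_b E k b *
   nsum 7 (fun s => leviS s * prod223 (phi a) (phi b) phi s)).
  under eq_bigr do rewrite -nsum_lin.
  rewrite -nsum_lin; apply: nsum_eq => s ss.
  case: s ss => [|a [|b [|c [|d [|e [|f [|g [|? ?]]]]]]]] // _.
  rewrite /X /=; move: (levi_civita _ _ _ _ _ _ _ _) => L.
  rewrite big_distrlr /= mulr_suml mulr_sumr; apply: eq_bigr => i _.
  rewrite mulr_suml !mulr_sumr; apply: eq_bigr => l _.
  by ring.
apply: eq_bigr => a _; rewrite !mulr_sumr; apply: eq_bigr => b _.
by rewrite W; ring.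
Qed.

End WedgeFrame.
End Levi.

(** * Orthonormal frames *)

Section Orthonormal.
Variable R : realType.
Notation ten1 := ('I_7 -> R).
Variable g : 'I_7 -> 'I_7 -> R.
Hypothesis gC : forall a b, g a b = g b a.
Hypothesis gpos : forall v : 'I_7 -> R, (exists a, v a != 0) ->
  0 < \sum_a \sum_b g a b * v a * v b.

Definition metric_form (u v : ten1) : R := \sum_a \sum_b g a b * u a * v b.
Definition lin (c d : R) (u v : ten1) : ten1 := fun a => c * u a + d * v a.

Lemma ggC u v : metric_form u v = metric_form v u.
Proof.
rewrite /metric_form exchange_big; apply: eq_bigr => b _; apply: eq_bigr => a _.
by rewrite gC; ring.
Qed.

Lemma gg_linl c d u v w : metric_form (lin c d u v) w = c * metric_form u w + d * metric_form v w.
Proof.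
rewrite /metric_form !mulr_sumr -big_split; apply: eq_bigr => a _ /=.
rewrite !mulr_sumr -big_split; apply: eq_bigr => b _ /=; rewrite /lin; ring.
Qed.

Lemma gg_linr c d u v w : metric_form w (lin c d u v) = c * metric_form w u + d * metric_form w v.
Proof. by rewrite ggC gg_linl !(ggC w). Qed.

Definition orthonormal_seq (F : seq ten1) : Prop := forall i j,
  (i < size F)%N -> (j < size F)%N ->
  metric_form (nth (fun=> 0) F i) (nth (fun=> 0) F j) = (i == j)%:R.

(** Fewer than seven vectors have a nonzero common orthogonal, which is then
    normalised. *)
Lemma orthonormal_extend F : orthonormal_seq F -> (size F < 7)%N ->
  exists v, orthonormal_seq (rcons F v).
Proof.
move=> oF sF; set k := size F.
pose M : 'M[R]_(k, 7) := \matrix_(i, b) \sum_a g a b * nth (fun=> 0) F i a.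
have : kermx M^T != 0.
  rewrite -mxrank_eq0 mxrank_ker -lt0n subn_gt0 mxrank_tr.
  by rewrite (leq_ltn_trans (rank_leq_row M)).
case/rowV0Pn => w /sub_kermxP wM w0.
pose u : ten1 := fun a => w 0 a.
have Fu i : (i < k)%N -> metric_form (nth (fun=> 0) F i) u = 0.
  move=> ik; have := congr1 (fun N : 'rV_k => N 0 (Ordinal ik)) wM.
  rewrite !mxE => E; rewrite -[RHS]E /metric_form exchange_big; apply: eq_bigr => b _ /=.
  rewrite !mxE mulr_sumr; apply: eq_bigr => a _; rewrite /u; ring.
have u0 : 0 < metric_form u u.
  apply: gpos; case/matrix0Pn: w0 => i [j wj]; exists j.
  by rewrite /u (_ : 0 = i) // ord1.
pose v := lin (Num.sqrt (metric_form u u))^-1 0 u u; exists v.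
have s0 : Num.sqrt (metric_form u u) != 0 by rewrite gt_eqF // sqrtr_gt0.
have vv : metric_form v v = 1.
  rewrite /v gg_linl !gg_linr !mul0r !addr0 mulrA -invfM -expr2.
  by rewrite sqr_sqrtr ?ltW // mulVf // gt_eqF.
have Fv i : (i < k)%N -> metric_form (nth (fun=> 0) F i) v = 0.
  by move=> ik; rewrite /v gg_linr Fu // !mulr0 addr0.
move=> i j; rewrite size_rcons !ltnS -/k => ik jk; rewrite !nth_rcons -/k.
case: (ltngtP i k) ik => // [ik|->] _.
  case: (ltngtP j k) jk => [jk||->] // _; first exact: oF.
  by rewrite Fv // ltn_eqF.
have [{}jk|kj|jk'] := ltngtP j k; first by rewrite ggC Fv // gtn_eqF.
  by rewrite leqNgt kj in jk.
by rewrite ?jk' ?eqxx ?vv.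
Qed.

Lemma orthonormal_complete F : orthonormal_seq F -> (size F <= 7)%N ->
  exists E : 'I_7 -> ten1, (forall i j, metric_form (E i) (E j) = (i == j)%:R) /\
    (forall i : 'I_7, (i < size F)%N -> E i = nth (fun=> 0) F i).
Proof.
move Ek : (7 - size F)%N => k; elim: k F Ek => [|k IH] F Ek oF sF.
  exists (fun i => nth (fun=> 0) F i); split => // i j.
  by rewrite oF //; apply: leq_trans (ltn_ord _) _; lia.
have [|v ov] := orthonormal_extend oF; first by lia.
have [||E [oE EF]] := IH (rcons F v) _ ov; rewrite ?size_rcons; [lia|lia|].
exists E; split => // i iF; rewrite EF ?nth_rcons ?iF // size_rcons.
exact: ltnW.
Qed.

Section OrthonormalFrame.
Variable E : 'I_7 -> ten1.
Hypothesis oE : forall i j, metric_form (E i) (E j) = (i == j)%:R.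
Let EM : 'M[R]_7 := \matrix_(s, i) E s i.
Let gM : 'M[R]_7 := \matrix_(a, b) g a b.

Lemma frame_mx : EM *m (gM *m EM^T) = 1%:M.
Proof.
apply/matrixP => i j; rewrite !mxE -oE /metric_form; apply: eq_bigr => a _.
by rewrite !mxE mulr_sumr; apply: eq_bigr => b _; rewrite !mxE; ring.
Qed.

(** [E g E^T = 1] implies [g^-1 = E^T E]. *)
Lemma frame_inv p q : metric_inv g p q = \sum_s E s p * E s q.
Proof.
have := mulmx1C frame_mx; rewrite -mulmxA => H.
have gu : gM \in unitmx by case/mulmx1_unit: H.
have E1 : invmx gM = EM^T *m EM.
  by rewrite -[LHS]mulmx1 -H mulKmx.
rewrite /metric_inv -/gM E1.
rewrite mxE; apply: eq_bigr => s _; by rewrite !mxE.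
Qed.

Lemma frame_dual : exists C : 'I_7 -> 'I_7 -> R,
  forall i j, evec R i j = \sum_s C i s * E s j.
Proof.
exists (fun i s => (gM *m EM^T) i s) => i j.
have := congr1 (fun M : 'M[R]_7 => M i j) (mulmx1C frame_mx); rewrite !mxE => H.
rewrite /evec eq_sym -[LHS]H; apply: eq_bigr => s _; congr (_ * _).
by rewrite !mxE.
Qed.

Lemma frame_det vol : vol ^+ 2 = \det gM -> (vol * \det EM) ^+ 2 = 1.
Proof.
move=> v2; have := congr1 determinant frame_mx.
by rewrite !det_mulmx det_tr det1 -v2 => <-; ring.
Qed.

Lemma gg_frame u v : metric_form u v = \sum_k metric_form u (E k) * metric_form v (E k).
Proof.
have Ek w k : metric_form w (E k) = (\sum_a w a * (gM *m EM^T) a k).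
  rewrite /metric_form; apply: eq_bigr => a _; rewrite mxE mulr_sumr.
  by apply: eq_bigr => b _; rewrite !mxE; ring.
pose um : 'rV[R]_7 := \row_a u a; pose vm : 'rV[R]_7 := \row_a v a.
have -> : metric_form u v = (um *m (gM *m vm^T)) 0 0.
  rewrite mxE; apply: eq_bigr => a _; rewrite !mxE mulr_sumr.
  by apply: eq_bigr => b _; rewrite !mxE; ring.
have HH : gM = (gM *m EM^T) *m (gM *m EM^T)^T.
  have gT : gM^T = gM by apply/matrixP => a b; rewrite !mxE.
  by rewrite trmx_mul trmxK gT mulmxA (mulmx1C frame_mx) mul1mx.
rewrite HH -mulmxA mulmxA mxE; apply: eq_bigr => k _.
rewrite !Ek !mxE; congr (_ * _); apply: eq_bigr => a _; rewrite !mxE //.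
by rewrite mulrC; congr (_ * _); apply: eq_bigr => b _; rewrite !mxE.
Qed.

End OrthonormalFrame.

End Orthonormal.

(** * The model 3-form *)

Definition p1 := BinInt.Z.one.
Definition m1 := BinInt.Z.opp BinInt.Z.one.
Definition z0 := BinNums.Z0.

(** The entry [(s, k)] at row [i] and column [j] encodes [e_i x e_j = s e_k]. *)
Definition cross0 : seq (seq (BinNums.Z * nat)) :=
  [:: [:: (z0,0); (p1,2); (m1,1); (p1,4); (m1,3); (p1,6); (m1,5)];
      [:: (m1,2); (z0,0); (p1,0); (p1,5); (m1,6); (m1,3); (p1,4)];
      [:: (p1,1); (m1,0); (z0,0); (m1,6); (m1,5); (p1,4); (p1,3)];
      [:: (m1,4); (m1,5); (p1,6); (z0,0); (p1,0); (p1,1); (m1,2)];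
      [:: (p1,3); (p1,6); (p1,5); (m1,0); (z0,0); (m1,2); (m1,1)];
      [:: (m1,6); (p1,3); (m1,4); (m1,1); (p1,2); (z0,0); (p1,0)];
      [:: (p1,5); (m1,4); (m1,3); (p1,2); (p1,1); (m1,0); (z0,0)]]%N.

Definition cross i j := nth (z0, 0%N) (nth [::] cross0 i) j.
Definition phi0 i j k : BinNums.Z :=
  let c := cross i j in if eqn c.2 k then c.1 else z0.
Definition del i j : BinNums.Z := if eqn i j then p1 else z0.
Definition psi0 i j k l : BinNums.Z :=
  let c := cross i j in
  BinInt.Z.sub (BinInt.Z.sub (BinInt.Z.mul (del i k) (del j l))
    (BinInt.Z.mul (del i l) (del j k)))
    (BinInt.Z.mul c.1 (phi0 k l c.2)).

Lemma phi0_alt_check : all (fun i => all (fun j => all (fun k =>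
    BinInt.Z.eqb (phi0 i j k) (BinInt.Z.opp (phi0 j i k)) &&
    BinInt.Z.eqb (phi0 i j k) (BinInt.Z.opp (phi0 i k j))) idx7) idx7) idx7.
Proof. by vm_compute. Qed.

Lemma mem_idx7 i : (i < 7)%N -> i \in idx7.
Proof. by rewrite mem_iota. Qed.

Lemma phi0_alt i j k : (i < 7)%N -> (j < 7)%N -> (k < 7)%N ->
  phi0 i j k = BinInt.Z.opp (phi0 j i k) /\ phi0 i j k = BinInt.Z.opp (phi0 i k j).
Proof.
move=> /mem_idx7 i7 /mem_idx7 j7 /mem_idx7 k7.
have := phi0_alt_check => /seq.allP/(_ _ i7)/seq.allP/(_ _ j7)/seq.allP/(_ _ k7).
by move=> /andP[/BinInt.Z.eqb_eq E1 /BinInt.Z.eqb_eq E2].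
Qed.

(** * The cross product *)

Section CrossProduct.
Variable R : realType.
Notation ten1 := ('I_7 -> R).
Variables (g : 'I_7 -> 'I_7 -> R) (phi : 'I_7 -> 'I_7 -> 'I_7 -> R) (vol : R).
Hypothesis gC : forall a b, g a b = g b a.
Hypothesis gpos : forall v : 'I_7 -> R, (exists a, v a != 0) ->
  0 < \sum_a \sum_b g a b * v a * v b.
Hypothesis vol2 : vol ^+ 2 = \det (\matrix_(a < 7, b < 7) g a b).
Hypothesis phi12 : forall a b c, phi a b c = - phi b a c.
Hypothesis phi23 : forall a b c, phi a b c = - phi a c b.
Hypothesis compat : forall a b,
  wedge223 (phi a) (phi b) phi = - 6 * g a b * vol.
Notation gg := (metric_form g).
Notation orthonormal := (orthonormal_seq g).

Definition phi_form (u v w : ten1) : R := ext (ten_seq3 phi) [:: u; v; w].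

Lemma ppE u v w : phi_form u v w = \sum_a \sum_b \sum_c u a * v b * w c * phi a b c.
Proof.
apply: eq_bigr => a _; rewrite mulr_sumr; apply: eq_bigr => b _.
by rewrite !mulr_sumr; apply: eq_bigr => c _ /=; rewrite !mulrA.
Qed.

Lemma pp12 u v w : phi_form u v w = - phi_form v u w.
Proof.
rewrite !ppE exchange_big -sumrN; apply: eq_bigr => i _ /=.
rewrite -sumrN; apply: eq_bigr => j _; rewrite -sumrN; apply: eq_bigr => k _.
by rewrite phi12; ring.
Qed.

Lemma pp23 u v w : phi_form u v w = - phi_form u w v.
Proof.
rewrite !ppE -sumrN; apply: eq_bigr => i _ /=.
rewrite exchange_big -sumrN; apply: eq_bigr => j _ /=.
rewrite -sumrN; apply: eq_bigr => k _.
by rewrite phi23; ring.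
Qed.

Lemma pp_lin1 c d u v x y : phi_form (lin c d u v) x y = c * phi_form u x y + d * phi_form v x y.
Proof.
rewrite !ppE !mulr_sumr -big_split; apply: eq_bigr => i _ /=.
rewrite !mulr_sumr -big_split; apply: eq_bigr => j _ /=.
by rewrite !mulr_sumr -big_split; apply: eq_bigr => k _ /=; rewrite /lin; ring.
Qed.

(** The vector metrically dual to [phi u v]. *)
Definition crossp (u v : ten1) : ten1 :=
  fun a => \sum_b metric_inv g a b * phi_form u v (evec R b).

Lemma gg_cr u v w : gg (crossp u v) w = phi_form u v w.
Proof.
have [|E [oE _]] := orthonormal_complete gC gpos (F := [::]) _ isT.
  by move=> i j.
have [gu _] : \matrix_(a, b) g a b \in unitmx /\ True.
  by split=> //; have := mulmx1C (frame_mx oE); rewrite -mulmxA => /mulmx1_unit[].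
have inv b c : \sum_a metric_inv g a b * g a c = (b == c)%:R.
  have := congr1 (fun M : 'M[R]_7 => M c b) (mulmxV gu); rewrite !mxE eq_sym => <-.
  by apply: eq_bigr => a _; rewrite /metric_inv mxE gC mulrC.
transitivity (\sum_c w c * phi_form u v (evec R c)).
  rewrite /metric_form exchange_big; apply: eq_bigr => c _ /=.
  transitivity (\sum_a \sum_b w c * (metric_inv g a b * g a c) * phi_form u v (evec R b)).
    apply: eq_bigr => a _; rewrite /crossp mulr_sumr mulr_suml.
    by apply: eq_bigr => b _; ring.
  rewrite exchange_big /=.
  under eq_bigr do rewrite -mulr_suml -mulr_sumr inv.
  rewrite (bigD1 c) //= eqxx mulr1 big1 ?addr0 // => b bc.
  by rewrite (negbTE bc) mulr0 mul0r.
have pe c : phi_form u v (evec R c) = \sum_a \sum_b u a * v b * phi a b c.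
  rewrite ppE; apply: eq_bigr => i _; apply: eq_bigr => j _.
  rewrite (bigD1 c) //= /evec eqxx mulr1 big1 ?addr0 // => k kc.
  by rewrite (negbTE kc) mulr0 mul0r.
rewrite ppE.
transitivity (\sum_c \sum_a \sum_b u a * v b * w c * phi a b c).
  apply: eq_bigr => c _; rewrite pe mulr_sumr; apply: eq_bigr => a _.
  by rewrite mulr_sumr; apply: eq_bigr => b _; ring.
rewrite exchange_big; apply: eq_bigr => a _ /=.
by rewrite exchange_big.
Qed.

(** The hypotheses of [hitchin] hold in an orthonormal frame, where the
    compatibility form is a nonzero multiple of the identity. *)
Lemma orthonormal_cross (E : 'I_7 -> ten1) :
  (forall i j, gg (E i) (E j) = (i == j)%:R) ->
  exists2 K, K != 0 & forall j l : 'I_7, j != 0 -> l != 0 ->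
    gg (crossp (E 0) (E j)) (crossp (E 0) (E l)) = K * (j == l)%:R.
Proof.
move=> oE.
have [d dE] : exists d, d = \det (\matrix_(a, i) E a i) by eexists.
have := frame_det oE vol2; rewrite -dE; set s := vol * d => s2.
have s0 : s != 0.
  by apply/eqP => s0; move: s2; rewrite s0 expr0n => /eqP; rewrite eq_sym oner_eq0.
have b0 : - 144 * s != 0 by rewrite mulf_neq0 // oppr_eq0 pnatr_eq0.
have [|K K0 HK] := hitchin (fr3_12 E phi12) (fr3_23 E phi23) b0.
  move=> j k; rewrite (wedge_frame E phi12 phi23) -dE -oE /metric_form !mulr_sumr.
  apply: eq_bigr => a _; rewrite !mulr_sumr; apply: eq_bigr => b _.
  by rewrite compat /s; ring.
exists K => // j l j0 l0.
rewrite (gg_frame gC oE) big_ord_recl.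
rewrite [X in X * _](_ : _ = 0) ?mul0r ?add0r; last first.
  rewrite gg_cr; have : phi_form (E 0) (E j) (E ord0) = - phi_form (E 0) (E j) (E ord0).
    by rewrite [LHS]pp23 pp12 pp23 !opprK -pp12.
  lra.
have [j' jE|] := unliftP ord0 j; last by move=> E0; move: j0; rewrite E0 eqxx.
have [l' lE|] := unliftP ord0 l; last by move=> E0; move: l0; rewrite E0 eqxx.
rewrite jE lE (inj_eq lift_inj) -HK; apply: eq_bigr => k _.
have L (i : 'I_6) : inord i.+1 = lift ord0 i :> 'I_7.
  by apply: val_inj; rewrite /= inordK // ltnS ltn_ord.
have L0 : inord 0 = 0 :> 'I_7 by apply: val_inj; rewrite /= inordK.
by rewrite !gg_cr !L L0 /fr3.
Qed.

(** Complete the triple to an orthonormal frame starting with [u]. *)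
Lemma cross_triple u v w : orthonormal [:: u; v; w] ->
  [/\ gg (crossp u v) (crossp u w) = 0,
      gg (crossp u v) (crossp u v) = gg (crossp u w) (crossp u w) & gg (crossp u v) (crossp u v) != 0].
Proof.
move=> o; have [E [oE EF]] := orthonormal_complete gC gpos o isT.
have [K K0 HK] := orthonormal_cross oE.
have E0 : E 0 = u by rewrite EF.
have E1 : E (inord 1) = v by rewrite EF inordK.
have E2 : E (inord 2) = w by rewrite EF inordK.
have i1 : inord 1 != 0 :> 'I_7 by rewrite -val_eqE /= inordK.
have i2 : inord 2 != 0 :> 'I_7 by rewrite -val_eqE /= inordK.
have := HK _ _ i1 i2; have := HK _ _ i1 i1; have := HK _ _ i2 i2.
rewrite E0 E1 E2 !eqxx -val_eqE /= !inordK //= !mulr1 mulr0 => -> -> ->.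
by [].
Qed.


Lemma orthonormal3 u v w : gg u u = 1 -> gg v v = 1 -> gg w w = 1 ->
  gg u v = 0 -> gg u w = 0 -> gg v w = 0 -> orthonormal [:: u; v; w].
Proof.
move=> uu vv ww uv uw vw [|[|[|i]]] [|[|[|j]]] //= _ _.
all: by rewrite ggC.
Qed.

Lemma cross_swap u v x y : gg (crossp u v) (crossp x y) = gg (crossp v u) (crossp y x).
Proof.
have N a b c : gg (crossp a b) c = - gg (crossp b a) c by rewrite !gg_cr pp12.
by rewrite N ggC // N opprK ggC.
Qed.

(** Apply [cross_triple] to [(u + u') / sqrt 2], [v] and [w]. *)
Lemma cross_polar u u' v w : gg u u = 1 -> gg u' u' = 1 -> gg v v = 1 -> gg w w = 1 ->
  gg u u' = 0 -> gg u v = 0 -> gg u w = 0 -> gg u' v = 0 -> gg u' w = 0 -> gg v w = 0 ->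
  gg (crossp u v) (crossp u' w) + gg (crossp u' v) (crossp u w) = 0.
Proof.
move=> uu uu' vv ww u_u' uv uw uv' uw' vw.
pose r := (Num.sqrt 2 : R)^-1; pose s := lin r r u u'.
have r2 : r * r = 2^-1.
  by rewrite /r -invfM -expr2 sqr_sqrtr.
have ss : gg s s = 1.
  rewrite /s gg_linl !gg_linr // uu uu' u_u' (ggC gC u' u) u_u'.
  by rewrite !mulr1 !mulr0 addr0 add0r r2; field.
have o : orthonormal [:: s; v; w].
  by apply: orthonormal3 => //; rewrite /s gg_linl ?uv ?uv' ?uw ?uw' !mulr0 addr0.
have crl x y : gg (crossp s x) y = r * gg (crossp u x) y + r * gg (crossp u' x) y.
  have cE a : crossp s x a = lin r r (crossp u x) (crossp u' x) a.
    rewrite /crossp /lin !mulr_sumr -big_split; apply: eq_bigr => b _ /=.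
    by rewrite pp_lin1; ring.
  by rewrite -gg_linl; apply: eq_bigr => a _; apply: eq_bigr => b _; rewrite cE.
have [uvw _ _] := @cross_triple u v w (orthonormal3 uu vv ww uv uw vw).
have [uvw' _ _] := @cross_triple u' v w (orthonormal3 uu' vv ww uv' uw' vw).
have [+ _ _] := cross_triple o.
rewrite crl !(ggC gC _ (crossp s w)) !crl !(ggC gC (crossp _ w)) uvw uvw'.
rewrite !mulr0 add0r addr0 !mulrA r2 => H; lra.
Qed.

(** The frame [e0, e1, e2 = e0 x e1, e3, e4 = e0 x e3, e5 = e1 x e3,
    e6 = e0 x e5], up to the unknown length [mu] of a cross product. *)
Lemma cross_frame : exists (mu : R) (E : 'I_7 -> ten1), [/\ 0 < mu,
    forall i j, gg (E i) (E j) = (i == j)%:R &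
    let f i j k := fr3 phi E (inord i) (inord j) (inord k) in
    forall k, (k < 7)%N -> [/\ f 0%N 1%N k = mu * (k == 2%N)%:R, f 0%N 3%N k = mu * (k == 4%N)%:R,
      f 1%N 3%N k = mu * (k == 5%N)%:R & f 0%N 5%N k = mu * (k == 6%N)%:R]].
Proof.
have [|E0 [oE0 _]] := orthonormal_complete gC gpos (F := [::]) _ isT.
  by move=> i j.
pose e0 := E0 0; pose e1 := E0 1; pose z := E0 (inord 2).
have e00 : gg e0 e0 = 1 by rewrite oE0.
have e11 : gg e1 e1 = 1 by rewrite oE0.
have e01 : gg e0 e1 = 0 by rewrite oE0.
have zz : gg z z = 1 by rewrite oE0 eqxx.
have z0 : gg e0 z = 0 by rewrite oE0 -val_eqE /= inordK.
have z1 : gg e1 z = 0 by rewrite oE0 -val_eqE /= inordK.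
pose K := gg (crossp e0 e1) (crossp e0 e1).
have [_ _ K0] := cross_triple (orthonormal3 e00 e11 zz e01 z0 z1).
have ge0 v : 0 <= gg v v.
  have [[a va]|v0] := pselect (exists a, v a != 0); first by apply/ltW/gpos; exists a.
  rewrite /metric_form big1 // => a _; rewrite big1 // => b _.
  have -> : v b = 0 by apply: contra_notP v0 => /eqP vb; exists b.
  by rewrite mulr0.
have Kpos : 0 < K by rewrite lt_def K0 ge0.
pose mu := Num.sqrt K; have mu0 : 0 < mu by rewrite sqrtr_gt0.
have muN : mu != 0 by rewrite gt_eqF.
have mu2 : mu * mu = K by rewrite -expr2 sqr_sqrtr // ltW.
pose nc u v := lin mu^-1 0 (crossp u v) (crossp u v).
have ncE u v w : gg (nc u v) w = mu^-1 * gg (crossp u v) w.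
  by rewrite /nc gg_linl mul0r addr0.
have ncE' u v w : gg w (nc u v) = mu^-1 * gg (crossp u v) w.
  by rewrite ggC // ncE.
have cr1 u v w : gg (crossp u v) w = mu * gg (nc u v) w.
  by rewrite ncE mulrA mulfV // mul1r.
have perp2 u v : gg (crossp u v) v = 0 by rewrite gg_cr; have := pp23 u v v; lra.
have perp1 u v : gg (crossp u v) u = 0 by rewrite gg_cr pp12 -gg_cr perp2 oppr0.
have nn u v : gg (crossp u v) (crossp u v) = K -> gg (nc u v) (nc u v) = 1.
  by move=> H; rewrite ncE ncE' H -mu2; field.
pose e2 := nc e0 e1.
have e22 : gg e2 e2 = 1 by exact: nn.
have e02 : gg e0 e2 = 0 by rewrite ncE' perp1 mulr0.
have e12 : gg e1 e2 = 0 by rewrite ncE' perp2 mulr0.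
have o3 := orthonormal3 e00 e11 e22 e01 e02 e12.
have [E3 [oE3 EF3]] := orthonormal_complete gC gpos o3 isT.
pose e3 := E3 (inord 3).
have f0 : E3 (inord 0) = e0 by rewrite EF3 inordK.
have f1 : E3 (inord 1) = e1 by rewrite EF3 inordK.
have f2 : E3 (inord 2) = e2 by rewrite EF3 inordK.
have e33 : gg e3 e3 = 1 by rewrite oE3 eqxx.
have e03 : gg e0 e3 = 0 by rewrite -f0 oE3 -val_eqE /= !inordK.
have e13 : gg e1 e3 = 0 by rewrite -f1 oE3 -val_eqE /= !inordK.
have e23 : gg e2 e3 = 0 by rewrite -f2 oE3 -val_eqE /= !inordK.
have sym u v : gg u v = 0 -> gg v u = 0 by rewrite ggC.
pose e4 := nc e0 e3.
have [t1 t2 _] := cross_triple (orthonormal3 e00 e11 e33 e01 e03 e13).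
have e44 : gg e4 e4 = 1 by apply: nn; rewrite -t2.
have e04 : gg e0 e4 = 0 by rewrite ncE' perp1 mulr0.
have e34 : gg e3 e4 = 0 by rewrite ncE' perp2 mulr0.
have e24 : gg e2 e4 = 0 by rewrite ncE ncE' ggC // t1 !mulr0.
have e14 : gg e1 e4 = 0.
  by rewrite ncE' gg_cr pp23 -gg_cr cr1 -/e2 e23 mulr0 oppr0 mulr0.
pose e5 := nc e1 e3.
have [t3 t4 _] := cross_triple (orthonormal3 e11 e00 e33 (sym _ _ e01) e13 e03).
have [t5 _ _] := cross_triple (orthonormal3 e33 e11 e00 (sym _ _ e13) (sym _ _ e03) (sym _ _ e01)).
have e55 : gg e5 e5 = 1 by apply: nn; rewrite -t4 cross_swap.
have e15 : gg e1 e5 = 0 by rewrite ncE' perp1 mulr0.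
have e35 : gg e3 e5 = 0 by rewrite ncE' perp2 mulr0.
have e05 : gg e0 e5 = 0.
  by rewrite ncE' gg_cr pp23 pp12 opprK -gg_cr cr1 -/e2 e23 !mulr0.
have e25 : gg e2 e5 = 0.
  rewrite ncE ncE' ggC // gg_cr pp12 -gg_cr.
  by rewrite (ggC gC (crossp e1 e0)) in t3 *; rewrite t3 oppr0 !mulr0.
have e45 : gg e4 e5 = 0.
  by rewrite ncE ncE' cross_swap t5 !mulr0.
pose e6 := nc e0 e5.
have [t6 t7 _] := cross_triple (orthonormal3 e00 e11 e55 e01 e05 e15).
have [t8 _ _] := cross_triple (orthonormal3 e00 e33 e55 e03 e05 e35).
have e66 : gg e6 e6 = 1 by apply: nn; rewrite -t7.
have e06 : gg e0 e6 = 0 by rewrite ncE' perp1 mulr0.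
have e56 : gg e5 e6 = 0 by rewrite ncE' perp2 mulr0.
have e16 : gg e1 e6 = 0.
  by rewrite ncE' gg_cr pp23 -gg_cr cr1 -/e2 e25 mulr0 oppr0 mulr0.
have e26 : gg e2 e6 = 0 by rewrite ncE ncE' ggC // t6 !mulr0.
have e36 : gg e3 e6 = 0.
  by rewrite ncE' gg_cr pp23 -gg_cr cr1 -/e4 e45 mulr0 oppr0 mulr0.
have e46 : gg e4 e6 = 0 by rewrite ncE ncE' ggC // t8 !mulr0.
pose E (i : 'I_7) := nth (fun=> 0 : R) [:: e0; e1; e2; e3; e4; e5; e6] i.
have oE i j : gg (E i) (E j) = (i == j)%:R.
  rewrite -val_eqE /E; case: i => i /= li; case: j => j /= lj.
  by move: i li j lj => [|[|[|[|[|[|[|i]]]]]]] // _ [|[|[|[|[|[|[|j]]]]]]] //= _;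
    rewrite ?(ggC gC e6) ?(ggC gC e5) ?(ggC gC e4) ?(ggC gC e3) ?(ggC gC e2) ?(ggC gC e1) //; rewrite ggC.
exists mu, E; split=> // f k k7.
have H i j m : (i < 7)%N -> (j < 7)%N -> (m < 7)%N ->
    nc (E (inord i)) (E (inord j)) = E (inord m) -> f i j k = mu * (k == m)%:R.
  move=> i7 j7 m7 nE; rewrite /f /fr3 -/(phi_form _ _ _) -gg_cr cr1 nE oE.
  by rewrite -val_eqE /= !inordK // eq_sym.
by split; apply: H; rewrite // /E !inordK.
Qed.

End CrossProduct.

(** * Existence of adapted frames *)

Section NormalForm.
Variables (R : realType) (mu : R) (f : nat -> nat -> nat -> R).
Hypothesis mu0 : mu != 0.
Hypothesis f12 : forall a b c, f a b c = - f b a c.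
Hypothesis f23 : forall a b c, f a b c = - f a c b.
Hypothesis rows : forall k, (k < 7)%N ->
  [/\ f 0%N 1%N k = mu * (k == 2%N)%:R, f 0%N 3%N k = mu * (k == 4%N)%:R,
      f 1%N 3%N k = mu * (k == 5%N)%:R & f 0%N 5%N k = mu * (k == 6%N)%:R].
Hypothesis rel3 : forall i j l, uniq [:: i; j; l] -> all (ltn^~ 7) [:: i; j; l] ->
  \sum_(k < 7) f i j k * f i l k = 0.
Hypothesis rel4 : forall i a j b, uniq [:: i; a; j; b] ->
  all (ltn^~ 7) [:: i; a; j; b] ->
  \sum_(k < 7) f i j k * f a b k + \sum_(k < 7) f a j k * f i b k = 0.

Lemma sum7 (F : nat -> R) :
  \sum_(k < 7) F k = F 0%N + F 1%N + F 2%N + F 3%N + F 4%N + F 5%N + F 6%N.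
Proof.
rewrite -(big_mkord xpredT F) /index_iota /= !big_cons big_nil; ring.
Qed.

Lemma faa a c : f a a c = 0.
Proof. by have := f12 a a c; lra. Qed.

Lemma fcyc a b c : f a b c = f b c a.
Proof. by rewrite f12 f23 opprK. Qed.

(** [e0 x e_j = s e_k] up to the common length, where [partner j = (k, s)]. *)
Definition partner (j : nat) : nat * R :=
  match j with
  | 1%N => (2%N, 1) | 2%N => (1%N, -1) | 3%N => (4%N, 1) | 4%N => (3%N, -1)
  | 5%N => (6%N, 1) | 6%N => (5%N, -1) | _ => (0%N, 0)
  end.

Lemma row0 j k : (j < 7)%N -> (k < 7)%N ->
  f 0%N j k = mu * ((partner j).2 * (k == (partner j).1)%:R).
Proof.
have r1 k' : (k' < 7)%N -> f 0%N 1%N k' = mu * (k' == 2%N)%:R by move=> /rows[].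
have r3 k' : (k' < 7)%N -> f 0%N 3%N k' = mu * (k' == 4%N)%:R by move=> /rows[].
have r5 k' : (k' < 7)%N -> f 0%N 5%N k' = mu * (k' == 6%N)%:R by move=> /rows[].
have z1 b : uniq [:: 0%N; 1%N; b] -> (b < 7)%N -> f 0%N b 2%N = 0.
  move=> u b7; have := rel3 u; rewrite /= b7 => /(_ isT).
  rewrite (sum7 (fun k => f 0%N 1%N k * f 0%N b k)) !r1 //= !mulr0 mulr1 !mul0r.
  by rewrite !add0r !addr0 => /eqP; rewrite mulf_eq0 (negbTE mu0) => /eqP.
have z3 b : uniq [:: 0%N; 3%N; b] -> (b < 7)%N -> f 0%N b 4%N = 0.
  move=> u b7; have := rel3 u; rewrite /= b7 => /(_ isT).
  rewrite (sum7 (fun k => f 0%N 3%N k * f 0%N b k)) !r3 //= !mulr0 mulr1 !mul0r.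
  by rewrite !add0r !addr0 => /eqP; rewrite mulf_eq0 (negbTE mu0) => /eqP.
have c0 j' : f 0%N j' 0%N = 0 by rewrite fcyc fcyc faa.
have d0 j' : f 0%N j' j' = 0 by rewrite fcyc faa.
move: j k => [|[|[|[|[|[|[|j]]]]]]] // [|[|[|[|[|[|[|k]]]]]]] // _ _;
  rewrite /= ?mul0r ?mulr0 ?mul1r ?mulr1 ?mulrN1 ?(faa, c0, d0) //;
  do ?[by rewrite r1 //= ?mulr1 ?mulr0|by rewrite r3 //= ?mulr1 ?mulr0|by rewrite r5 //= ?mulr1 ?mulr0
      |by rewrite f23 r1 //= ?mulr1 ?mulr0 ?oppr0|by rewrite f23 r3 //= ?mulr1 ?mulr0 ?oppr0|by rewrite f23 r5 //= ?mulr1 ?mulr0 ?oppr0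
      |by rewrite z1|by rewrite z3|by rewrite f23 z1 ?oppr0|by rewrite f23 z3 ?oppr0].
Qed.

(** The polarised relation with [e0] expresses that cross products with [e0]
    permute the other components of [phi] up to sign. *)
Lemma rel0 a j b : uniq [:: 0%N; a; j; b] -> all (ltn^~ 7) [:: 0%N; a; j; b] ->
  (partner j).2 * f a b (partner j).1 + (partner b).2 * f a j (partner b).1 = 0.
Proof.
move=> u l; have := rel4 u l; case/and5P: l => _ a7 j7 b7 _.
rewrite (eq_bigr (fun k : 'I_7 => mu * ((partner j).2 * (nat_of_ord k == (partner j).1)%:R) * f a b k)); last first.
  by move=> k _; rewrite row0.
rewrite [X in _ + X](eq_bigr (fun k : 'I_7 => f a j k * (mu * ((partner b).2 * (nat_of_ord k == (partner b).1)%:R)))); last first.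
  by move=> k _; rewrite (row0 b7).
have p7 i : ((partner i).1 < 7)%N by case: i => [|[|[|[|[|[|[|i]]]]]]].
rewrite (bigD1 (Ordinal (p7 j))) //= eqxx [X in _ + X + _]big1; last first.
  by move=> k; rewrite -val_eqE /= => /negbTE ->; rewrite !mulr0 mul0r.
rewrite addr0 (bigD1 (Ordinal (p7 b))) //= eqxx big1; last first.
  by move=> k; rewrite -val_eqE /= => /negbTE ->; rewrite !mulr0.
rewrite addr0 /= !mulr1 => H; apply: (mulfI mu0); rewrite mulr0 -[RHS]H; ring.
Qed.

Lemma rel00 a j : uniq [:: 0%N; a; j] -> all (ltn^~ 7) [:: 0%N; a; j] ->
  f a j (partner j).1 = 0.
Proof.
move=> u l; have u' : uniq [:: j; 0%N; a].
  by move: u; rewrite -(rot_uniq 2).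
have l' : all (ltn^~ 7) [:: j; 0%N; a] by move: l => /= /andP[-> /andP[-> _]].
have := rel3 u' l'; case/and4P: l => _ a7 j7 _.
rewrite (eq_bigr (fun k : 'I_7 => mu * ((partner j).2 * (nat_of_ord k == (partner j).1)%:R) * f a j k)); last first.
  by move=> k _; rewrite (f12 j 0%N) (f12 j a) mulrNN row0.
have p7 i : ((partner i).1 < 7)%N by case: i => [|[|[|[|[|[|[|i]]]]]]].
rewrite (bigD1 (Ordinal (p7 j))) //= eqxx big1; last first.
  by move=> k; rewrite -val_eqE /= => /negbTE ->; rewrite !mulr0 mul0r.
rewrite addr0 mulr1 => /eqP; rewrite !mulf_eq0 (negbTE mu0) /= => /orP[|/eqP //].
case: j u j7 {l' u'} => [|[|[|[|[|[|[|j]]]]]]] //=; rewrite ?oppr_eq0 ?oner_eq0 //.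
by rewrite !inE orbT.
Qed.

(** The rows of [e0] and of [e1 x e3] are known; the relations [rel0], [rel00],
    [rel3] and [rel4] determine or annihilate every remaining component. *)
Lemma normal_form i j k : (i < 7)%N -> (j < 7)%N -> (k < 7)%N ->
  f i j k = mu * zr R (phi0 i j k).
Proof.
have zrp : zr R p1 = 1 by [].
have zrm : zr R m1 = -1 by [].
have zrz : zr R z0 = 0 by [].
have v135 : f 1%N 3%N 5%N = mu by have [_ _ -> _] := rows (isT : 5 < 7)%N; rewrite mulr1.
have v136 : f 1%N 3%N 6%N = 0 by have [_ _ -> _] := rows (isT : 6 < 7)%N; rewrite mulr0.
have v146 : f 1%N 4%N 6%N = - mu.
  by have := @rel0 1 3 6 isT isT; rewrite /= (f23 1%N 6%N) v135; lra.
have v145 : f 1%N 4%N 5%N = 0.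
  by have := @rel0 1 3 5 isT isT; rewrite /= (f23 1%N 5%N) v136; lra.
have v236 : f 2%N 3%N 6%N = - mu.
  by have := @rel0 3 1 6 isT isT; rewrite /= (fcyc 2%N) (f12 3%N 1%N) v135; lra.
have v245 : f 2%N 4%N 5%N = - mu.
  by have := @rel0 5 1 4 isT isT; rewrite /= (fcyc 2%N) (f12 4%N 5%N) (fcyc 5%N 1%N) v135; lra.
have v235 : f 2%N 3%N 5%N = 0.
  by have := @rel0 3 1 5 isT isT; rewrite /= (fcyc 2%N) (f12 3%N 1%N) v136; lra.
have v246 : f 2%N 4%N 6%N = 0.
  by have := @rel0 4 1 6 isT isT; rewrite /= (fcyc 2%N) (f12 4%N 1%N) v145; lra.
have w a j' : uniq [:: 0%N; a; j'] -> all (ltn^~ 7) [:: 0%N; a; j'] ->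
   f a j' (partner j').1 = 0 := @rel00 a j'.
have zE := (zrp, zrm, zrz, mulr0, mulr1, mulrN1).
have f0 b c : (b < 7)%N -> (c < 7)%N -> f 0%N b c = mu * zr R (phi0 0 b c).
  move=> b7 c7; rewrite row0 //; congr (_ * _).
  move: b c b7 c7 => [|[|[|[|[|[|[|b]]]]]]] // [|[|[|[|[|[|[|c]]]]]]] // _ _;
  by rewrite /phi0 /= ?zE ?mul0r.
have v3 a j' : uniq [:: 0%N; a; j'] -> all (ltn^~ 7) [:: 0%N; a; j'] ->
   f a j' (partner j').1 = 0 := @rel00 a j'.
have v123 : f 1%N 2%N 3%N = 0 by rewrite -fcyc; exact: (v3 3%N 1%N).
have v124 : f 1%N 2%N 4%N = 0 by rewrite -fcyc; exact: (v3 4%N 1%N).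
have v125 : f 1%N 2%N 5%N = 0 by rewrite -fcyc; exact: (v3 5%N 1%N).
have v126 : f 1%N 2%N 6%N = 0 by rewrite -fcyc; exact: (v3 6%N 1%N).
have v134 : f 1%N 3%N 4%N = 0 by exact: (v3 1%N 3%N).
have v234 : f 2%N 3%N 4%N = 0 by exact: (v3 2%N 3%N).
have v345 : f 3%N 4%N 5%N = 0 by rewrite -fcyc; exact: (v3 5%N 3%N).
have v346 : f 3%N 4%N 6%N = 0 by rewrite -fcyc; exact: (v3 6%N 3%N).
have v156 : f 1%N 5%N 6%N = 0 by exact: (v3 1%N 5%N).
have v256 : f 2%N 5%N 6%N = 0 by exact: (v3 2%N 5%N).
have v356 : f 3%N 5%N 6%N = 0 by exact: (v3 3%N 5%N).
have v456 : f 4%N 5%N 6%N = 0 by exact: (v3 4%N 5%N).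
have vE := (v123, v124, v125, v126, v134, v135, v136, v145, v146, v156,
  (v234, v235, v236, v245, v246, v256, v345, v346, v356, v456)).
have fS a b c : (a < b)%N -> (b < c)%N -> (c < 7)%N -> f a b c = mu * zr R (phi0 a b c).
  move=> ab bc c7; case: a ab => [|a] ab; first by apply: f0 => //; apply: ltn_trans c7.
  case: a ab => [|a] ab.
    move: b c ab bc c7 => [|[|[|[|[|[|b]]]]]] // [|[|[|[|[|[|[|c]]]]]]] // _ _ _;
    by rewrite vE /phi0 /= ?zE.
  case: a ab => [|a] ab.
    move: b c ab bc c7 => [|[|[|[|[|[|b]]]]]] // [|[|[|[|[|[|[|c]]]]]]] // _ _ _;
    by rewrite vE /phi0 /= ?zE.
  case: a ab => [|a] ab.
    move: b c ab bc c7 => [|[|[|[|[|[|b]]]]]] // [|[|[|[|[|[|[|c]]]]]]] // _ _ _;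
    by rewrite vE /phi0 /= ?zE.
  case: a ab => [|a] ab; last first.
    by exfalso; lia.
  move: b c ab bc c7 => [|[|[|[|[|[|b]]]]]] // [|[|[|[|[|[|[|c]]]]]]] // _ _ _;
  by rewrite vE /phi0 /= ?zE.
pose d a b c := f a b c - mu * zr R (phi0 a b c).
have zN z : zr R (BinInt.Z.opp z) = - zr R z.
  by rewrite /zr -mulrNz; congr (_%:~R); lia.
have d12 a b c : (a < 7)%N -> (b < 7)%N -> (c < 7)%N -> d a b c = - d b a c.
  by move=> a7 b7 c7; rewrite /d (phi0_alt a7 b7 c7).1 zN f12; ring.
have d23 a b c : (a < 7)%N -> (b < 7)%N -> (c < 7)%N -> d a b c = - d a c b.
  by move=> a7 b7 c7; rewrite /d (phi0_alt a7 b7 c7).2 zN f23; ring.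
have dS a b c : (a < b)%N -> (b < c)%N -> (c < 7)%N -> d a b c = 0.
  by move=> ab bc c7; rewrite /d fS // subrr.
have x0 (x : R) : x = - x -> x = 0 by lra.
have d3 a b c : (a < b)%N -> (a < 7)%N -> (b < 7)%N -> (c < 7)%N -> d a b c = 0.
  move=> ab a7 b7 c7; case: (ltngtP b c) => [bc|cb|<-]; first exact: dS.
    rewrite d23 //; case: (ltngtP a c) => [ac|ca|->]; first by rewrite dS ?oppr0.
      by rewrite d12 // dS // !oppr0.
    by rewrite (x0 (d c c b)) ?oppr0 //; exact: d12.
  by apply: x0; exact: d23.
move=> i7 j7 k7; suff : d i j k = 0 by rewrite /d => /eqP; rewrite subr_eq0 => /eqP.
case: (ltngtP i j) => [ij|ji|<-]; first exact: d3.
  by rewrite d12 // d3 // oppr0.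
by apply: x0; exact: d12.
Qed.

End NormalForm.

Section FrameComponents.
Variables (R : realType) (E : 'I_7 -> 'I_7 -> R).

Definition fr1 (A : 'I_7 -> R) i := ext (ten_seq1 A) [:: E i].
Definition fr2 (A : 'I_7 -> 'I_7 -> R) i j := ext (ten_seq2 A) [:: E i; E j].
Definition fr4 (A : 'I_7 -> 'I_7 -> 'I_7 -> 'I_7 -> R) i j k l :=
  ext (ten_seq4 A) [:: E i; E j; E k; E l].

Lemma ext0 (A : seq 'I_7 -> R) vs :
  (forall s, size s = size vs -> A s = 0) -> ext A vs = 0.
Proof.
move=> A0; rewrite (ext_size (B := fun=> 0) A0).
elim: vs {A0} => [|v vs IH] //=; apply: big1 => i _.
by rewrite IH mulr0.
Qed.

Lemma frame_ten2 A s : ext (ten_seq2 A) [seq E i | i <- s] = ten_seq2 (fr2 A) s.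
Proof. by case: s => [|a [|b [|? ?]]] //; apply: ext0; case=> [|? [|? []]]. Qed.

Lemma frame_ten3 A s : ext (ten_seq3 A) [seq E i | i <- s] = ten_seq3 (fr3 A E) s.
Proof. by case: s => [|a [|b [|c [|? ?]]]] //; apply: ext0; case=> [|? [|? [|? []]]]. Qed.

Lemma frame_ten4 A s : ext (ten_seq4 A) [seq E i | i <- s] = ten_seq4 (fr4 A) s.
Proof.
by case: s => [|a [|b [|c [|d [|? ?]]]]] //; apply: ext0; case=> [|? [|? [|? [|? []]]]].
Qed.

End FrameComponents.

(** The first two conditions follow from the third, [E] being a square matrix;
    contractions and changes of basis use them in this form. *)
Definition adapted (R : realType) (g : 'I_7 -> 'I_7 -> R)
    (phi : 'I_7 -> 'I_7 -> 'I_7 -> R) (E : 'I_7 -> 'I_7 -> R) : Prop :=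
  [/\ forall p q, metric_inv g p q = \sum_s E s p * E s q,
      exists C : 'I_7 -> 'I_7 -> R, forall i j, evec R i j = \sum_s C i s * E s j,
      forall i j, fr2 E g i j = zr R (del i j) &
      forall i j k, fr3 phi E i j k = zr R (phi0 i j k)].

Section Adapted.
Variable R : realType.
Notation ten1 := ('I_7 -> R).
Variables (g : 'I_7 -> 'I_7 -> R) (phi : 'I_7 -> 'I_7 -> 'I_7 -> R) (vol : R).
Hypothesis gC : forall a b, g a b = g b a.
Hypothesis gpos : forall v : 'I_7 -> R, (exists a, v a != 0) ->
  0 < \sum_a \sum_b g a b * v a * v b.
Hypothesis vol2 : vol ^+ 2 = \det (\matrix_(a < 7, b < 7) g a b).
Hypothesis phi12 : forall a b c, phi a b c = - phi b a c.
Hypothesis phi23 : forall a b c, phi a b c = - phi a c b.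
Hypothesis compat : forall a b,
  wedge223 (phi a) (phi b) phi = - 6 * g a b * vol.
Notation gg := (metric_form g).

Lemma gg_fr2 E i j : gg (E i) (E j) = fr2 E g i j.
Proof.
apply: eq_bigr => a _; rewrite mulr_sumr; apply: eq_bigr => b _ /=; ring.
Qed.

(** The polynomial is cubic in [phi], and computation gives 144 on the model. *)
Lemma B00_model (mu : R) (val : var -> R) :
  (forall i j k, (i < 7)%N -> (j < 7)%N -> (k < 7)%N ->
     val [:: i; j; k] = mu * zr R (phi0 i j k)) ->
  peval val (Bpoly 0 0) = 144 * mu ^+ 3.
Proof.
move=> H.
pose ok (t : BinNums.Z * mono) := if t.2 is [:: [:: a; b; c]; [:: d; e; f]; [:: u; v; w]] then
  all (ltn^~ 7) [:: a; b; c; d; e; f; u; v; w] else false.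
pose z (t : BinNums.Z * mono) := if t.2 is [:: [:: a; b; c]; [:: d; e; f]; [:: u; v; w]] then
  BinInt.Z.mul t.1 (BinInt.Z.mul (phi0 a b c) (BinInt.Z.mul (phi0 d e f) (phi0 u v w))) else z0.
have okB : all ok (Bpoly 0 0) by vm_compute.
have sB : foldr (fun t s => BinInt.Z.add (z t) s) z0 (Bpoly 0 0) = BinInt.Z.of_nat 144.
  by vm_compute.
have -> : 144 = zr R (BinInt.Z.of_nat 144) by [].
rewrite -sB; clear sB; move: (Bpoly 0 0) okB; elim=> [|t p IH] /=.
  by rewrite peval_nil /zr /= mulr0z mul0r.
case/andP => okt okp; rewrite peval_cons zrD mulrDl IH //; congr (_ + _).
case: t okt => c [|[|a [|b [|d [|? ?]]]] [|[|a' [|b' [|d' [|? ?]]]] [|[|a'' [|b'' [|d'' [|? ?]]]] [|? ?]]]] //=.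
move=> /and4P[a1 b1 d1 /and4P[a2 b2 d2 /and4P[a3 b3 d3 _]]].
rewrite /meval !big_cons big_nil !H // !zrM /=; ring.
Qed.

(** The frame of [cross_frame] is normal up to the length [mu].  The compatibility
    identity at [e0] reads [mu^3 = - vol det E], and [vol det E] is a sign, so
    [mu = 1] because [mu > 0]. *)
Theorem adapted_frame : exists E, adapted g phi E /\ vol * \det (\matrix_(a, i) E a i) = -1.
Proof.
have [mu [E [mu0 oE rows]]] := cross_frame gC gpos vol2 phi12 phi23 compat.
pose f i j k := fr3 phi E (inord i) (inord j) (inord k).
have fcr i j k : fr3 phi E i j k = gg (crossp g phi (E i) (E j)) (E k).
  by rewrite (gg_cr phi gC gpos).
have dist (i j : nat) : (i < 7)%N -> (j < 7)%N -> i != j -> gg (E (inord i)) (E (inord j)) = 0.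
  by move=> i7 j7 ij; rewrite oE -val_eqE /= !inordK // (negbTE ij).
have unit i : gg (E i) (E i) = 1 by rewrite oE eqxx.
have fsum i j a b : \sum_(k < 7) f i j k * f a b k =
    gg (crossp g phi (E (inord i)) (E (inord j))) (crossp g phi (E (inord a)) (E (inord b))).
  rewrite (gg_frame gC oE); apply: eq_bigr => k _.
  by rewrite /f !fcr !inord_val.
have f0 i j k : (i < 7)%N -> (j < 7)%N -> (k < 7)%N -> f i j k = mu * zr R (phi0 i j k).
  apply: normal_form => //.
  - by rewrite gt_eqF.
  - by move=> a b c; apply: fr3_12.
  - by move=> a b c; apply: fr3_23.
  - move=> a b c /=; rewrite !inE !andbT !negb_or => /andP[/andP[ab ac] bc] /and3P[a7 b7 c7].
    rewrite fsum.
    have o : orthonormal_seq g [:: E (inord a); E (inord b); E (inord c)].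
      by apply: orthonormal3 => //; apply: dist.
    by have [] := cross_triple gC gpos vol2 phi12 phi23 compat o.
  - move=> u a v b /=; rewrite !inE !andbT !negb_or.
    move=> /and3P[/and3P[ua uv ub] /andP[av ab] vb] /and4P[u7 a7 v7 b7].
    by rewrite !fsum; apply: (cross_polar gC gpos vol2 phi12 phi23 compat) => //; apply: dist.
have s2 := frame_det oE vol2.
have [d dE] : exists d, d = \det (\matrix_(a, i) E a i) by eexists.
move: s2; rewrite -dE => s2.
have mu3 : mu ^+ 3 = - (vol * d).
  have := @B00_model mu (val3 (fr3 phi E)) f0.
  rewrite -[(0 : nat) in X in X = _ -> _]/(nat_of_ord (ord0 : 'I_7)) (wedge_frame E phi12 phi23) -dE.
  rewrite (_ : \sum_a \sum_b _ = - 6 * vol).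
    by move=> H; lra.
  transitivity (- 6 * vol * gg (E 0) (E 0)); last by rewrite unit mulr1.
  rewrite mulr_sumr; apply: eq_bigr => a _; rewrite mulr_sumr; apply: eq_bigr => b _.
  by rewrite compat; ring.
have mu1 : mu = 1.
  have : mu ^+ 6 = 1 by rewrite (exprM mu 3 2) mu3 sqrrN s2.
  by move=> /eqP; rewrite pexpr_eq1 // ?ltW // => /eqP.
have vd : vol * d = -1 by move: mu3; rewrite mu1 expr1n => H; lra.
exists E; split; last by rewrite -dE.
split.
- exact: frame_inv oE.
- exact: frame_dual oE.
- move=> i j; rewrite -gg_fr2 oE /del.
  by rewrite (_ : eqn i j = (i == j)) //; case: (i == j).
- by move=> i j k; have := f0 i j k (ltn_ord i) (ltn_ord j) (ltn_ord k); rewrite mu1 mul1r /f !inord_val.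
Qed.

End Adapted.

(** * Contractions of the 3-form *)

Section TensorIdentity.
Variables (R : realType) (g : 'I_7 -> 'I_7 -> R) (phi : 'I_7 -> 'I_7 -> 'I_7 -> R).
Variable E : 'I_7 -> 'I_7 -> R.
Hypothesis ad : adapted g phi E.

(** By multilinearity it is enough to evaluate on the vectors of an adapted frame,
    where contractions are sums and all components are values of [penv]. *)
Lemma tensor_identity (val : var -> R) penv env e r : wf e ->
  (forall id s, frame_env E env id s = peval val (penv id [seq nat_of_ord i | i <- s])) ->
  vanishes penv (fv e) (fun=> 0%N) e -> den g env r e = 0.
Proof.
move=> we H van; have [gE [C CE] _ _] := ad.
rewrite (den_vden _ _ _ gE) //.
apply: (@vden_multilinear0 _ E env e E C we CE) => s.
pose s' n := if n \in fv e then s n else ord0.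
rewrite (@vden_eq _ _ _ _ (fun n => E (s' n))) //; last first.
  by move=> n ne; rewrite /s' ne.
rewrite vden_frame; apply: (vanishesP (val := val)) H van _ => n ne.
by rewrite /s' (negbTE ne).
Qed.

End TensorIdentity.

Definition hodge_texp i j k l := Ctr 4 5 (Ctr 6 7 (Ctr 8 9
   (Mul (At 1 [:: 4; 6; 8]) (At 2 [:: 5; 7; 9; i; j; k; l])))).
Definition phiphi_texp i j a b := Ctr 4 5 (Mul (At 1 [:: i; j; 4]) (At 1 [:: a; b; 5])).
Definition gg_texp i j a b := Add (Mul (At 0 [:: i; a]) (At 0 [:: j; b])) (Opp (Mul (At 0 [:: i; b]) (At 0 [:: j; a]))).

(** The identifier 2 stands for the volume form.  In an adapted frame its components
    are those of the Levi-Civita symbol with the opposite sign, because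
    [vol * det E = -1]. *)
Definition hodge_penv (id : nat) (s : seq nat) : spoly :=
  match id, s with
  | 0, [:: i; j] => pconst (del i j)
  | 1, [:: i; j; k] => pconst (phi0 i j k)
  | 2, [:: _; _; _; _; _; _; _] => pconst (BinInt.Z.opp (lev idx7 s))
  | _, _ => [::]
  end%N.

Definition ff_texp := Add (hodge_texp 0 1 2 3) (Mul (Cst six) (Add (phiphi_texp 0 1 2 3) (Opp (gg_texp 0 1 2 3)))).

Lemma ff_check : vanishes hodge_penv (fv ff_texp) (fun=> 0%N) ff_texp.
Proof. vm_cast_no_check (erefl true). Qed.

Section Contraction.
Variable R : realType.
Variables (g : 'I_7 -> 'I_7 -> R) (phi : 'I_7 -> 'I_7 -> 'I_7 -> R) (vol : R).
Variable E : 'I_7 -> 'I_7 -> R.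
Hypothesis ad : adapted g phi E.
Hypothesis volE : vol * \det (\matrix_(a, i) E a i) = -1.

Definition hodge_env (id : nat) : seq 'I_7 -> R :=
  match id with
  | 0%N => ten_seq2 g | 1%N => ten_seq3 phi | 2%N => fun s => vol * leviS R s
  | _ => fun=> 0
  end.

Lemma ext_scale c (A : seq 'I_7 -> R) vs : ext (fun s => c * A s) vs = c * ext A vs.
Proof.
elim: vs A => //= v vs IH A; rewrite mulr_sumr; apply: eq_bigr => i _.
by rewrite IH mulrCA.
Qed.

(** The contraction identity of G2-geometry, which eliminates the Hodge star. *)
Lemma ctr_phi_phi i j a b :
  ctr g (fun m m' => phi i j m * phi a b m') =
  g i a * g j b - g i b * g j a - hodge3 g vol phi i j a b.
Proof.
pose r n := nth ord0 [:: i; j; a; b] n.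
suff : den g hodge_env r ff_texp = 0.
  rewrite /ff_texp [den _ _ _ _]/= /r /= zr_six => H.
  rewrite /hodge3; move: H; set c := ctr _ _; set h := ctr _ _.
  move=> H; rewrite -[h](mulKf (x := 6)) ?pnatr_eq0 //.
  lra.
have [gE CE gd pd] := ad.
apply: (tensor_identity ad (val := fun=> 0) (penv := hodge_penv) _ _ _ ff_check) => //.
move=> id s; rewrite /frame_env; case: id => [|[|[|id]]].
- rewrite /= frame_ten2; case: s => [|x [|y [|? ?]]] //=; rewrite ?peval_nil //.
  by rewrite peval_const gd.
- rewrite /= frame_ten3; case: s => [|x [|y [|z [|? ?]]]] //=; rewrite ?peval_nil //.
  by rewrite peval_const pd.
- have [s7|s7] := eqVneq (size s) 7%N; last first.
    have -> : hodge_penv 2 [seq nat_of_ord i | i <- s] = [::].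
      by move: s7; case: s => [|? [|? [|? [|? [|? [|? [|? [|? ?]]]]]]]].
    rewrite peval_nil ext0 //.
    move=> t; rewrite size_map => ts; rewrite -ts in s7.
    rewrite [LHS]/= (_ : leviS R t = 0) ?mulr0 //.
    by move: s7; case: t {ts} => [|? [|? [|? [|? [|? [|? [|? [|? ?]]]]]]]].
  rewrite [LHS]ext_scale ext_levi // leviSE // mulrCA volE mulrN1.
  have -> : hodge_penv 2 [seq nat_of_ord i | i <- s] =
      pconst (BinInt.Z.opp (lev idx7 [seq nat_of_ord i | i <- s])).
    by case: s s7 => [|? [|? [|? [|? [|? [|? [|? [|? ?]]]]]]]].
  by rewrite peval_const /zr -mulrNz; congr (_%:~R); lia.
- rewrite ext0 //; by case: s => [|? [|? [|? ?]]]; rewrite peval_nil.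
Qed.

End Contraction.

(** * Functions of class C^k *)

Section ClassC.
Variables (R : realType) (W : normedModType R) (U : set W).
Hypothesis Uo : open U.
Implicit Types f g : W -> R^o.

Lemma classC_cont k f x : class_C k U f -> U x -> {for x, continuous f}.
Proof. by case: k => [|k] [H _]; apply: H. Qed.

Lemma classC_derivable k f x v : class_C k.+1 U f -> U x -> derivable f x v.
Proof. by move=> [_ /(_ v)[H _]]; apply: H. Qed.

Lemma classC_D k f v : class_C k.+1 U f -> class_C k U ('D_v f).
Proof. by move=> [_ /(_ v)[_ H]]. Qed.

Lemma classC_pred k f : class_C k.+1 U f -> class_C k U f.
Proof.
elim: k f => [|k IH] f [cf df]; first by split.
split => // v; split; first by have [] := df v.
by apply: IH; have [] := df v.
Qed.

Lemma near_U x (P : W -> Prop) : (forall y, U y -> P y) -> U x -> \forall y \near x, P y.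
Proof.
move=> UP Ux; have : nbhs x U by exact: open_nbhs_nbhs.
by apply: filterS => y; apply: UP.
Qed.

Lemma classC_ext k f g : (forall x, U x -> f x = g x) -> class_C k U f -> class_C k U g.
Proof.
elim: k f g => [|k IH] f g fg [cf df].
  split=> // x Ux; have /near_U/(_ Ux) nfg := fg.
  rewrite /prop_for /continuous_at -fg //.
  exact: cvg_trans (near_eq_cvg nfg) (cf _ Ux).
split.
  move=> x Ux; have /near_U/(_ Ux) nfg := fg.
  rewrite /prop_for /continuous_at -fg //.
  exact: cvg_trans (near_eq_cvg nfg) (cf _ Ux).
move=> v; have [dfv cDf] := df v; split.
  by move=> x Ux; apply: near_eq_derivable (dfv _ Ux); exact: near_U.
apply: IH cDf => x Ux; apply: near_eq_derive; exact: near_U.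
Qed.

Lemma classC_cst k (c : R) : class_C k U (fun=> c : R^o).
Proof.
elim: k c => [|k IH] c; split => //; try by move=> x _; apply: cvg_cst.
move=> v; split; first by move=> x _; exact: derivable_cst.
apply: classC_ext (IH 0) => x _; by rewrite derive_cst.
Qed.

Lemma classC_add k f g : class_C k U f -> class_C k U g ->
  class_C k U (fun x => f x + g x : R^o).
Proof.
elim: k f g => [|k IH] f g [cf df] [cg dg].
  by split => // x Ux; apply: cvgD; [exact: cf|exact: cg].
split; first by move=> x Ux; apply: cvgD; [exact: cf|exact: cg].
move=> v; have [dfv Df] := df v; have [dgv Dg] := dg v; split.
  by move=> x Ux; apply: derivableD; [exact: dfv|exact: dgv].
by apply: classC_ext (IH _ _ Df Dg) => x Ux; rewrite deriveD //; [exact: dfv|exact: dgv].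
Qed.

Lemma classC_mul k f g : class_C k U f -> class_C k U g ->
  class_C k U (fun x => f x * g x : R^o).
Proof.
elim: k f g => [|k IH] f g Cf Cg.
  have [cf _] := Cf; have [cg _] := Cg.
  by split => // x Ux; apply: cvgM; [exact: cf|exact: cg].
have [cf df] := Cf; have [cg dg] := Cg.
split; first by move=> x Ux; apply: cvgM; [exact: cf|exact: cg].
move=> v; have [dfv Df] := df v; have [dgv Dg] := dg v; split.
  by move=> x Ux; apply: derivableM; [exact: dfv|exact: dgv].
apply: classC_ext (classC_add (IH _ _ (classC_pred Cf) Dg) (IH _ _ (classC_pred Cg) Df)) => x Ux.
by rewrite (deriveM (dfv _ Ux) (dgv _ Ux)).
Qed.

Lemma classC_opp k f : class_C k U f -> class_C k U (fun x => - f x : R^o).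
Proof.
move=> Cf; apply: classC_ext (classC_mul (classC_cst k (-1)) Cf) => x _.
by rewrite mulN1r.
Qed.

Lemma classC_inv k f : (forall x, U x -> f x != 0) -> class_C k U f ->
  class_C k U (fun x => (f x)^-1 : R^o).
Proof.
move=> f0; elim: k => [|k IH] Cf.
  by split => // x Ux; apply: cvgV; [exact: f0|exact: (classC_cont Cf)].
split; first by move=> x Ux; apply: cvgV; [exact: f0|exact: (classC_cont Cf)].
move=> v; have [dfv Df] := Cf.2 v; split.
  by move=> x Ux; apply: derivableV; [exact: f0|exact: dfv].
have Ci := IH (classC_pred Cf).
apply: classC_ext (classC_opp (classC_mul (classC_mul Ci Ci) Df)) => x Ux.
rewrite deriveV ?f0 //; last exact: dfv.
by rewrite /GRing.scale /= expr2 invfM mulNr.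
Qed.

Lemma classC_sum k (I : Type) (r : seq I) (P : pred I) (F : I -> W -> R^o) :
  (forall i, P i -> class_C k U (F i)) -> class_C k U (fun x => \sum_(i <- r | P i) F i x : R^o).
Proof.
move=> H; elim: r => [|i r IH].
  by apply: classC_ext (classC_cst k 0) => x _; rewrite big_nil.
case E : (P i).
  by apply: classC_ext (classC_add (H i E) IH) => x _; rewrite big_cons E.
by apply: classC_ext IH => x _; rewrite big_cons E.
Qed.

Lemma classC_prod k (I : Type) (r : seq I) (P : pred I) (F : I -> W -> R^o) :
  (forall i, P i -> class_C k U (F i)) -> class_C k U (fun x => \prod_(i <- r | P i) F i x : R^o).
Proof.
move=> H; elim: r => [|i r IH].
  by apply: classC_ext (classC_cst k 1) => x _; rewrite big_nil.
case E : (P i).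
  by apply: classC_ext (classC_mul (H i E) IH) => x _; rewrite big_cons E.
by apply: classC_ext IH => x _; rewrite big_cons E.
Qed.

Lemma classC_det k n (F : 'I_n -> 'I_n -> W -> R^o) :
  (forall i j, class_C k U (F i j)) ->
  class_C k U (fun x => \det (\matrix_(i, j) F i j x) : R^o).
Proof.
move=> H; apply: classC_ext (_ : class_C k U (fun x => \sum_(s : 'S_n) (-1) ^+ s * \prod_i F i (s i) x : R^o)).
  by move=> x _; apply: eq_bigr => s _; congr (_ * _); apply: eq_bigr => i _; rewrite mxE.
apply: classC_sum => s _; apply: classC_mul; first exact: classC_cst.
exact: classC_prod.
Qed.

Lemma odd_exp_mono n (a b : R) : a < b -> a ^+ n.*2.+1 < b ^+ n.*2.+1.
Proof.
move=> ab; have oddN (x : R) : (- x) ^+ n.*2.+1 = - x ^+ n.*2.+1.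
  by rewrite exprNn -signr_odd /= odd_double expr1 mulN1r.
have [a0|a0] := lerP 0 a; first by rewrite ltrXn2r.
have [b0|b0] := lerP 0 b; last first.
  by rewrite -ltrN2 -!oddN ltrXn2r // ?ltrN2 // oppr_ge0 ltW.
apply: lt_le_trans (exprn_ge0 _ b0).
by rewrite -oppr_gt0 -oddN exprn_gt0 // oppr_gt0.
Qed.

(** Odd powers are strictly increasing, so that bounds on [D] bound its root. *)
Lemma root_cont n f (D : W -> R^o) x : (forall y, U y -> f y ^+ n.*2.+1 = D y) ->
  U x -> {for x, continuous D} -> {for x, continuous f}.
Proof.
move=> fD Ux cD; apply/cvgrPdist_lt => e e0.
have mono (a b : R) : a ^+ n.*2.+1 < b ^+ n.*2.+1 -> a < b.
  move=> H; rewrite ltNge le_eqVlt; apply/negP => /orP[/eqP ab|/(odd_exp_mono n)].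
    by move: H; rewrite ab ltxx.
  by move=> /(lt_trans H); rewrite ltxx.
have D1 : (f x - e) ^+ n.*2.+1 < D x.
  by rewrite -fD //; apply: odd_exp_mono; rewrite ltrBlDr ltrDl.
have D2 : D x < (f x + e) ^+ n.*2.+1.
  by rewrite -fD //; apply: odd_exp_mono; rewrite ltrDl.
have n1 := cvgr_gt _ cD _ D1; have n2 := cvgr_lt _ cD _ D2.
near=> y; have Uy : U y by near: y; exact: open_nbhs_nbhs.
have : (f x - e) ^+ n.*2.+1 < D y by near: y; exact: n1.
have : D y < (f x + e) ^+ n.*2.+1 by near: y; exact: n2.
rewrite -fD // => /mono l1 /mono l2.
by rewrite ltr_norml; apply/andP; split; lra.
Unshelve. all: by end_near. Qed.

Lemma classC_exp k n f : class_C k U f -> class_C k U (fun x => f x ^+ n : R^o).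
Proof.
move=> Cf; elim: n => [|n IH].
  by apply: classC_ext (classC_cst k 1) => x _; rewrite expr0.
by apply: classC_ext (classC_mul Cf IH) => x _; rewrite exprS.
Qed.

Lemma cvg_line (x v : W) : (fun h : R => h *: v + x) @ 0^' --> x.
Proof.
have : {for (0 : R), continuous (fun h : R => h *: v + x)}.
  by apply: cvgD; [exact: scalel_continuous|exact: cvg_cst].
by move=> /continuous_withinNx; rewrite scale0r add0r.
Qed.

(** The difference quotients of an odd root [f] of [D] are those of [D] divided
    by [S], where [f y ^+ N - f x ^+ N = (f y - f x) * S y]. *)
Lemma root_derive n f (D : W -> R^o) x v : (forall y, U y -> f y ^+ n.*2.+1 = D y) ->
  (forall y, U y -> f y != 0) -> class_C 0 U D -> U x -> derivable D x v ->
  is_derive x v f ((n.*2.+1%:R * f x ^+ n.*2)^-1 * 'D_v D x).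
Proof.
move=> fD f0 CD Ux dD.
set N := n.*2.+1.
have Cf : class_C 0 U f.
  by split => // y Uy; exact: (root_cont fD Uy (classC_cont CD Uy)).
pose S (y : W) : R^o := \sum_(i < N) f y ^+ (N.-1 - i) * f x ^+ i.
have S0 : S x = N%:R * f x ^+ n.*2.
  transitivity (\sum_(i < N) f x ^+ n.*2).
    by apply: eq_bigr => i _; rewrite -exprD subnK // -ltnS ltn_ord.
  by rewrite sumr_const card_ord mulr_natl.
have Sx0 : S x != 0 by rewrite S0 mulf_neq0 ?pnatr_eq0 // expf_neq0 // f0.
have CS : class_C 0 U S.
  apply: classC_sum => i _; apply: classC_mul; last exact: classC_cst.
  exact: classC_exp.
have cS : (S \o (fun h : R => h *: v + x)) @ 0^' --> S x.
  apply: cvg_comp; [exact: cvg_line|exact: (classC_cont CS Ux)].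
have key : (fun h => h^-1 *: ((f \o shift x) (h *: v) - f x)) @ 0^' -->
    ((N%:R * f x ^+ n.*2)^-1 * 'D_v D x : R^o).
  rewrite -S0.
  have c1 : (fun h : R => (S (h *: v + x))^-1) @ 0^' --> (S x)^-1 by exact: cvgV cS.
  have c2 := @cvgM _ _ _ (Proper_dnbhs_numFieldType (0 : R)) _ _ _ _ c1 dD.
  have nU : \forall h \near (0 : R)^', U (h *: v + x).
    exact: (@cvg_line x v U (open_nbhs_nbhs (conj Uo Ux))).
  have nS : \forall h \near (0 : R)^', S (h *: v + x) != 0.
    by apply: (cS [set y | y != 0]); exact: (open_nbhs_nbhs (conj (open_neq (y := 0)) Sx0)).
  refine (cvg_trans (near_eq_cvg _) c2); near=> h; rewrite /=.
  have Uh : U (h *: v + x) by near: h.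
  have Sh : S (h *: v + x) != 0 by near: h.
  rewrite -!fD // subrXX -/N -/(S _) /GRing.scale /=.
  by rewrite mulrCA; congr (_ * _); rewrite mulrCA mulVf // mulr1.
apply: DeriveDef; last exact: cvg_lim key.
by apply/cvg_ex; eexists; exact: key.
Unshelve. all: by end_near. Qed.

(** By induction on the order, the derivative of the root being
    [D' / (N f^(N-1))]. *)
Lemma classC_root k n f (D : W -> R^o) : (forall y, U y -> f y ^+ n.*2.+1 = D y) ->
  (forall y, U y -> f y != 0) -> class_C k U D -> class_C k U f.
Proof.
move=> fD f0; elim: k => [|k IH] CD.
  by split => // y Uy; exact: (root_cont fD Uy (classC_cont CD Uy)).
have Cf := IH (classC_pred CD).
have CD0 : class_C 0 U D by split => // y Uy; exact: (classC_cont CD).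
have der x v : U x -> is_derive x v f ((n.*2.+1%:R * f x ^+ n.*2)^-1 * 'D_v D x).
  by move=> Ux; apply: root_derive => //; exact: (classC_derivable CD Ux).
split; first by move=> x Ux; exact: (classC_cont Cf).
move=> v; split; first by move=> x Ux; case: (der x v Ux).
apply: classC_ext (_ : class_C k U (fun x => (n.*2.+1%:R * f x ^+ n.*2)^-1 * 'D_v D x : R^o)).
  by move=> x Ux; case: (der x v Ux) => _ ->.
apply: classC_mul; last exact: classC_D.
apply: classC_inv; first by move=> x Ux; rewrite mulf_neq0 ?pnatr_eq0 // expf_neq0 // f0.
by apply: classC_mul; [exact: classC_cst|exact: classC_exp].
Qed.

(** * Symmetry of second derivatives *)

Lemma is_derive_line f x0 v s d : is_derive (x0 + s *: v) v f d ->
  is_derive (s : R) 1 (fun s => f (x0 + s *: v)) d.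
Proof.
have E : (fun h : R => h^-1 *: ((f \o shift (x0 + s *: v)) (h *: v) - f (x0 + s *: v))) =
    (fun h : R => h^-1 *: (((fun s => f (x0 + s *: v)) \o shift s) (h *: 1) - f (x0 + s *: v))).
  apply/funext => h; congr (_ *: (f _ - _)) => /=.
  by rewrite [h%:A]mulr1 scalerDl addrCA addrA.
by case; rewrite /derivable /derive E => H1 H2; apply: DeriveDef.
Qed.

Lemma MVT_closed (k dk : R -> R) (h : R) : 0 < h ->
  (forall s : R, 0 <= s <= h -> is_derive s 1 k (dk s)) ->
  exists2 c, 0 <= c <= h & k h - k 0 = dk c * h.
Proof.
move=> h0 Hk.
have Hi (s : R) : s \in `[0, h] -> is_derive s 1 k (dk s).
  by rewrite in_itv /= => /Hk.
have cont : {within `[0, h], continuous k}.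
  by apply: derivable_within_continuous => s /Hi [].
have Ho (s : R) : s \in `]0, h[ -> is_derive s 1 k (dk s).
  by move=> sI; apply: Hi; move: sI; rewrite !in_itv /= => /andP[/ltW -> /ltW ->].
have [c cI E] := MVT h0 Ho cont.
by exists c; [move: cI; rewrite in_itv /= => /andP[/ltW -> /ltW ->]|rewrite E subr0].
Qed.

(** Two applications of the mean value theorem bring the second difference to
    an iterated derivative at a nearby point. *)
Lemma second_difference f x v w (e : R) : class_C 2 U f -> U x -> 0 < e ->
  exists2 r : R, 0 < r & forall h : R, 0 < h < r ->
  `|(f (x + h *: v + h *: w) - f (x + h *: v) - f (x + h *: w) + f x) / (h * h)
     - 'D_w ('D_v f) x| < e.
Proof.
move=> Cf Ux e0.
have CDv := classC_D v Cf; have CDwv := classC_D w CDv.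
have nP : \forall y \near x, U y /\ `|'D_w ('D_v f) x - 'D_w ('D_v f) y| < e.
  near=> y; split; first by near: y; exact: open_nbhs_nbhs.
  by near: y; move/cvgrPdist_lt: (classC_cont CDwv Ux); apply.
move/nbhs_normP: nP => [d /= d0 Hd].
pose m := `|v| + `|w| + 1; have m0 : 0 < m by rewrite ltr_wpDl // addr_ge0.
exists (d / m); first by rewrite divr_gt0.
move=> h /andP[h0 hd].
have pt s t : 0 <= s <= h -> 0 <= t <= h ->
    U (x + s *: v + t *: w) /\
    `|'D_w ('D_v f) x - 'D_w ('D_v f) (x + s *: v + t *: w)| < e.
  move=> /andP[s0 sh] /andP[t0 th]; apply: Hd => /=.
  rewrite -addrA opprD addrA subrr sub0r normrN.
  apply: le_lt_trans (ler_normD _ _) _; rewrite !normrZ !ger0_norm //.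
  apply: (@le_lt_trans _ _ (h * m)); last by rewrite -ltr_pdivlMr.
  rewrite /m !mulrDr mulr1; apply: le_trans (_ : h * `|v| + h * `|w| <= _).
    by apply: lerD; apply: ler_wpM2r.
  by rewrite lerDl ltW.
have hh : 0 <= h <= h by rewrite ltW // lexx.
have h00 : 0 <= (0 : R) <= h by rewrite lexx ltW.
have [c ch Ec] : exists2 c, 0 <= c <= h &
    (f (x + h *: w + h *: v) - f (x + h *: v)) - (f (x + h *: w + 0 *: v) - f (x + 0 *: v)) =
    ('D_v f (x + h *: w + c *: v) - 'D_v f (x + c *: v)) * h.
  apply: (MVT_closed (k := fun s => f (x + h *: w + s *: v) - f (x + s *: v))
    (dk := fun s => 'D_v f (x + h *: w + s *: v) - 'D_v f (x + s *: v)) h0) => s sh.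
  apply: is_deriveB; apply: is_derive_line; apply: derivableP; apply: (classC_derivable Cf).
    by have [] := pt _ _ sh hh; rewrite addrAC.
  by have [] := pt _ _ sh h00; rewrite scale0r addr0.
have [t th Et] : exists2 t, 0 <= t <= h &
    'D_v f (x + c *: v + h *: w) - 'D_v f (x + c *: v + 0 *: w) =
    'D_w ('D_v f) (x + c *: v + t *: w) * h.
  apply: (MVT_closed (k := fun t => 'D_v f (x + c *: v + t *: w))
    (dk := fun t => 'D_w ('D_v f) (x + c *: v + t *: w)) h0) => s sh.
  apply: (@is_derive_line ('D_v f) (x + c *: v) w); apply: derivableP; apply: (classC_derivable CDv).
  by have [] := pt _ _ ch sh.
rewrite !scale0r !addr0 in Ec Et.
have -> : f (x + h *: v + h *: w) - f (x + h *: v) - f (x + h *: w) + f x =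
    'D_w ('D_v f) (x + c *: v + t *: w) * (h * h).
  rewrite mulrA -Et [x + c *: v + _]addrAC -Ec [x + h *: w + _]addrAC; ring.
rewrite mulfK; last by rewrite mulf_neq0 // gt_eqF.
by rewrite distrC; have [] := pt _ _ ch th.
Unshelve. all: by end_near. Qed.

(** The second difference is symmetric in the two directions. *)
Lemma schwarz f x v w : class_C 2 U f -> U x ->
  'D_v ('D_w f) x = 'D_w ('D_v f) x.
Proof.
move=> Cf Ux; apply/eqP; rewrite -subr_eq0 -normr_le0; apply/ler_addgt0Pl => e e0.
have e2 : 0 < e / 2 by rewrite divr_gt0.
have [r1 r10 H1] := second_difference v w Cf Ux e2.
have [r2 r20 H2] := second_difference w v Cf Ux e2.
pose h := Num.min r1 r2 / 2.
have h0 : 0 < h by rewrite divr_gt0 // lt_min r10.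
have hm : h < Num.min r1 r2 by rewrite ltr_pdivrMr // ltr_pMr ?lt_min ?r10 // ltr1n.
have [hr1 hr2] : h < r1 /\ h < r2 by move: hm; rewrite lt_min => /andP[].
have := H1 h; rewrite h0 hr1 => /(_ isT).
have := H2 h; rewrite h0 hr2 => /(_ isT).
rewrite (_ : x + h *: w + h *: v = x + h *: v + h *: w); last by rewrite addrAC.
rewrite (_ : _ - f (x + h *: w) - f (x + h *: v) + f x =
   f (x + h *: v + h *: w) - f (x + h *: v) - f (x + h *: w) + f x); last by ring.
move: ('D_v _ x) ('D_w _ x) (_ / (h * h)) => A B q; rewrite addr0.
rewrite !ltr_norml => /andP[l1 l2] /andP[l3 l4].
by rewrite ler_norml; apply/andP; split; lra.
Qed.

End ClassC.

(** * Connection matrices and curvature *)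

Section MetricInverse.
Variables (R : realType) (V : normedModType R) (z w : V).
Notation ten2 := ('I_7 -> 'I_7 -> R).
Variables (g : V -> ten2) (Gam : ten2).
Let gM y : 'M[R]_7 := \matrix_(a, b) g y a b.
Hypothesis gunit : \forall y \near z, gM y \in unitmx.
Hypothesis dg : forall i j, dder z w (fun y => g y i j)
  (\sum_m (Gam m i * g z m j + Gam m j * g z i m)).
Hypothesis dG : forall p q, derivable (fun y => metric_inv (g y) p q : R^o) z w.

(** Differentiate [g^-1 g = 1]. *)
Lemma metric_inv_der p q : dder z w (fun y => metric_inv (g y) p q)
  (- \sum_m (Gam p m * metric_inv (g z) m q + Gam q m * metric_inv (g z) p m)).
Proof.
pose D : 'M[R]_7 := \matrix_(p, q) 'D_w (fun y => metric_inv (g y) p q : R^o) z.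
have HD p' q' : dder z w (fun y => metric_inv (g y) p' q') (D p' q').
  by rewrite mxE; apply: derivableP.
pose Gm : 'M[R]_7 := \matrix_(m, i) Gam m i.
pose iM : 'M[R]_7 := invmx (gM z).
pose dM : 'M[R]_7 := Gm^T *m gM z + gM z *m Gm.
have zu : gM z \in unitmx by exact: nbhs_singleton gunit.
have dME i j : dM i j = \sum_m (Gam m i * g z m j + Gam m j * g z i m).
  rewrite !mxE -big_split; apply: eq_bigr => m _; rewrite !mxE.
  by rewrite [g z i m * _]mulrC.
have eq0 : D *m gM z + iM *m dM = 0.
  apply/matrixP => i j; rewrite [LHS]mxE [X in X + _]mxE [X in _ + X]mxE [RHS]mxE.
  have H : dder z w (fun y => \sum_q metric_inv (g y) i q * g y q j)
      (\sum_q (D i q * g z q j + metric_inv (g z) i q * dM q j)).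
    by apply: dder_sum_ord => k; apply: dderM; [exact: HD|rewrite dME; exact: dg].
  have H0 : dder z w (fun y => \sum_q metric_inv (g y) i q * g y q j) 0.
    apply: near_eq_is_derive (dder_cst z w (i == j)%:R).
    near=> y; have yu : gM y \in unitmx by near: y.
    have := congr1 (fun M : 'M[R]_7 => M i j) (mulVmx yu); rewrite !mxE => <-.
    by apply: eq_bigr => k _; rewrite /metric_inv mxE.
  transitivity ('D_w (fun y => \sum_q metric_inv (g y) i q * g y q j : R^o) z).
    rewrite (dder_val H) big_split; congr (_ + _).
    by apply: eq_bigr => k _; rewrite [gM z _ _]mxE.
  exact: (dder_val H0).
have DE : D = - (Gm *m iM + iM *m Gm^T).
  have : D *m gM z *m iM = - (iM *m dM) *m iM.
    by congr (_ *m _); apply/eqP; rewrite -addr_eq0 eq0.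
  rewrite -mulmxA mulmxV // mulmx1 => ->.
  rewrite mulNmx mulmxDr mulmxDl addrC; congr (- (_ + _)).
    by rewrite mulmxA mulVmx // mul1mx.
  by rewrite -!mulmxA mulmxV // mulmx1.
apply: (dder_eq (HD p q)); rewrite DE !mxE; congr (- _).
rewrite -big_split; apply: eq_bigr => m _; rewrite !mxE.
congr (_ + _); rewrite mulrC //.
Unshelve. all: by end_near. Qed.

End MetricInverse.

Section ActCommutator.
Variable R : realType.
Notation ten2 := ('I_7 -> 'I_7 -> R).
Implicit Types (P Q : ten2) (A B : seq 'I_7 -> R).

Lemma act_eq P Q A B s : (forall m i, P m i = Q m i) ->
  (forall t, size t = size s -> A t = B t) -> act P A s = act Q B s.
Proof.
move=> PQ; elim: s A B => [|i s IH] A B AB //=; congr (_ + _).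
  by apply: eq_bigr => m _; rewrite PQ AB.
by apply: IH => t ts; apply: AB; rewrite /= ts.
Qed.

Lemma act_lin P s (c : 'I_7 -> R) (A : 'I_7 -> seq 'I_7 -> R) :
  act P (fun t => \sum_i c i * A i t) s = \sum_i c i * act P (A i) s.
Proof.
elim: s A => [|i s IH] A /=; first by rewrite big1 // => i _; rewrite mulr0.
rewrite IH; under [RHS]eq_bigr do rewrite mulrDr.
rewrite [RHS]big_split /=; congr (_ + _).
under eq_bigr do rewrite mulr_sumr.
rewrite exchange_big; apply: eq_bigr => j _ /=; rewrite mulr_sumr.
by apply: eq_bigr => m _; rewrite mulrCA.
Qed.

Lemma actD P s A B : act P (fun t => A t + B t) s = act P A s + act P B s.
Proof.
elim: s A B => [|i s IH] A B /=; first by rewrite addr0.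
rewrite IH addrACA; congr (_ + _); rewrite -big_split.
by apply: eq_bigr => m _ /=; rewrite mulrDr.
Qed.

Lemma actN P s A : act P (fun t => - A t) s = - act P A s.
Proof.
elim: s A => [|i s IH] A /=; first by rewrite oppr0.
by rewrite IH opprD -sumrN; congr (_ + _); apply: eq_bigr => m _; rewrite mulrN.
Qed.

Lemma act_addl P Q s A : act (fun m i => P m i + Q m i) A s = act P A s + act Q A s.
Proof.
elim: s A => [|i s IH] A /=; first by rewrite addr0.
rewrite IH addrACA; congr (_ + _); rewrite -big_split.
by apply: eq_bigr => m _ /=; rewrite mulrDl.
Qed.

Lemma act_oppl P s A : act (fun m i => - P m i) A s = - act P A s.
Proof.
elim: s A => [|i s IH] A /=; first by rewrite oppr0.
by rewrite IH opprD -sumrN; congr (_ + _); apply: eq_bigr => m _; rewrite mulNr.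
Qed.

Lemma act_comm P Q A s :
  act P (act Q A) s - act Q (act P A) s =
  act (fun n i => \sum_m (Q n m * P m i - P n m * Q m i)) A s.
Proof.
elim: s A => [|i s IH] A; first by rewrite /= subrr.
have H P' Q' : act P' (act Q' A) (i :: s) =
    \sum_n (\sum_m Q' n m * P' m i) * A (n :: s) +
    (\sum_m P' m i * act Q' (fun t => A (m :: t)) s +
     \sum_n Q' n i * act P' (fun t => A (n :: t)) s) +
    act P' (act Q' (fun t => A (i :: t))) s.
  rewrite [LHS]/= actD act_lin !addrA; congr (_ + _ + _).
  under eq_bigr do rewrite mulrDr mulr_sumr.
  rewrite big_split /=; congr (_ + _).
  rewrite exchange_big; apply: eq_bigr => n _ /=; rewrite mulr_suml.
  by apply: eq_bigr => m _; rewrite mulrA [Q' _ _ * _]mulrC.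
rewrite !H [act (fun n i => _) A (i :: s)]/= -IH.
under [X in _ = X + _]eq_bigr do rewrite sumrB mulrBl.
rewrite sumrB; ring.
Qed.

End ActCommutator.

(** The commutator of two covariant derivatives of a field of tensors acts by
    the curvature of the connection. *)
Section RicciIdentity.
Variables (R : realType) (V : normedModType R) (z va vp : V).
Notation ten2 := ('I_7 -> 'I_7 -> R).
Variables (Ga Gp : V -> ten2) (dGa dGp : ten2).
Variables (A Aa Ap : V -> seq 'I_7 -> R).
Variables (Aap : seq 'I_7 -> R).
Hypothesis HGa : forall m i, dder z vp (fun y => Ga y m i) (dGa m i).
Hypothesis HGp : forall m i, dder z va (fun y => Gp y m i) (dGp m i).
Hypothesis HAa : forall s, dder z va (fun y => A y s) (Aa z s).
Hypothesis HAp : forall s, dder z vp (fun y => A y s) (Ap z s).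
Hypothesis HAap : forall s, dder z va (fun y => Ap y s) (Aap s).
Hypothesis HApa : forall s, dder z vp (fun y => Aa y s) (Aap s).

Lemma dder_act (v : V) (G : V -> ten2) (dG : ten2) (B : V -> seq 'I_7 -> R) (dB : seq 'I_7 -> R) s :
  (forall m i, dder z v (fun y => G y m i) (dG m i)) ->
  (forall t, dder z v (fun y => B y t) (dB t)) ->
  dder z v (fun y => act (G y) (B y) s) (act dG (B z) s + act (G z) dB s).
Proof.
move=> HG; elim: s B dB => [|i s IH] B dB HB /=.
  by rewrite addr0; exact: dder_cst.
apply: dder_eq.
  apply: dderD; last by apply: (IH _ (fun t => dB (i :: t))) => t; apply: HB.
  by apply: dder_sum_ord => m; apply: dderM; [exact: HG|exact: HB].
by rewrite big_split /=; ring.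
Qed.

(** The curvature, as a matrix, of the connection with matrices [Ga] and [Gp] in
    the directions [va] and [vp]; both directions may be in time or in space. *)
Definition curvature_mx : ten2 := fun m i =>
  dGp m i - dGa m i + \sum_n (Ga z m n * Gp z n i - Gp z m n * Ga z n i).

Lemma ricci_identity s :
  exists2 DaAp, dder z va (fun y => Ap y s - act (Gp y) (A y) s) (DaAp + act (Ga z) (fun t => Ap z t - act (Gp z) (A z) t) s) &
  exists2 DpAa, dder z vp (fun y => Aa y s - act (Ga y) (A y) s) (DpAa + act (Gp z) (fun t => Aa z t - act (Ga z) (A z) t) s) &
  DaAp - DpAa = - act curvature_mx (A z) s.
Proof.
have H1 := dderD (HAap s) (dderN (dder_act s HGp HAa)).
have H2 := dderD (HApa s) (dderN (dder_act s HGa HAp)).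
exists (Aap s - (act dGp (A z) s + act (Gp z) (Aa z) s) -
    act (Ga z) (fun t => Ap z t - act (Gp z) (A z) t) s).
  by apply: (dder_eq H1); ring.
exists (Aap s - (act dGa (A z) s + act (Ga z) (Ap z) s) -
    act (Gp z) (fun t => Aa z t - act (Ga z) (A z) t) s).
  by apply: (dder_eq H2); ring.
rewrite /curvature_mx act_addl (act_addl dGp (fun m i => - dGa m i)) act_oppl -act_comm.
rewrite !actD !actN; ring.
Qed.

End RicciIdentity.

(** * Joint smoothness of a family of G2-structures *)

Section Spacetime.
Variable R : realType.
Notation V := 'rV[R]_7.
(** The regular algebra in the first factor makes the pair a normed module. *)
Definition spacetime : normedModType R := (R^o * 'rV[R]_7)%type.
Notation W := spacetime.

Definition spatial (v : V) : W := (0, v).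
Definition et : W := (1, 0).

Lemma slice_space (f : W -> R^o) (t : R) (y v : V) :
  (fun h : R => h^-1 *: (((fun y => f (t, y)) \o shift y) (h *: v) - f (t, y))) =
  (fun h : R => h^-1 *: ((f \o shift ((t, y) : W)) (h *: spatial v) - f (t, y))).
Proof.
apply/funext => h; congr (_ *: (f _ - _)) => /=.
by apply/pair_equal_spec; split; rewrite /= ?scaler0 ?add0r.
Qed.

Lemma slice_time (f : W -> R^o) (t : R) (y : V) :
  (fun h : R => h^-1 *: (((fun t : R^o => f (t, y)) \o shift (t : R^o)) (h *: (1 : R^o)) - f (t, y))) =
  (fun h : R => h^-1 *: ((f \o shift ((t, y) : W)) (h *: et) - f (t, y))).
Proof.
apply/funext => h; congr (_ *: (f _ - _)) => /=.
by apply/pair_equal_spec; split; rewrite /= ?scaler0 ?add0r.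
Qed.

Lemma derive_space (f : W -> R^o) t y v :
  'D_v (fun y => f (t, y) : R^o) y = 'D_(spatial v) f (t, y).
Proof. by rewrite /derive slice_space. Qed.

Lemma derivable_space (f : W -> R^o) t y v :
  derivable f (t, y) (spatial v) -> derivable (fun y => f (t, y) : R^o) y v.
Proof. by rewrite /derivable slice_space. Qed.

Lemma derive_time (f : W -> R^o) t y :
  'D_(1 : R^o) (fun t : R^o => f (t, y) : R^o) t = 'D_et f (t, y).
Proof. by rewrite /derive slice_time. Qed.

Lemma derivable_time (f : W -> R^o) t y :
  derivable f (t, y) et -> derivable (fun t : R^o => f (t, y) : R^o) t 1.
Proof. by rewrite /derivable slice_time. Qed.

Section Family.
Variables (eps : R) (O : set V).
Hypothesis Oo : open O.
Definition domain : set W := [set z | `|z.1| < eps /\ O z.2].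
Notation U := domain.

Lemma domain_open : open U.
Proof.
have -> : U = (fst @^-1` [set t : R^o | `|t| < eps]) `&` (snd @^-1` O) by [].
apply: openI; apply: open_comp => //.
- by move=> z _; exact: cvg_fst.
- have -> : [set t : R^o | `|t| < eps] = ball (0 : R^o) eps.
    by apply/seteqP; split => t /=; rewrite /ball /= sub0r normrN.
  exact: ball_open.
- by move=> z _; exact: cvg_snd.
Qed.
Let Uo := domain_open.

Variables (F : R -> V -> 'I_7 -> 'I_7 -> 'I_7 -> R) (G : R -> V -> 'I_7 -> 'I_7 -> R) (vol : R -> V -> R).
Hypothesis Gpos : forall t y, U (t, y) -> forall v : 'I_7 -> R, (exists a, v a != 0) ->
  0 < \sum_a \sum_b G t y a b * v a * v b.
Hypothesis vol2 : forall t y, U (t, y) -> vol t y ^+ 2 = \det (\matrix_(a < 7, b < 7) G t y a b).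
Hypothesis compat : forall t y, U (t, y) -> forall a b,
  wedge223 (F t y a) (F t y b) (F t y) = - 6 * G t y a b * vol t y.
Hypothesis F_smooth : forall a b c, smooth_on U (fun z : W => F z.1 z.2 a b c : R^o).

Lemma det_G_neq0 t y : U (t, y) -> \det (\matrix_(a < 7, b < 7) G t y a b) != 0.
Proof.
move=> Uz; rewrite -unitfE -/(_ \in unitmx); apply: contraT => Gu.
have : kermx (\matrix_(a < 7, b < 7) G t y a b) != 0.
  by rewrite kermx_eq0 row_free_unit.
case/rowV0Pn => w /sub_kermxP wG w0.
have := Gpos Uz (v := fun a => w 0 a); rewrite exchange_big big1; last first.
  move=> b _; have := congr1 (fun M : 'rV[R]_7 => M 0 b * w 0 b) wG; rewrite !mxE mul0r => E.
  rewrite -[RHS]E mulr_suml; apply: eq_bigr => a _; rewrite mxE; ring.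
rewrite ltxx => H; exfalso; apply: (notF (H _)).
case/matrix0Pn: w0 => i [j wj]; exists j.
by rewrite (_ : 0 = i) // ord1.
Qed.

Lemma G_unit t y : U (t, y) -> (\matrix_(a < 7, b < 7) G t y a b : 'M[R]_7) \in unitmx.
Proof. by move=> Uz; rewrite unitmxE unitfE det_G_neq0. Qed.

Lemma vol_neq0 t y : U (t, y) -> vol t y != 0.
Proof.
move=> Uz; apply: contraNneq (det_G_neq0 Uz) => v0.
by rewrite -vol2 // v0 expr0n.
Qed.

Let B (z : W) a b : R^o := wedge223 (F z.1 z.2 a) (F z.1 z.2 b) (F z.1 z.2).

Lemma B_smooth a b : smooth_on U (fun z => B z a b).
Proof.
move=> k; apply: classC_mul => //; first exact: classC_cst.
do 7 (apply: classC_sum => // ? _).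
move: (levi_civita _ _ _ _ _ _ _ _) => c.
apply: classC_mul => //; last exact: F_smooth.
apply: classC_mul => //; last exact: F_smooth.
apply: classC_mul => //; last exact: F_smooth.
exact: classC_cst.
Qed.

(** A ninth root: the compatibility identity multiplies the determinant of the
    metric, [vol^2], by [(-6 vol)^7]. *)
Lemma vol_smooth : smooth_on U (fun z : W => vol z.1 z.2 : R^o).
Proof.
move=> k.
(* The exponent is [9 = 2 * 4 + 1]. *)
apply: (@classC_root _ _ _ Uo k 4 _ (fun z : W => (- 6 ^+ 7)^-1 * \det (\matrix_(a < 7, b < 7) B z a b) : R^o)).
- case=> t y Uz.
  have -> : \matrix_(a < 7, b < 7) B (t, y) a b = (- 6 * vol t y) *: \matrix_(a < 7, b < 7) G t y a b.
    by apply/matrixP => a b; rewrite !mxE /B compat //=; ring.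
  by rewrite detZ -vol2 //=; field; rewrite ?oppr_eq0 ?expf_neq0 ?oppr_eq0 ?pnatr_eq0.
- by case=> t y Uz; exact: vol_neq0.
- apply: (classC_mul Uo); first exact: (classC_cst Uo).
  by apply: (classC_det Uo) => a b; exact: B_smooth.
Qed.

Lemma G_smooth a b : smooth_on U (fun z : W => G z.1 z.2 a b : R^o).
Proof.
move=> k; apply: (classC_ext Uo (f := fun z => B z a b * (- 6 * vol z.1 z.2)^-1 : R^o)).
  case=> t y Uz /=; rewrite /B compat //=.
  have v0 := vol_neq0 Uz; by field.
apply: classC_mul => //; first exact: B_smooth.
apply: classC_inv => //; first by case=> t y Uz; rewrite mulf_neq0 ?vol_neq0 // oppr_eq0 pnatr_eq0.
by apply: classC_mul => //; [exact: classC_cst|exact: vol_smooth].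
Qed.

(** Cramer's rule. *)
Lemma Ginv_smooth p q : smooth_on U (fun z : W => metric_inv (G z.1 z.2) p q : R^o).
Proof.
move=> k; pose M (z : W) : 'M[R]_7 := \matrix_(a < 7, b < 7) G z.1 z.2 a b.
apply: (classC_ext Uo (f := fun z => (\det (M z))^-1 * ((-1) ^+ (q + p) * \det (row' q (col' p (M z)))) : R^o)).
  case=> t y Uz; rewrite /metric_inv /invmx G_unit // !mxE.
  by congr (_ * _).
apply: classC_mul => //.
  apply: classC_inv => //; first by case=> t y; exact: det_G_neq0.
  by apply: classC_det => // a b; exact: G_smooth.
apply: classC_mul => //; first exact: classC_cst.
apply: (classC_ext Uo (f := fun z => \det (\matrix_(i, j) G z.1 z.2 (lift q i) (lift p j)) : R^o)).
  by move=> z _; congr (\det _); apply/matrixP => i j; rewrite !mxE.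
by apply: classC_det => // i j; exact: G_smooth.
Qed.

Definition ea (a : 'I_7) : W := spatial (delta_mx ord0 a).

Lemma pd_space (f : W -> R^o) a t y : pd a (fun y => f (t, y)) y = 'D_(ea a) f (t, y).
Proof. exact: derive_space. Qed.

Lemma christoffel_smooth k i j : smooth_on U (fun z : W => christoffel (G z.1) z.2 k i j : R^o).
Proof.
move=> n.
have D a b c : class_C n U (fun z : W => pd a (fun y => G z.1 y b c) z.2 : R^o).
  apply: (classC_ext Uo (f := 'D_(ea a) (fun z : W => G z.1 z.2 b c : R^o))).
    by case=> t y _; rewrite -pd_space.
  by apply: classC_D; exact: G_smooth.
apply: classC_mul => //; first exact: classC_cst.
apply: classC_sum => // l _; apply: classC_mul => //; first exact: Ginv_smooth.
by do ?[apply: classC_add => //|apply: classC_opp => //].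
Qed.

End Family.
End Spacetime.

(** * The tensor identities of the proof *)

(** The identifiers of tensors: 0 is the metric, 1 the 3-form [phi], 2 the torsion,
   3 and 4 are [h] and [X], 5 is [nabla h], 6 the Ricci tensor, 7 the Riemann
   tensor, 8 is [psi] and 9 is [nabla phi].  Adding 10 gives the covariant
   derivative in space, adding 20 that in time, and adding 40 that in time for
   the auxiliary connection of [met_time].  The indices bound in different
   scopes have different names, chosen small because the evaluation compares
   them in unary. *)
Definition zn (n : nat) := BinInt.Z.of_nat n.
Definition Scl n e := Mul (Cst (zn n)) e.
Definition Dif a b := Add a (Opp b).
Definition gE i j := At 0 [:: i; j].
Definition fE i j k := At 1 [:: i; j; k].
Definition tE i j := At 2 [:: i; j].
Definition hE i j := At 3 [:: i; j].
Definition xE i := At 4 [:: i].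
Definition dhE a i j := At 5 [:: a; i; j].
Definition psiE i j k l := At 8 [:: i; j; k; l].

Definition torsion_texp p i j k := Ctr 19 20 (Mul (psiE 20 i j k) (tE p 19)).
Definition hook_texp i j k := Ctr 19 20 (Mul (psiE 20 i j k) (xE 19)).
(** The 4-form [- Y /\ phi]. *)
Definition wedge_texp (Y : nat -> texp) i j k l :=
  Add (Add (Mul (fE i k l) (Y j)) (Mul (fE i j k) (Y l)))
      (Opp (Add (Mul (fE j k l) (Y i)) (Mul (fE i j l) (Y k)))).
Definition psi_texp i j k l :=
  Dif (Dif (Mul (gE i k) (gE j l)) (Mul (gE i l) (gE j k)))
      (Ctr 21 22 (Mul (fE i j 21) (fE k l 22))).
Definition dspace a := der (addn 10) [:: a].
Definition dtime := der (addn 20) [::].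

(** [psi_qabc psi_labc = 24 g_ql], so this contraction of [nabla phi] is [24 T]. *)
Definition torsion24 p q := Ctr 5 6 (Ctr 7 8 (Ctr 9 10
   (Mul (psiE q 6 8 10) (At 9 [:: p; 5; 7; 9])))).

(** The curvature of the spacetime connection in a direction of time and one of
   space, with its last index lowered. *)
Definition curl_texp p i l := Dif (dhE i p l) (dhE l p i).
Definition sdot_texp p i j k :=
  Dif (Dif (dspace p (hook_texp i j k))
    (Add (Ctr 23 24 (Mul (fE 24 j k) (curl_texp p i 23)))
    (Add (Ctr 23 24 (Mul (fE i 24 k) (curl_texp p j 23)))
         (Ctr 23 24 (Mul (fE i j 24) (curl_texp p k 23))))))
  (Ctr 25 26 (Mul (hE 25 p) (At 9 [:: 26; i; j; k]))).
Definition tau_texp p q :=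
  Add (Dif (At 14 [:: p; q]) (Ctr 27 28 (Mul (hE p 27) (tE 28 q))))
   (Dif (Ctr 27 28 (Ctr 29 30 (Mul (fE 28 30 q) (dhE 27 29 p))))
     (Ctr 27 28 (Ctr 29 30 (Mul (fE 28 30 q) (Mul (tE p 27) (xE 29)))))).

Definition rE a p i j := At 7 [:: a; p; i; j].
(** The action of the curvature on [phi], and the same commutator computed from
   [nabla phi = T _| psi]. *)
Definition riem_act_texp a p i j k := Opp (Add (Ctr 33 34 (Mul (fE 34 j k) (rE a p i 33)))
   (Add (Ctr 33 34 (Mul (fE i 34 k) (rE a p j 33))) (Ctr 33 34 (Mul (fE i j 34) (rE a p k 33))))).
Definition contract_texp (comm : nat -> nat -> nat -> nat -> nat -> texp) a c :=
  Ctr 27 28 (Ctr 29 30 (Ctr 31 32 (Mul (fE c 30 32) (comm a 27 28 29 31)))).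
Definition rcyc_texp a p i m := Add (rE a p i m) (Add (rE a i m p) (rE a m p i)).
(** Contracted with [phi], the commutator is minus four times the Ricci tensor, up
    to a trace over a skew pair of indices and terms that the first Bianchi
    identity annihilates. *)
Definition riem_ricci_texp a c :=
  Dif (Add (Scl 3 (contract_texp riem_act_texp a c))
     (Add (Scl 12 (Ctr 27 28 (rE a 27 28 c))) (Scl 6 (Ctr 27 28 (rE a c 27 28)))))
   (Scl 2 (Ctr 27 28 (Ctr 29 30 (Ctr 31 32 (Mul (psiE 28 32 c 30) (rcyc_texp a 27 29 31)))))).
Definition tors_comm_texp a p i j k :=
  Dif (dspace a (torsion_texp p i j k)) (dspace p (torsion_texp a i j k)).
Definition dtE a i j := At 12 [:: a; i; j].
Definition ricci_texp a c :=
  Dif (Add (Ctr 27 28 (Ctr 29 30 (Mul (fE c 28 30) (Dif (dtE 27 a 29) (dtE a 27 29)))))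
           (Mul (tE a c) (Ctr 27 28 (tE 27 28))))
      (Add (Ctr 27 28 (Mul (tE a 27) (tE 28 c)))
           (Ctr 27 28 (Ctr 29 30 (Ctr 31 32 (Mul (psiE 28 30 32 c) (Mul (tE a 27) (tE 29 31))))))).
Definition ricci_torsion_texp := Add (contract_texp tors_comm_texp 0 1) (Scl 4 (ricci_texp 0 1)).

(** Twice the variation of the Christoffel symbols, lowered, for the variation
   [h] of the metric, hence the variation for [2 h]. *)
Definition palatini_texp j k l := Dif (Add (dhE j k l) (dhE k j l)) (dhE l j k).
Definition ricci_dot_texp j k :=
  Dif (Ctr 33 34 (dspace 33 (palatini_texp j k 34))) (Ctr 33 34 (dspace j (palatini_texp 33 k 34))).
Definition ricE i j := At 6 [:: i; j].
Definition rho_texp j k := Dif (ricci_dot_texp j k)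
  (Add (Ctr 35 36 (Mul (hE 35 j) (ricE 36 k))) (Ctr 35 36 (Mul (hE 35 k) (ricE j 36)))).

Definition trT_texp := Ctr 5 6 (tE 5 6).
(** Six times the Lagrangian; below, six times the right-hand side, three times
   the components of [A], six times [P1_hat] and three times [P2]. *)
Definition lagr_texp := Dif (Dif (Ctr 5 6 (ricE 5 6)) (Mul trT_texp trT_texp))
  (Scl 2 (Ctr 5 6 (Ctr 7 8 (Mul (tE 5 7) (tE 6 8))))).
Definition vt_texp k := Ctr 5 6 (Ctr 7 8 (Mul (tE 5 7) (fE 6 8 k))).
Definition tv_texp i j := Ctr 9 10 (Mul (tE i 9) (Ctr 11 12 (Mul (vt_texp 11) (fE 12 10 j)))).
Definition p1_texp i j :=
  Add (Dif (Dif (Opp (Scl 6 (ricE i j))) (Scl 2 (Add (dspace i (vt_texp j)) (dspace j (vt_texp i)))))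
    (Scl 2 (Add (tv_texp i j) (tv_texp j i))))
  (Scl 3 (Mul trT_texp (Add (tE i j) (tE j i)))).
Definition p2_texp k :=
  Add (Add (Scl 2 (Ctr 5 6 (dtE 5 6 k))) (dspace k trT_texp)) (Mul trT_texp (vt_texp k)).
Definition htE i j := Ctr 13 14 (Mul (hE i 13) (tE 14 j)).
Definition divergence_texp k :=
  Dif (Dif (Dif (Add (Opp (Ctr 5 6 (dhE k 5 6))) (Ctr 5 6 (dhE 5 6 k)))
    (Scl 2 (Ctr 5 6 (Ctr 7 8 (Mul (htE 5 7) (fE 6 8 k))))))
    (Scl 2 (Ctr 5 6 (Mul (tE k 5) (xE 6)))))
    (Mul trT_texp (xE k)).
Definition rhs_texp :=
  Add (Add (Ctr 15 16 (Ctr 17 18 (Mul (hE 15 17) (p1_texp 16 18))))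
     (Scl 2 (Ctr 15 16 (Mul (xE 15) (p2_texp 16)))))
   (Scl 2 (Ctr 15 16 (dspace 15 (divergence_texp 16)))).
Definition final_texp := Dif (dtime lagr_texp) rhs_texp.


Definition diamond_texp i j k :=
  Add (Ctr 19 20 (Mul (fE 20 j k) (hE i 19)))
 (Add (Ctr 19 20 (Mul (fE i 20 k) (hE j 19))) (Ctr 19 20 (Mul (fE i j 20) (hE k 19)))).
(** This vanishes, because [phi_ijk phi_ajk = 6 g_ia]. *)
Definition metric6 i a :=
  Dif (Ctr 5 6 (Ctr 7 8 (Mul (fE i 5 7) (fE a 6 8)))) (Scl 6 (gE i a)).
Definition metric6_dot i a := der (addn 40) [::] (metric6 i a).
(** With parallel metric and the derivative [h <> phi + X _| psi] of [phi], the
   derivative of [metric6] is [8 h + 4 (tr h) g]; removing its trace leaves a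
   multiple of [h]. *)
Definition metric_dot_texp :=
  Dif (Dif (Scl 9 (metric6_dot 0 1)) (Mul (gE 0 1) (Ctr 27 28 (metric6_dot 27 28))))
      (Scl 72 (hE 0 1)).
Definition psi_dot_texp := Dif (dtime (psi_texp 0 1 2 3)) (wedge_texp xE 0 1 2 3).
Definition torsion24_texp := Dif (torsion24 0 1) (Scl 24 (tE 0 1)).
Definition tau24_texp := Dif (dtime (torsion24 0 1)) (Scl 24 (At 22 [:: 0; 1])).

(** The derived fields in terms of the independent ones; the symmetric tensors
    are written as [u + u^t], so that no symmetry is left between the atoms. *)
Definition atom_texp (id k : nat) : texp :=
  match id, k with
  | 3, 2 => Add (At 33 [:: 0; 1]) (At 33 [:: 1; 0])
  | (5|13), 3 => Add (At 35 [:: 0; 1; 2]) (At 35 [:: 0; 2; 1])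
  | 15, 4 => Add (At 36 [:: 0; 1; 2; 3]) (At 36 [:: 0; 1; 3; 2])
  | (10|20|40), _ => Mul (Cst z0) (At 10 (iota 0 k))
  | (9|11), 4 => torsion_texp 0 1 2 3
  | 18, 5 => wedge_texp (tE 0) 1 2 3 4
  | 21, 3 => hook_texp 0 1 2
  | 28, 4 => wedge_texp xE 0 1 2 3
  | 29, 4 => sdot_texp 0 1 2 3
  | 22, 2 => tau_texp 0 1
  | 6, 2 => ricci_texp 0 1
  | 26, 2 => rho_texp 0 1
  | 41, 3 => Add (diamond_texp 0 1 2) (hook_texp 0 1 2)
  | _, _ => At id (iota 0 k)
  end%N.

(** Bound names are renamed too, which is harmless when [f] is injective on the
    names of the expression. *)
Fixpoint rename (f : nat -> nat) e :=
  match e with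
  | At id s => At id (map f s)
  | Cst c => Cst c
  | Opp a => Opp (rename f a)
  | Add a b => Add (rename f a) (rename f b)
  | Mul a b => Mul (rename f a) (rename f b)
  | Ctr p q a => Ctr (f p) (f q) (rename f a)
  end.

Fixpoint names e : seq nat :=
  match e with
  | At _ s => s
  | Cst _ => [::]
  | Opp a => names a
  | Add a b | Mul a b => names a ++ names b
  | Ctr p q a => [:: p, q & names a]
  end.

Definition at_args (s : seq nat) n := nth n s n.

Section Subst.
Variable D : seq nat.

Fixpoint subst e :=
  match e with
  | At id s => if id \in D then rename (at_args s) (atom_texp id (size s)) else At id s
  | Cst c => Cst c
  | Opp a => Opp (subst a)
  | Add a b => Add (subst a) (subst b)
  | Mul a b => Mul (subst a) (subst b)
  | Ctr p q a => Ctr p q (subst a)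
  end.

(** No variable is captured by [subst]. *)
Fixpoint clean e :=
  match e with
  | At id s => (id \notin D) || uniq [seq at_args s n | n <- undup (iota 0 (size s) ++ names (atom_texp id (size s)))]
  | Cst _ => true
  | Opp a => clean a
  | Add a b | Mul a b => clean a && clean b
  | Ctr _ _ a => clean a
  end.

Definition subst3 e := subst (subst (subst e)).

End Subst.

(** The metric, [phi] and [psi] have fixed components in an adapted frame; those
    of every other tensor are independent variables. *)
Definition g2_penv (id : nat) (s : seq nat) : spoly :=
  match id, s with
  | 0, [:: i; j] => pconst (del i j)
  | 1, [:: i; j; k] => pconst (phi0 i j k)
  | 8, [:: i; j; k; l] => pconst (psi0 i j k l)
  | (0|1|8), _ => [::]
  | _, _ => pvar (rcons s id)
  end%N.

Definition holds e := wf e && vanishes g2_penv (fv e) (fun=> 0%N) e.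
(** Three rounds of substitution reach the independent tensors: the variation of
    the Ricci tensor contains the Ricci tensor, which contains the torsion. *)
Definition holds_subst D e :=
  [&& clean D e, clean D (subst D e), clean D (subst D (subst D e)) & holds (subst3 D e)].

(** * Substitution, and identities in adapted frames *)

Section Substitution.
Variable R : realType.
Variables (g : 'I_7 -> 'I_7 -> R) (env : nat -> seq 'I_7 -> R).

Lemma den_rename f e r r' : {in names e &, injective f} ->
  {in names e, forall n, r (f n) = r' n} ->
  den g env r (rename f e) = den g env r' e.
Proof.
elim: e r r' => [id s|c|a IH|a IHa b IHb|a IHa b IHb|p q a IH] r r' fi rr /=.
- by rewrite -map_comp; congr env; apply/eq_in_map.
- by [].
- by rewrite (IH _ r').
- rewrite (IHa _ r') ?(IHb _ r') // => [m n|m|m n|m] H.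
  + by move=> H'; apply: fi; rewrite /= mem_cat ?H ?H' orbT.
  + by apply: rr; rewrite /= mem_cat H orbT.
  + by move=> H'; apply: fi; rewrite /= mem_cat ?H ?H'.
  + by apply: rr; rewrite /= mem_cat H.
- rewrite (IHa _ r') ?(IHb _ r') // => [m n|m|m n|m] H.
  + by move=> H'; apply: fi; rewrite /= mem_cat ?H ?H' orbT.
  + by apply: rr; rewrite /= mem_cat H orbT.
  + by move=> H'; apply: fi; rewrite /= mem_cat ?H ?H'.
  + by apply: rr; rewrite /= mem_cat H.
- apply: eq_bigr => i _; apply: eq_bigr => j _; congr (_ * _); apply: IH.
    by move=> m n mn nn; apply: fi; rewrite /= !inE ?mn ?nn !orbT.
  move=> n na; rewrite !updE.
  have fE m : m \in [:: p, q & names a] -> (f n == f m) = (n == m).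
    by move=> ma; rewrite (inj_in_eq fi) //= !inE na !orbT.
  by rewrite !fE ?mem_head ?inE ?eqxx ?orbT // rr //= !inE na !orbT.
Qed.

(** The tensors with identifiers in [D] satisfy the equations used by [subst]. *)
Definition resolves (D : seq nat) := forall id k r, id \in D -> env id [seq r n | n <- iota 0 k] = den g env r (atom_texp id k).

Variable D : seq nat.
Hypothesis res : resolves D.

Lemma den_subst e r : clean D e -> den g env r (subst D e) = den g env r e.
Proof.
elim: e r => [id s|c|a IH|a IHa b IHb|a IHa b IHb|p q a IH] r.
- rewrite [subst D _]/= [clean D _]/=; case: ifP => //= iD C.
  have -> : env id [seq r n | n <- s] =
      env id [seq (fun n => r (at_args s n)) n | n <- iota 0 (size s)].
    congr env; rewrite [RHS](map_comp r (at_args s)); congr map.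
    rewrite -{1}(mkseq_nth 0%N s); apply/eq_in_map => n.
    by rewrite mem_iota => /andP[_ ns]; apply: set_nth_default.
  rewrite res //; apply: den_rename => // m n mc nc E.
  have U x : x \in names (atom_texp id (size s)) ->
      x \in undup (iota 0 (size s) ++ names (atom_texp id (size s))).
    by rewrite mem_undup mem_cat => ->; rewrite orbT.
  have := U _ mc; have := U _ nc; move: (undup _) C => l C nl ml.
  have im : (index m l < size [seq at_args s n | n <- l])%N by rewrite size_map index_mem.
  have jn : (index n l < size [seq at_args s n | n <- l])%N by rewrite size_map index_mem.
  have H := nth_uniq 0%N im jn C; move: H.
  rewrite !(nth_map 0%N) ?index_mem // !nth_index // E eqxx => /esym/eqP H.
  by rewrite -(nth_index 0%N ml) H nth_index.
- by [].
- by move=> /= /IH ->.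
- by move=> /= /andP[/IHa -> /IHb ->].
- by move=> /= /andP[/IHa -> /IHb ->].
- by move=> /= C; apply: eq_bigr => i _; apply: eq_bigr => j _; rewrite IH.
Qed.

End Substitution.

Definition phi_penv (id : nat) (s : seq nat) : spoly :=
  match id, s with
  | 0, [:: i; j] => pconst (del i j)
  | 1, [:: i; j; k] => pconst (phi0 i j k)
  | _, _ => [::]
  end%N.

Definition nil_poly (p : spoly) := if p is [::] then true else false.

Lemma psi0_check : all (fun i => all (fun j => all (fun k => all (fun l =>
  nil_poly (padd (pev phi_penv (nth 0%N [:: i; j; k; l]) (psi_texp 0 1 2 3))
    (pscale m1 (pconst (psi0 i j k l))))) idx7) idx7) idx7) idx7.
Proof. vm_cast_no_check (erefl true). Qed.

Section Identities.
Variable R : realType.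
Variables (g : 'I_7 -> 'I_7 -> R) (phi : 'I_7 -> 'I_7 -> 'I_7 -> R) (psi : 'I_7 -> 'I_7 -> 'I_7 -> 'I_7 -> R).
Variable E : 'I_7 -> 'I_7 -> R.
Hypothesis ad : adapted g phi E.
Hypothesis psiE : forall i j k l, psi i j k l =
  g i k * g j l - g i l * g j k - ctr g (fun m m' => phi i j m * phi k l m').

(** The extension of a tensor defined by an expression, vector by vector; [us] are
    the vectors already inserted. *)
Lemma ext_vden env e (us vs : seq ('I_7 -> R)) d : wf e ->
  {subset iota (size us) (size vs) <= fv e} ->
  ext (fun s => vden E env (nth d (us ++ [seq @evec R i | i <- s])) e) vs =
  vden E env (nth d (us ++ vs)) e.
Proof.
move=> we; elim: vs us => [|v vs IH] us sub //=.
have step i : ext (fun s => vden E env (nth d (us ++ evec R i :: [seq evec R i | i <- s])) e) vs =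
    vden E env (nth d (us ++ evec R i :: vs)) e.
  rewrite -cat_rcons -IH; last first.
    by move=> n nin; apply: sub; rewrite size_rcons in nin; rewrite /= inE nin orbT.
  by apply: ext_eq => s; rewrite cat_rcons.
under eq_bigr do rewrite step.
rewrite [RHS](@vden_lin _ _ _ _ _ (size us) v (fun s => evec R s)) //.
- apply: eq_bigr => i _; congr (_ * _); apply: vden_eq => // n _.
  rewrite updE !nth_cat; case: eqP => [->|/eqP nu]; first by rewrite ltnn subnn.
  case: ltnP => // un; have : (0 < n - size us)%N by rewrite subn_gt0 ltn_neqAle eq_sym nu.
  by case: (n - size us)%N.
- by apply: sub; rewrite /= mem_head.
- by move=> i; rewrite nth_cat ltnn subnn /= -evec_sum.
Qed.


Definition env3 (id : nat) : seq 'I_7 -> R :=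
  match id with
  | 0%N => ten_seq2 g | 1%N => ten_seq3 phi | _ => fun=> 0
  end.

Lemma psi_frame (i j k l : 'I_7) : fr4 E psi i j k l = zr R (psi0 i j k l).
Proof.
have [gE _ gd pd] := ad.
pose e := psi_texp 0 1 2 3; have we : wf e by [].
pose d : 'I_7 -> R := fun=> 0.
have -> : fr4 E psi i j k l = vden E env3 (nth d [:: E i; E j; E k; E l]) e.
  rewrite -(@ext_vden env3 e [::] [:: E i; E j; E k; E l] d we); last first.
    by move=> n; rewrite mem_iota /e !inE; case: n => [|[|[|[|n]]]].
  apply: ext_size => s s4.
  rewrite -(@vden_eq _ _ _ (fun n => evec R (nth ord0 s n))) //.
    rewrite -(den_vden env3 _ we gE).
    by case: s s4 => [|a [|b [|c [|? [|? ?]]]]] //= _; rewrite psiE.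
  move=> n nf; rewrite (nth_map ord0) // s4.
  by move: nf; rewrite !inE => /or4P[]/eqP->.
pose s n := nth ord0 [:: i; j; k; l] n.
rewrite (@vden_eq _ _ _ _ (fun n => E (s n))) //; last first.
  by move=> n; rewrite !inE => /or4P[]/eqP->.
rewrite vden_frame (fden_pev (val := fun=> 0) (penv := phi_penv)); last first.
  move=> id t; rewrite /frame_env /env3; case: id => [|[|id]].
  - rewrite frame_ten2; case: t => [|x [|y [|? ?]]] //=; rewrite ?peval_nil //.
    by rewrite peval_const gd.
  - rewrite frame_ten3; case: t => [|x [|y [|z [|? ?]]]] //=; rewrite ?peval_nil //.
    by rewrite peval_const pd.
  - by rewrite ext0 // peval_nil.
have in7 (x : 'I_7) : nat_of_ord x \in idx7 by rewrite mem_iota add0n ltn_ord.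
have := psi0_check => /seq.allP/(_ _ (in7 i))/seq.allP/(_ _ (in7 j)).
move=> /seq.allP/(_ _ (in7 k))/seq.allP/(_ _ (in7 l)).
rewrite (@pev_eq _ _ (fun n => nat_of_ord (s n))); last first.
  by case=> [|[|[|[|n]]]] //; rewrite /s /= !nth_nil.
move: (pev _ _ _) => p H; apply/eqP; rewrite -subr_eq0; apply/eqP.
have : peval (fun=> 0 : R) (padd p (pscale m1 (pconst (psi0 i j k l)))) = 0.
  by move: H; case: (padd _ _) => // _; rewrite peval_nil.
by rewrite peval_add peval_scale peval_const /zr /= mulN1r.
Qed.

(** The tensors other than the metric, [phi] and [psi] may take any values, so
    their components are the variables of the polynomials. *)
Lemma g2_identity env e r : holds e ->
  env 0%N = ten_seq2 g -> env 1%N = ten_seq3 phi -> env 8%N = ten_seq4 psi ->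
  den g env r e = 0.
Proof.
move=> /andP[we van] e0 e1 e8; have [gE _ gd pd] := ad.
pose val (v : var) := frame_env E env (last 0%N v)
  [seq inord i : 'I_7 | i <- take (size v).-1 v].
apply: (tensor_identity ad (val := val) _ _ _ van) => //.
move=> id s.
have gen : frame_env E env id s = peval val (pvar (rcons [seq nat_of_ord i | i <- s] id)).
  rewrite peval_var /val last_rcons size_rcons -cats1 take_size_cat // -map_comp -[LHS]/(frame_env E env id s); congr frame_env.
  by rewrite -[LHS]map_id; apply: eq_map => i /=; rewrite inord_val.
have [i0|n0] := eqVneq id 0%N.
  rewrite i0 /frame_env e0 frame_ten2; case: s {gen} => [|x [|y [|? ?]]] //=; rewrite ?peval_nil //.
  by rewrite peval_const gd.
have [i1|n1] := eqVneq id 1%N.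
  rewrite i1 /frame_env e1 frame_ten3; case: s {gen} => [|x [|y [|z [|? ?]]]] //=; rewrite ?peval_nil //.
  by rewrite peval_const pd.
have [i8|n8] := eqVneq id 8%N.
  rewrite i8 /frame_env e8 frame_ten4; case: s {gen} => [|x [|y [|z [|w [|? ?]]]]] //=; rewrite ?peval_nil //.
  by rewrite peval_const psi_frame.
rewrite gen; congr peval; move: n0 n1 n8.
by case: id {gen} => [|[|[|[|[|[|[|[|[|id]]]]]]]]].
Qed.

Lemma g2_identity_subst D env e r : holds_subst D e -> resolves g env D ->
  env 0%N = ten_seq2 g -> env 1%N = ten_seq3 phi -> env 8%N = ten_seq4 psi ->
  den g env r e = 0.
Proof.
move=> /and4P[c1 c2 c3 H] res e0 e1 e8.
rewrite -(den_subst res _ c1) -(den_subst res _ c2) -(den_subst res _ c3).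
exact: g2_identity.
Qed.

End Identities.

Lemma metric6_check : holds_subst [::] (metric6 0 1).
Proof. vm_cast_no_check (erefl true). Qed.
Lemma metric_dot_check : holds_subst [:: 3; 40; 41]%N metric_dot_texp.
Proof. vm_cast_no_check (erefl true). Qed.
Lemma psi_dot_check : holds_subst [:: 20; 21]%N psi_dot_texp.
Proof. vm_cast_no_check (erefl true). Qed.
Lemma torsion24_check : holds_subst [:: 9]%N torsion24_texp.
Proof. vm_cast_no_check (erefl true). Qed.
Definition tau_ids : seq nat := ([:: 3; 5; 9; 18; 20; 22; 28; 29])%N.
Lemma tau24_check : holds_subst tau_ids tau24_texp.
Proof. vm_cast_no_check (erefl true). Qed.
Lemma riem_ricci_check : holds_subst [::] (riem_ricci_texp 0 1).
Proof. vm_cast_no_check (erefl true). Qed.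
Lemma ricci_torsion_check : holds_subst [:: 18]%N ricci_torsion_texp.
Proof. vm_cast_no_check (erefl true). Qed.
Definition final_ids : seq nat := ([:: 3; 5; 6; 10; 11; 13; 15; 18; 20; 21; 22; 26; 28])%N.
Lemma final_check : holds_subst final_ids final_texp.
Proof. vm_cast_no_check (erefl true). Qed.

(** * Covariant derivatives along a direction *)

Section CovariantDerivative.
Variables (R : realType) (V : normedModType R) (z w : V).
Notation ten1 := ('I_7 -> R).
Notation ten2 := ('I_7 -> 'I_7 -> R).
Notation ten3 := ('I_7 -> 'I_7 -> 'I_7 -> R).
Notation ten4 := ('I_7 -> 'I_7 -> 'I_7 -> 'I_7 -> R).
Variable Gam : ten2.

(** Covariant differentiation, written as an equation for the ordinary derivative,
    which also asserts that this derivative exists. *)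
Definition cov (A : V -> seq 'I_7 -> R) (B : seq 'I_7 -> R) :=
  forall s, dder z w (fun y => A y s) (B s + act Gam (A z) s).

Lemma dder_uniq f a b : dder z w f a -> dder z w f b -> a = b.
Proof. by move=> /dder_val <- /dder_val <-. Qed.

Lemma cov_eq A B B' : cov A B -> (forall s, B s = B' s) -> cov A B'.
Proof. by move=> H E s; apply: (dder_eq (H s)); rewrite E. Qed.

Lemma act0 G (A : seq 'I_7 -> R) s : (forall t, size t = size s -> A t = 0) -> act G A s = 0.
Proof.
elim: s A => //= i s IH A A0; rewrite big1 ?add0r => [|m _]; last first.
  by rewrite A0 ?mulr0.
by apply: IH => t ts; apply: A0; rewrite /= ts.
Qed.

Lemma cov_size k A B : (forall y s, size s != k -> A y s = 0) ->
  (forall s, size s != k -> B s = 0) ->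
  (forall s, size s = k -> dder z w (fun y => A y s) (B s + act Gam (A z) s)) -> cov A B.
Proof.
move=> A0 B0 H s; have [sk|sk] := eqVneq (size s) k; first exact: H.
rewrite B0 // add0r act0 => [|t ts]; last by rewrite A0 // ts.
have -> : (fun y => A y s) = fun=> 0 by apply/funext => y; rewrite A0.
exact: dder_cst.
Qed.

Lemma cov_ten1 (A : V -> ten1) (B : ten1) :
  (forall i, dder z w (fun y => A y i) (B i + \sum_m Gam m i * A z m)) <->
  cov (fun y => ten_seq1 (A y)) (ten_seq1 B).
Proof.
split=> [H|H i]; last by apply: (dder_eq (H [:: i])); rewrite /= addr0.
apply: (@cov_size 1) => [y|s|s].
- by case=> [|? [|? ?]].
- by case: s => [|? [|? ?]].
- by case: s => [|i [|? ?]] // _; apply: (dder_eq (H i)); rewrite /= addr0.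
Qed.

Lemma cov_ten2 (A : V -> ten2) (B : ten2) :
  (forall i j, dder z w (fun y => A y i j)
     (B i j + \sum_m Gam m i * A z m j + \sum_m Gam m j * A z i m)) <->
  cov (fun y => ten_seq2 (A y)) (ten_seq2 B).
Proof.
split=> [H|H i j]; last by apply: (dder_eq (H [:: i; j])); rewrite /= addr0 addrA.
apply: (@cov_size 2) => [y|s|s].
- by case=> [|? [|? [|? ?]]].
- by case: s => [|? [|? [|? ?]]].
- by case: s => [|i [|j [|? ?]]] // _; apply: (dder_eq (H i j)); rewrite /= addr0 addrA.
Qed.

Lemma cov_ten3 (A : V -> ten3) (B : ten3) :
  (forall i j k, dder z w (fun y => A y i j k)
     (B i j k + \sum_m Gam m i * A z m j k + \sum_m Gam m j * A z i m k
      + \sum_m Gam m k * A z i j m)) <->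
  cov (fun y => ten_seq3 (A y)) (ten_seq3 B).
Proof.
split=> [H|H i j k]; last by apply: (dder_eq (H [:: i; j; k])); rewrite /= addr0 !addrA.
apply: (@cov_size 3) => [y|s|s].
- by case=> [|? [|? [|? [|? ?]]]].
- by case: s => [|? [|? [|? [|? ?]]]].
- by case: s => [|i [|j [|k [|? ?]]]] // _; apply: (dder_eq (H i j k)); rewrite /= addr0 !addrA.
Qed.

Lemma cov_ten4 (A : V -> ten4) (B : ten4) :
  (forall i j k l, dder z w (fun y => A y i j k l)
     (B i j k l + act Gam (ten_seq4 (A z)) [:: i; j; k; l])) <->
  cov (fun y => ten_seq4 (A y)) (ten_seq4 B).
Proof.
split=> [H|H i j k l]; last by apply: (dder_eq (H [:: i; j; k; l])).
apply: (@cov_size 4) => [y|s|s].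
- by case=> [|? [|? [|? [|? [|? ?]]]]].
- by case: s => [|? [|? [|? [|? [|? ?]]]]].
- by case: s => [|i [|j [|k [|l [|? ?]]]]] // _; apply: (dder_eq (H i j k l)).
Qed.

Variables (g : V -> ten2).
Hypothesis inv_der : forall p q,
  dder z w (fun y => metric_inv (g y) p q)
    (- \sum_m (Gam p m * metric_inv (g z) m q + Gam q m * metric_inv (g z) p m)).

(** The form of [leibniz] in which the free indices of the expression are numbered
    consecutively, after the index of differentiation. *)
Lemma leibniz_cov (env : V -> nat -> seq 'I_7 -> R) env1 dd (xs s : seq 'I_7) e :
  let extra := iota 0 (size xs) in
  let r t := nth ord0 (xs ++ t) in
  wf e -> perm_eq (fv e) (iota (size xs) (size s)) ->
  ~~ has (mem extra) (bound e) ->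
  (forall id, id \in ids e -> (forall t, env1 id t = env z id t) /\
     cov (fun y => env y id) (fun t => env1 (dd id) (xs ++ t))) ->
  dder z w (fun y => den (g y) (env y) (r s) e)
    (den (g z) env1 (r s) (der dd extra e) +
     act Gam (fun t => den (g z) (env z) (r t) e) s).
Proof.
move=> extra r we fve eb H.
have r1 : [seq r s n | n <- extra] = xs.
  rewrite -[RHS](mkseq_nth ord0); apply/eq_in_map => n; rewrite mem_iota => /andP[_ nx].
  by rewrite /r nth_cat nx.
apply: (dder_eq (leibniz inv_der (env1 := env1) (dd := dd) (extra := extra) (xs := xs) we r1 _ _)).
- move=> n ne; apply: contraNN eb => nb; apply/hasP; by exists n.
- by move=> id t /H [-> ?].
congr (_ + _); rewrite (perm_big _ fve) /=.
have sE : s = [seq r s n | n <- iota (size xs) (size s)].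
  rewrite -{1}[s](mkseq_nth ord0) /mkseq -[in RHS](addn0 (size xs)) iotaDl -map_comp.
  by apply/eq_in_map => n _; rewrite /= /r nth_cat ltnNge leq_addr /= addKn.
rewrite [in RHS]sE act_upd ?iota_uniq // big_seq [RHS]big_seq; apply: eq_bigr => n nin.
apply: eq_bigr => m _; congr (_ * _); apply: den_eq => // k.
rewrite (perm_mem fve) mem_iota => /andP[xk kx]; rewrite {2}/r nth_cat ltnNge xk /=.
rewrite (nth_map 0%N) ?size_iota; last by rewrite ltn_subLR.
by rewrite nth_iota ?ltn_subLR // subnKC.
Qed.

End CovariantDerivative.

Section DualDerivative.
Variables (R : realType) (V : normedModType R) (z w : V).
Notation ten2 := ('I_7 -> 'I_7 -> R).
Variables (Gam : ten2) (g : V -> ten2) (phi : V -> 'I_7 -> 'I_7 -> 'I_7 -> R).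
Variables (Y : 'I_7 -> R) (E : 'I_7 -> 'I_7 -> R).
Hypothesis inv_der : forall p q,
  dder z w (fun y => metric_inv (g y) p q)
    (- \sum_m (Gam p m * metric_inv (g z) m q + Gam q m * metric_inv (g z) p m)).
Hypothesis ad : adapted (g z) (phi z) E.

Definition psi_of (g : ten2) (phi : 'I_7 -> 'I_7 -> 'I_7 -> R) i j k l : R :=
  g i k * g j l - g i l * g j k - ctr g (fun m m' => phi i j m * phi k l m').
Definition hook_of (g : ten2) (psi : 'I_7 -> 'I_7 -> 'I_7 -> 'I_7 -> R) (Y : 'I_7 -> R) i j k : R :=
  ctr g (fun m m' => psi m' i j k * Y m).
Definition wedge_of (phi : 'I_7 -> 'I_7 -> 'I_7 -> R) (Y : 'I_7 -> R) i j k l : R :=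
  phi i k l * Y j + phi i j k * Y l - (phi j k l * Y i + phi i j l * Y k).

Hypothesis cov_g : cov z w Gam (fun y => ten_seq2 (g y)) (fun=> 0).
Hypothesis cov_phi : cov z w Gam (fun y => ten_seq3 (phi y))
  (ten_seq3 (hook_of (g z) (psi_of (g z) (phi z)) Y)).

(** Differentiating [psi = g g - g g - phi phi] along a direction where the
    metric is parallel and [D phi] is the contraction of [Y] with [psi]. *)
Lemma cov_psi : cov z w Gam (fun y => ten_seq4 (psi_of (g y) (phi y)))
  (ten_seq4 (wedge_of (phi z) Y)).
Proof.
pose env y id := match id with 0%N => ten_seq2 (g y) | 1%N => ten_seq3 (phi y) | _ => fun=> 0 end.
pose env1 id := match id with
  | 0%N => ten_seq2 (g z) | 1%N => ten_seq3 (phi z) | 4%N => ten_seq1 Y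
  | 8%N => ten_seq4 (psi_of (g z) (phi z))
  | 21%N => ten_seq3 (hook_of (g z) (psi_of (g z) (phi z)) Y)
  | _ => fun=> 0 end.
apply/cov_ten4 => i j k l.
have psiE y i' j' k' l' : psi_of (g y) (phi y) i' j' k' l' =
    den (g y) (env y) (nth ord0 [:: i'; j'; k'; l']) (psi_texp 0 1 2 3) by [].
have := @leibniz_cov _ _ z w Gam g inv_der env env1 (addn 20) [::] [:: i; j; k; l] (psi_texp 0 1 2 3).
rewrite [size _]/= [size _]/= => /(_ isT isT isT) H.
apply: (dder_eq (H _)).
  move=> id; rewrite !inE => idE; have /orP[/eqP->|/eqP->] : (id == 0%N) || (id == 1%N).
      by move: idE; do ![case/orP; first by move=> ->; rewrite ?orbT]; move=> ->; rewrite ?orbT.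
    by split=> //; exact: cov_g.
  by split=> //; exact: cov_phi.
congr (_ + _).
  apply/eqP; rewrite -subr_eq0; apply/eqP.
  have := @g2_identity_subst _ (g z) (phi z) (psi_of (g z) (phi z)) E ad (fun _ _ _ _ => erefl) _ env1 _
     (nth ord0 [:: i; j; k; l]) psi_dot_check.
  move=> <- //.
  move=> id k' r; rewrite !inE => /orP[]/eqP->.
    by rewrite /= /zr /= mulr0z mul0r.
  by case: k' => [|[|[|[|k']]]].
Qed.

End DualDerivative.

(** * The variation of the geometry *)

(** The algebraic symmetries of a curvature tensor imply the symmetry under exchange
    of pairs, which carries the Bianchi identity over to the last three
    indices. *)
Lemma bianchi_cyclic (R : realType) (f : 'I_7 -> 'I_7 -> 'I_7 -> 'I_7 -> R) :
  (forall a b c d, f a b c d = - f b a c d) ->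
  (forall a b c d, f a b c d = - f a b d c) ->
  (forall a b c d, f a b c d + f b c a d + f c a b d = 0) ->
  forall a b c d, f a b c d + (f a c d b + f a d b c) = 0.
Proof.
move=> s12 s34 B.
have pair a b c d : f a b c d = f c d a b.
  have B1 := B a b c d; have B2 := B b c d a; have B3 := B c d a b; have B4 := B d a b c.
  have E1 := s34 a b d c; have E2 := s34 c d b a; have E3 := s34 b c d a.
  have E4 := s34 c a d b; have E5 := s12 a c d b; have E6 := s34 d a b c.
  have E7 := s12 b d a c; have E8 := s34 d b c a; lra.
move=> a b c d; have := B b c d a; have := pair a b c d; have := pair a c d b.
have := pair a d b c; have := s34 c d a b; have := s34 d b a c; have := s34 b c a d; lra.
Qed.

Lemma opp_self0 (R : realType) (u : R) : u = - u -> u = 0.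
Proof. lra. Qed.

Lemma ricci_arith (R : realType) (u v w : R) :
  u + 4%:R * v = 0 -> 3%:R * u + (12%:R * w + 6%:R * 0) - 2%:R * 0 = 0 -> w = v.
Proof. lra. Qed.

Section Spacetime2.
Variable R : realType.
Notation V := 'rV[R]_7.
Notation W := (spacetime R).
Notation ea := (@ea R).
Notation et := (@et R).
Notation ten2 := ('I_7 -> 'I_7 -> R).

Lemma dder_space (f : W -> R) (t : R) (y v : V) d :
  dder (t, y) (spatial v) f d <-> dder y v (fun y => f (t, y)) d.
Proof.
rewrite /dder; split; case=> H1 H2; apply: DeriveDef.
- exact: (@derivable_space R f t y v H1).
- by rewrite (@derive_space R f t y v).
- by move: H1; rewrite /derivable (@slice_space R f t y v).
- by rewrite -(@derive_space R f t y v).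
Qed.

Lemma dder_time (f : W -> R) (t : R) (y : V) d :
  dder (t, y) et f d <-> dder (t : R^o) (1 : R^o) (fun t => f (t, y)) d.
Proof.
rewrite /dder; split; case=> H1 H2; apply: DeriveDef.
- exact: (@derivable_time R f t y H1).
- by rewrite (@derive_time R f t y).
- by move: H1; rewrite /derivable (@slice_time R f t y).
- by rewrite -(@derive_time R f t y).
Qed.

Section Family.
Variables (eps : R) (O : set V).
Hypothesis Oo : open O.
Notation U := (domain eps O).
Let Uo := @domain_open R eps O Oo.
Variables (F : R -> V -> 'I_7 -> 'I_7 -> 'I_7 -> R) (G : R -> V -> 'I_7 -> 'I_7 -> R) (vol : R -> V -> R).
Hypothesis Gsym : forall t y, U (t, y) -> forall a b, G t y a b = G t y b a.
Hypothesis Gpos : forall t y, U (t, y) -> forall v : 'I_7 -> R, (exists a, v a != 0) ->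
  0 < \sum_a \sum_b G t y a b * v a * v b.
Hypothesis vol2 : forall t y, U (t, y) -> vol t y ^+ 2 = \det (\matrix_(a < 7, b < 7) G t y a b).
Hypothesis F12 : forall t y, U (t, y) -> forall a b c, F t y a b c = - F t y b a c.
Hypothesis F23 : forall t y, U (t, y) -> forall a b c, F t y a b c = - F t y a c b.
Hypothesis compat : forall t y, U (t, y) -> forall a b,
  wedge223 (F t y a) (F t y b) (F t y) = - 6 * G t y a b * vol t y.
Hypothesis F_smooth : forall a b c, smooth_on U (fun z : W => F z.1 z.2 a b c : R^o).

Let G_sm a b := G_smooth Oo Gpos vol2 compat F_smooth a b.
Let Gi_sm p q := Ginv_smooth Oo Gpos vol2 compat F_smooth p q.
Let Ga_sm k i j := christoffel_smooth Oo Gpos vol2 compat F_smooth k i j.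

Definition met (z : W) := G z.1 z.2.
Definition phi (z : W) := F z.1 z.2.
Definition psi z := psi_of (met z) (phi z).
Definition Gam (a : 'I_7) (z : W) : ten2 := fun m i => christoffel (G z.1) z.2 m a i.

Lemma smooth_dder (f : W -> R) z w : smooth_on U (f : W -> R^o) -> U z ->
  dder z w f ('D_w (f : W -> R^o) z).
Proof. move=> Hf Uz; apply: derivableP; exact: (classC_derivable (Hf 1%N) Uz). Qed.

Lemma dder_near z w f f' d : U z -> (forall y, U y -> f y = f' y) -> dder z w f d -> dder z w f' d.
Proof.
move=> Uz E; apply: near_eq_is_derive.
by apply: (near_U Uo _ Uz) => y Uy; rewrite E.
Qed.

Lemma met_sym z a b : U z -> met z a b = met z b a.
Proof. by case: z => t y /Gsym H; apply: H. Qed.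

Lemma frame_exists z : U z -> exists E, adapted (met z) (phi z) E /\
  (forall i j k l, hodge3 (met z) (vol z.1 z.2) (phi z) i j k l = psi z i j k l).
Proof.
case: z => t y Uz; have [E [ad vE]] := adapted_frame (Gsym Uz) (Gpos Uz) (vol2 Uz) (F12 Uz) (F23 Uz) (compat Uz).
exists E; split => // i j k l; rewrite /psi /psi_of (ctr_phi_phi ad vE) /=.
by rewrite opprB addrCA subrr addr0.
Qed.

Lemma inv_sym z p q : U z -> metric_inv (met z) p q = metric_inv (met z) q p.
Proof.
move=> /frame_exists[E [[gE _ _ _] _]]; rewrite !gE.
by apply: eq_bigr => s _; rewrite mulrC.
Qed.

Lemma inv_met z i j : U z -> \sum_m metric_inv (met z) i m * met z m j = (i == j)%:R.
Proof.
case: z => t y Uz; have zu := G_unit Gpos Uz.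
have := congr1 (fun M : 'M[R]_7 => M i j) (mulVmx zu); rewrite !mxE => <-.
by apply: eq_bigr => m _; rewrite [in RHS]mxE.
Qed.

Lemma sum_delta (i : 'I_7) (f : 'I_7 -> R) : \sum_m (m == i)%:R * f m = f i.
Proof.
rewrite (bigD1 i) //= eqxx mul1r big1 ?addr0 // => m /negbTE ->.
by rewrite mul0r.
Qed.

Lemma lower_raise z (f : 'I_7 -> R) i : U z ->
  \sum_m met z m i * (\sum_l metric_inv (met z) m l * f l) = f i.
Proof.
move=> Uz; rewrite -[RHS](sum_delta i f).
under eq_bigr do rewrite mulr_sumr.
rewrite exchange_big; apply: eq_bigr => l _ /=; rewrite -(inv_met l i Uz) mulr_suml.
by apply: eq_bigr => m _; rewrite mulrA (inv_sym l m Uz) [met _ _ _ * _]mulrC.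
Qed.

Lemma raise_lower z (f : 'I_7 -> R) i : U z ->
  \sum_l metric_inv (met z) i l * (\sum_m f m * met z m l) = f i.
Proof.
move=> Uz; rewrite -[RHS](sum_delta i f).
under eq_bigr do rewrite mulr_sumr.
rewrite exchange_big; apply: eq_bigr => m _ /=; rewrite eq_sym -(inv_met i m Uz) mulr_suml.
by apply: eq_bigr => l _; rewrite (met_sym m l Uz); ring.
Qed.

Lemma met_space z a i j : U z ->
  dder z (ea a) (fun z => met z i j) (pd a (fun y => G z.1 y i j) z.2).
Proof.
case: z => t y Uz; rewrite (@pd_space R (fun z => met z i j)).
by apply: smooth_dder => //; exact: G_sm.
Qed.

Lemma pd_sym z a i j : U z -> pd a (fun y => G z.1 y i j) z.2 = pd a (fun y => G z.1 y j i) z.2.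
Proof.
move=> Uz; rewrite -(dder_val (met_space a i j Uz)) -(dder_val (met_space a j i Uz)).
rewrite (dder_val (met_space a i j Uz)); apply/esym/dder_val.
by apply: (dder_near Uz _ (met_space a i j Uz)) => y Uy; exact: met_sym.
Qed.

(** Koszul's formula. *)
Lemma Gam_lower z a i j : U z -> \sum_m Gam a z m i * met z m j =
  2^-1 * (pd a (fun y => G z.1 y i j) z.2 + pd i (fun y => G z.1 y a j) z.2
     - pd j (fun y => G z.1 y a i) z.2).
Proof.
move=> Uz; rewrite -[RHS](lower_raise (fun j => 2^-1 * (pd a (fun y => G z.1 y i j) z.2
  + pd i (fun y => G z.1 y a j) z.2 - pd j (fun y => G z.1 y a i) z.2)) j Uz).
apply: eq_bigr => m _; rewrite [LHS]mulrC; apply: (congr1 (fun c => met z m j * c)).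
by rewrite /Gam /christoffel mulr_sumr; apply: eq_bigr => l _; rewrite mulrCA.
Qed.

Lemma Gam_sym z a m i : U z -> Gam a z m i = Gam i z m a.
Proof.
move=> Uz; rewrite /Gam /christoffel; congr (_ * _); apply: eq_bigr => l _.
by rewrite (pd_sym l a i Uz); congr (_ * _); ring.
Qed.

Lemma cov_met z w Ga : (forall i j, dder z w (fun y => met y i j)
     (\sum_m Ga m i * met z m j + \sum_m Ga m j * met z i m)) ->
  cov z w Ga (fun y => ten_seq2 (met y)) (fun=> 0).
Proof.
move=> H; apply: cov_eq (_ : cov _ _ _ _ (ten_seq2 (fun _ _ => 0))) _.
  by apply/cov_ten2 => i j; apply: (dder_eq (H i j)); rewrite add0r.
by case=> [|? [|? [|? ?]]].
Qed.

(** The Levi-Civita connection is metric. *)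
Lemma met_compat z a i j : U z -> dder z (ea a) (fun y => met y i j)
     (\sum_m Gam a z m i * met z m j + \sum_m Gam a z m j * met z i m).
Proof.
move=> Uz; apply: (dder_eq (met_space a i j Uz)).
rewrite Gam_lower //; under eq_bigr do rewrite (met_sym _ _ Uz).
by rewrite Gam_lower // (pd_sym a j i Uz); field.
Qed.

Lemma inv_compat z w (Ga : ten2) : U z ->
  (forall i j, dder z w (fun y => met y i j)
     (\sum_m Ga m i * met z m j + \sum_m Ga m j * met z i m)) ->
  forall p q, dder z w (fun y => metric_inv (met y) p q)
    (- \sum_m (Ga p m * metric_inv (met z) m q + Ga q m * metric_inv (met z) p m)).
Proof.
move=> Uz H p q; apply: metric_inv_der.
- apply: (near_U Uo) Uz => -[t y] Uy; exact: (G_unit Gpos Uy).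
- by move=> i j; apply: (dder_eq (H i j)); rewrite big_split.
- by move=> p' q'; exact: (classC_derivable (Gi_sm p' q' 1%N) Uz).
Qed.

(** * The variation of the metric *)

Variables (h : V -> ten2) (X : V -> 'I_7 -> R).
Hypothesis eps0 : 0 < eps.
Hypothesis hsym : forall y, O y -> forall a b, h y a b = h y b a.
Hypothesis dF : forall y, O y -> forall a b c,
  dder (0 : R^o) (1 : R^o) (fun t => F t y a b c)
    (diamond (G 0 y) (h y) (F 0 y) a b c
     + hook4 (G 0 y) (X y) (hodge3 (G 0 y) (vol 0 y) (F 0 y)) a b c).

Lemma dom0 y : O y -> U ((0, y) : W).
Proof. by move=> Oy; split => //=; rewrite normr0. Qed.

Lemma ctr_act z (s : ten2) (f : 'I_7 -> R) i : U z -> (forall a b, s a b = s b a) ->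
  \sum_m (\sum_l metric_inv (met z) m l * s l i) * f m =
  ctr (met z) (fun p q => s i p * f q).
Proof.
move=> Uz ss; under eq_bigr do rewrite mulr_suml.
rewrite exchange_big; apply: eq_bigr => l _; apply: eq_bigr => m _ /=.
by rewrite (inv_sym m l Uz) (ss l i) mulrA.
Qed.

Lemma ctr_linear (g A B : ten2) (c d : R) :
  c * ctr g A + d * ctr g B = ctr g (fun p q => c * A p q + d * B p q).
Proof.
rewrite /ctr !mulr_sumr -big_split; apply: eq_bigr => p _ /=.
rewrite !mulr_sumr -big_split; apply: eq_bigr => q _ /=; ring.
Qed.

Lemma ctr_ext (g A B : ten2) : (forall p q, A p q = B p q) -> ctr g A = ctr g B.
Proof. by move=> E; apply: eq_bigr => p _; apply: eq_bigr => q _; rewrite E. Qed.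

Lemma ctr0 (g A : ten2) : (forall p q, A p q = 0) -> ctr g A = 0.
Proof. by move=> E; rewrite /ctr big1 // => p _; rewrite big1 // => q _; rewrite E mulr0. Qed.

Lemma hook4E y i j k : O y ->
  hook4 (G 0 y) (X y) (hodge3 (G 0 y) (vol 0 y) (F 0 y)) i j k =
  hook_of (met (0, y)) (psi (0, y)) (X y) i j k.
Proof.
move=> Oy; have [E [_ pE]] := frame_exists (dom0 Oy).
by apply: ctr_ext => m m'; rewrite mulrC; congr (_ * _); rewrite -pE.
Qed.

Definition raise (z : W) (s : ten2) : ten2 := fun m i => \sum_l metric_inv (met z) m l * s l i.

(** A symmetric variation [2 s] of the metric is absorbed by the connection matrix
    [s] with one index raised. *)
Lemma raise_compat z w (s : ten2) : U z -> (forall a b, s a b = s b a) ->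
  (forall i j, dder z w (fun y => met y i j) (2 * s i j)) ->
  forall i j, dder z w (fun y => met y i j)
     (\sum_m raise z s m i * met z m j + \sum_m raise z s m j * met z i m).
Proof.
move=> Uz ss H i j; apply: (dder_eq (H i j)).
have L a b : \sum_m raise z s m a * met z m b = s b a.
  by rewrite -(lower_raise (fun l => s l a) b Uz); apply: eq_bigr => m _; rewrite mulrC.
rewrite L; under eq_bigr do rewrite (met_sym i _ Uz).
by rewrite L (ss j i); ring.
Qed.

(** Such a matrix acts on [phi] by the diamond product, so it changes [h] into
    [h - s]. *)
Lemma phi_time y (s : ten2) : O y -> (forall a b, s a b = s b a) ->
  cov ((0, y) : W) et (raise (0, y) s) (fun z => ten_seq3 (phi z))
   (ten_seq3 (fun i j k => diamond (met (0, y)) (fun a b => h y a b - s a b) (phi (0, y)) i j k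
      + hook_of (met (0, y)) (psi (0, y)) (X y) i j k)).
Proof.
move=> Oy ss; apply/cov_ten3 => i j k; apply/dder_time.
apply: (dder_eq (dF Oy i j k)); rewrite hook4E // /raise !(ctr_act _ _ (dom0 Oy)) //.
rewrite /diamond.
have D (f : 'I_7 -> R) a : ctr (G 0 y) (fun p q => h y a p * f q) =
    ctr (met (0, y)) (fun p q => (h y a p - s a p) * f q) + ctr (met (0, y)) (fun p q => s a p * f q).
  rewrite -[X in X + _]mul1r -[X in _ + X]mul1r ctr_linear; apply: ctr_ext => p q; ring.
rewrite !D /phi /=; ring.
Qed.

Definition phi_env (z : W) (id : nat) : seq 'I_7 -> R :=
  match id with 0%N => ten_seq2 (met z) | 1%N => ten_seq3 (phi z) | _ => fun=> 0 end.

Lemma metric6_0 z r : U z -> den (met z) (phi_env z) r (metric6 0 1) = 0.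
Proof.
move=> Uz; have [E [ad _]] := frame_exists Uz.
pose env id := if id == 8%N then ten_seq4 (psi z) else phi_env z id.
rewrite -(@g2_identity_subst R _ _ (psi z) E ad (fun _ _ _ _ => erefl) _ env _ r metric6_check) //.
Qed.

(** The variation of the metric induced by [h <> phi + X _| psi] is [2 h]:
    the identity [phi_ijk phi_ajk = 6 g_ia] determines the metric algebraically,
    and differentiating it with a connection for which the metric is parallel
    leaves a linear equation for the error, which is invertible. *)
Lemma met_time y i j : O y -> dder ((0, y) : W) et (fun z => met z i j) (2 * h y i j).
Proof.
move=> Oy; pose z : W := (0, y); have Uz := dom0 Oy.
pose k a b : R := 'D_et (fun z => met z a b : R^o) z.
have Hk a b : dder z et (fun z => met z a b) (k a b) by apply: smooth_dder => //; exact: G_sm.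
have ks a b : k a b = k b a.
  apply/dder_val/(dder_near Uz _ (Hk b a)) => z' Uz'; exact: met_sym.
(* The metric is parallel for the connection matrix given by [s], and [q] is the
   error to be shown zero. *)
pose s a b := k a b / 2.
have ss a b : s a b = s b a by rewrite /s ks.
have sE a b : dder z et (fun z => met z a b) (2 * s a b).
  by apply: (dder_eq (Hk a b)); rewrite /s; field.
have H := raise_compat Uz ss sE.
pose q a b := h y a b - s a b.
have qs a b : q a b = q b a by rewrite /q ss hsym.
pose D3 i j k := diamond (met z) q (phi z) i j k + hook_of (met z) (psi z) (X y) i j k.
pose env1 id := match id with
  | 3%N => ten_seq2 q | 33%N => ten_seq2 (fun a b => q a b / 2) | 4%N => ten_seq1 (X y)
  | 8%N => ten_seq4 (psi z) | 41%N => ten_seq3 D3 | _ => phi_env z id end.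
have Z0 a b : den (met z) env1 (nth ord0 [:: a; b]) (metric6_dot 0 1) = 0.
  have := leibniz_cov (inv_compat Uz H) (env := phi_env) (env1 := env1) (dd := addn 40)
    (xs := [::]) (s := [:: a; b]) (e := metric6 0 1) isT isT isT.
  move=> L; have {}L : dder z et (fun=> 0) (den (met z) env1 (nth ord0 [:: a; b]) (metric6_dot 0 1)
     + act (raise z s) (fun t => den (met z) (phi_env z) (nth ord0 ([::] ++ t)) (metric6 0 1)) [:: a; b]).
    apply: (dder_near Uz _ (L _)) => [z' Uz'|id]; first by rewrite metric6_0.
    rewrite !inE => idE; have /orP[/eqP->|/eqP->] : (id == 0%N) || (id == 1%N).
        by move: idE; do ![case/orP; first by move=> ->; rewrite ?orbT]; move=> ->; rewrite ?orbT.
      by split => //; exact: cov_met.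
    by split => //; exact: phi_time.
  have := dder_uniq L (dder_cst z et 0); rewrite act0 ?addr0 // => t _.
  exact: metric6_0.
have [E [ad _]] := frame_exists Uz.
have q0 a b : q a b = 0.
  have : den (met z) env1 (nth ord0 [:: a; b]) metric_dot_texp = 0.
    apply: (@g2_identity_subst R _ _ (psi z) E ad (fun _ _ _ _ => erefl) _ env1 _ _ metric_dot_check) => //.
    move=> id n r; rewrite !inE => /or3P[]/eqP->.
    - case: n => [|[|[|n]]] //=; rewrite (qs (r 1%N) (r 0%N)); by field.
    - by rewrite /= /zr /= mulr0z mul0r.
    - by case: n => [|[|[|[|n]]]] //=; rewrite /D3 /diamond /hook_of /=;
        congr (_ + _); rewrite addrA; do ?[congr (_ + _)]; apply: ctr_ext => *; rewrite mulrC.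
  have -> : den (met z) env1 (nth ord0 [:: a; b]) metric_dot_texp =
     9%:R * den (met z) env1 (nth ord0 [:: a; b]) (metric6_dot 0 1)
     - met z a b * ctr (met z) (fun c d => den (met z) env1 (nth ord0 [:: c; d]) (metric6_dot 0 1))
     - 72%:R * q a b by [].
  rewrite Z0 ctr0 // mulr0 mulr0 subrr sub0r => /eqP; rewrite oppr_eq0 mulf_eq0 pnatr_eq0 /=.
  by move/eqP.
apply: (dder_eq (Hk i j)); have := q0 i j; rewrite /q /s => /subr0_eq ->; by field.
Qed.

(** * Covariant derivatives in time and in space *)

Definition GamT (z : W) : ten2 := raise z (h z.2).

Lemma met_compat_time y i j : O y -> dder ((0, y) : W) et (fun z => met z i j)
     (\sum_m GamT (0, y) m i * met (0, y) m j + \sum_m GamT (0, y) m j * met (0, y) i m).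
Proof.
move=> Oy; apply: (raise_compat (dom0 Oy) (hsym Oy)) => a b; exact: met_time.
Qed.

Lemma phi_cov_time y : O y -> cov ((0, y) : W) et (GamT (0, y)) (fun z => ten_seq3 (phi z))
   (ten_seq3 (hook_of (met (0, y)) (psi (0, y)) (X y))).
Proof.
move=> Oy; apply: (cov_eq (phi_time Oy (hsym Oy))) => s.
case: s => [|i [|j [|k [|? ?]]]] //=; rewrite /diamond !ctr0 ?addr0 ?add0r //;
  by move=> p q; rewrite subrr mul0r.
Qed.

Lemma psi_cov_time y : O y -> cov ((0, y) : W) et (GamT (0, y)) (fun z => ten_seq4 (psi z))
   (ten_seq4 (wedge_of (phi (0, y)) (X y))).
Proof.
move=> Oy; have [E [ad _]] := frame_exists (dom0 Oy).
apply: (cov_psi (E := E)) => //.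
- by apply: inv_compat; [exact: dom0|move=> i j; exact: met_compat_time].
- by apply: cov_met => i j; exact: met_compat_time.
- exact: phi_cov_time.
Qed.

Variable T : R -> V -> ten2.
Hypothesis torsion : forall t y, U (t, y) -> forall p a b c,
  nabla3 (G t) (F t) y p a b c =
  ctr (G t y) (fun l m => T t y p l * hodge3 (G t y) (vol t y) (F t y) m a b c).
Hypothesis T_smooth : forall a b, smooth_on O (fun y => T 0 y a b : R^o).
Hypothesis h_smooth : forall a b, smooth_on O (fun y => h y a b : R^o).
Hypothesis X_smooth : forall a, smooth_on O (fun y => X y a : R^o).

Definition tor (z : W) := T z.1 z.2.
Definition dphi (z : W) p i j k := nabla3 (G z.1) (F z.1) z.2 p i j k.

Lemma dphiE z p i j k : U z -> dphi z p i j k = hook_of (met z) (psi z) (tor z p) i j k.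
Proof.
case: z => t y Uz; have [E [_ pE]] := frame_exists Uz.
rewrite /dphi torsion //; apply: ctr_ext => l m; rewrite mulrC; congr (_ * _).
by rewrite -pE.
Qed.

Notation dv a := (delta_mx ord0 a : V).

Lemma pd_dder (f : V -> R) y a : derivable (f : V -> R^o) y (dv a) -> dder y (dv a) f (pd a f y).
Proof. by move=> H; apply: derivableP. Qed.

(** On a slice of constant time the covariant derivatives in space are the usual
    ones. *)
Lemma cov_nabla1 (B : W -> 'I_7 -> R) t y a :
  (forall i, derivable (fun y => B (t, y) i : R^o) y (dv a)) ->
  cov ((t, y) : W) (ea a) (Gam a (t, y)) (fun z => ten_seq1 (B z))
    (ten_seq1 (nabla1 (G t) (fun y => B (t, y)) y a)).
Proof.
move=> H; apply/cov_ten1 => i; apply/dder_space; apply: (dder_eq (pd_dder (H i))).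
by rewrite /nabla1 /Gam /=; ring.
Qed.

Lemma cov_nabla2 (B : W -> ten2) t y a :
  (forall i j, derivable (fun y => B (t, y) i j : R^o) y (dv a)) ->
  cov ((t, y) : W) (ea a) (Gam a (t, y)) (fun z => ten_seq2 (B z))
    (ten_seq2 (nabla2 (G t) (fun y => B (t, y)) y a)).
Proof.
move=> H; apply/cov_ten2 => i j; apply/dder_space; apply: (dder_eq (pd_dder (H i j))).
by rewrite /nabla2 /Gam /=; ring.
Qed.

Lemma cov_nabla3 (B : W -> 'I_7 -> ten2) t y a :
  (forall i j k, derivable (fun y => B (t, y) i j k : R^o) y (dv a)) ->
  cov ((t, y) : W) (ea a) (Gam a (t, y)) (fun z => ten_seq3 (B z))
    (ten_seq3 (nabla3 (G t) (fun y => B (t, y)) y a)).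
Proof.
move=> H; apply/cov_ten3 => i j k; apply/dder_space; apply: (dder_eq (pd_dder (H i j k))).
by rewrite /nabla3 /Gam /=; ring.
Qed.

Lemma phi_cov_space z a : U z -> cov z (ea a) (Gam a z) (fun z => ten_seq3 (phi z)) (ten_seq3 (dphi z a)).
Proof.
case: z => t y Uz; apply: (@cov_nabla3 phi) => i j k.
exact: (@derivable_space R (fun z => phi z i j k) t y _ (classC_derivable (F_smooth i j k 1%N) Uz)).
Qed.

Lemma psi_cov_space z a : U z -> cov z (ea a) (Gam a z) (fun z => ten_seq4 (psi z))
   (ten_seq4 (wedge_of (phi z) (tor z a))).
Proof.
move=> Uz; have [E [ad _]] := frame_exists Uz.
apply: (cov_psi (E := E)) => //.
- by apply: inv_compat => // i j; exact: met_compat.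
- by apply: cov_met => i j; exact: met_compat.
- apply: (cov_eq (phi_cov_space a Uz)) => s.
  by case: s => [|i [|j [|k [|? ?]]]] //=; rewrite dphiE.
Qed.

Lemma smooth_derivable (f : V -> R) y v : smooth_on O (f : V -> R^o) -> O y -> derivable (f : V -> R^o) y v.
Proof. by move=> H Oy; exact: (classC_derivable (H 1%N) Oy). Qed.

Lemma tor_cov_space y a : O y -> cov ((0, y) : W) (ea a) (Gam a (0, y)) (fun z => ten_seq2 (tor z))
   (ten_seq2 (nabla2 (G 0) (T 0) y a)).
Proof. by move=> Oy; apply: (@cov_nabla2 tor) => i j; exact: (smooth_derivable (T_smooth i j) Oy). Qed.

Lemma h_cov_space y a : O y -> cov ((0, y) : W) (ea a) (Gam a (0, y)) (fun z => ten_seq2 (h z.2))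
   (ten_seq2 (nabla2 (G 0) h y a)).
Proof. by move=> Oy; apply: (@cov_nabla2 (fun z => h z.2)) => i j; exact: (smooth_derivable (h_smooth i j) Oy). Qed.

Lemma X_cov_space y a : O y -> cov ((0, y) : W) (ea a) (Gam a (0, y)) (fun z => ten_seq1 (X z.2))
   (ten_seq1 (nabla1 (G 0) X y a)).
Proof. by move=> Oy; apply: (@cov_nabla1 (fun z => X z.2)) => i; exact: (smooth_derivable (X_smooth i) Oy). Qed.

Definition dh (y : V) := nabla2 (G 0) h y.

Lemma dh_cov_space y b : O y -> cov ((0, y) : W) (ea b) (Gam b (0, y)) (fun z => ten_seq3 (dh z.2))
   (ten_seq3 (nabla3 (G 0) dh y b)).
Proof.
move=> Oy; apply: (@cov_nabla3 (fun z => dh z.2)) => a i j.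
have dG m p q : derivable (fun y => christoffel (G 0) y m p q : R^o) y (dv b).
  exact: (@derivable_space R (fun z => christoffel (G z.1) z.2 m p q) 0 y _ (classC_derivable (Ga_sm m p q 1%N) (dom0 Oy))).
have dS (f : 'I_7 -> V -> R) : (forall m, derivable (f m : V -> R^o) y (dv b)) ->
    derivable (fun y => \sum_m f m y : R^o) y (dv b).
  by move=> H; have [] := dder_sum_ord (fun m => pd_dder (H m)).
have dM (f k : V -> R^o) : derivable f y (dv b) -> derivable k y (dv b) ->
    derivable (fun y => f y * k y : R^o) y (dv b).
  by move=> /derivableP H1 /derivableP H2; have [] := dderM H1 H2.
have dhs p q : derivable (fun y => h y p q : R^o) y (dv b).
  exact: (smooth_derivable (h_smooth p q) Oy).
apply: derivableB; last by apply: dS => m; exact: dM.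
apply: derivableB; last by apply: dS => m; exact: dM.
exact: (classC_derivable (classC_D _ (h_smooth i j 2%N)) Oy).
Qed.

Lemma dder_nearV y v (f f' : V -> R) d : O y -> (forall y, O y -> f y = f' y) -> dder y v f d -> dder y v f' d.
Proof.
move=> Oy E; apply: near_eq_is_derive.
by apply: (near_U Oo _ Oy) => z Oz; rewrite E.
Qed.

(** * The variation of the Levi-Civita connection *)

Lemma mixed_der y p i j : O y ->
  dder ((0, y) : W) et (fun z => pd p (fun y => G z.1 y i j) z.2) (2 * pd p (fun y => h y i j) y).
Proof.
move=> Oy; have Uz := dom0 Oy; pose f (z : W) : R^o := met z i j.
have E z : U z -> 'D_(ea p) f z = pd p (fun y => G z.1 y i j) z.2.
  by case: z => t y' Uz'; rewrite -pd_space.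
apply: (dder_near Uz E).
have C2 : class_C 2 U f by exact: G_sm.
have -> : 2 * pd p (fun y => h y i j) y = 'D_et ('D_(ea p) f) (0, y).
  rewrite (schwarz Uo et (ea p) C2 Uz) -(@pd_space R ('D_et f)).
  apply/esym/dder_val/(@dder_nearV _ _ (fun y => 2 * h y i j)) => //.
    by move=> y' Oy'; rewrite (dder_val (met_time i j Oy')).
  have H := pd_dder (a := p) (smooth_derivable (h_smooth i j) Oy).
  by apply: (dder_eq (dderM (dder_cst y (dv p) 2) H)); rewrite mul0r add0r.
apply: derivableP; exact: (classC_derivable (classC_D _ C2) Uz).
Qed.

Lemma pd_h_sym y p i j : O y -> pd p (fun y => h y i j) y = pd p (fun y => h y j i) y.
Proof.
move=> Oy; have H := pd_dder (a := p) (smooth_derivable (h_smooth j i) Oy).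
by apply/dder_val/(dder_nearV Oy _ H) => y' Oy'; exact: hsym.
Qed.

Lemma dh_sym y a i j : O y -> dh y a i j = dh y a j i.
Proof.
move=> Oy; rewrite /dh /nabla2 (pd_h_sym a i j Oy).
under eq_bigr do rewrite (hsym Oy _ j).
under [X in _ - _ - X]eq_bigr do rewrite (hsym Oy i).
by rewrite addrAC.
Qed.

Definition pal (y : V) p i l := dh y p i l + dh y i p l - dh y l p i.

(** Differentiate [Gam_lower] in time: the terms in the variation of the metric
    make the partial derivatives of [h] covariant. *)
Lemma Gam_time y p m i : O y -> dder ((0, y) : W) et (fun z => Gam p z m i)
  (\sum_l metric_inv (met (0, y)) m l * pal y p i l).
Proof.
move=> Oy; pose z : W := (0, y); have Uz : U z := dom0 Oy.
pose ga m := 'D_et (fun z => Gam p z m i : R^o) z.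
have Hg n : dder z et (fun z => Gam p z n i) (ga n).
  by apply: smooth_dder => //; exact: Ga_sm.
have low j : \sum_m ga m * met z m j = pal y p i j.
  have L : dder z et (fun z => \sum_m Gam p z m i * met z m j)
      (\sum_m (ga m * met z m j + Gam p z m i * (2 * h y m j))).
    by apply: dder_sum_ord => n; apply: dderM; [exact: Hg|exact: met_time].
  have {}L := dder_near Uz (fun z' Uz' => Gam_lower p i j Uz') L.
  have L' := dderM (dder_cst z et 2^-1) (dderD (dderD (mixed_der p i j Oy) (mixed_der i p j Oy)) (dderN (mixed_der j p i Oy))).
  have := dder_uniq L L'; rewrite big_split /= mul0r add0r => /eqP.
  rewrite eq_sym -subr_eq => /eqP <-.
  have S a b c : \sum_m christoffel (G 0) y m a b * h y m c = \sum_m Gam a z m b * h y m c by [].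
  rewrite /pal /dh /nabla2 !S.
  have S2 a b c : \sum_m christoffel (G 0) y m a b * h y c m = \sum_m Gam a z m b * h y m c.
    by apply: eq_bigr => n _; rewrite (hsym Oy c).
  rewrite !S2.
  have S3 a b c : \sum_m Gam a z m b * h y m c = \sum_m Gam b z m a * h y m c.
    by apply: eq_bigr => n _; rewrite (Gam_sym a n b Uz).
  rewrite (S3 i p j) (S3 j p i) (S3 j i p).
  have -> : \sum_m Gam p z m i * (2 * h y m j) = 2 * \sum_m Gam p z m i * h y m j.
    by rewrite mulr_sumr; apply: eq_bigr => n _; rewrite mulrCA.
  by field.
apply: (dder_eq (Hg m)); rewrite -(raise_lower ga m Uz).
by apply: eq_bigr => l _; rewrite low.
Qed.

(** * The variation of the torsion *)

(** The covariant derivative of the connection matrix in time is [nabla h]. *)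
Lemma GamT_space y p m i : O y -> let z := (0, y) : W in
  dder z (ea p) (fun z => GamT z m i)
    (\sum_l metric_inv (met z) m l * dh y p l i - \sum_n Gam p z m n * GamT z n i
     + \sum_n Gam p z n i * GamT z m n).
Proof.
move=> Oy z; have Uz : U z := dom0 Oy.
have inv := inv_compat Uz (fun i j => met_compat p i j Uz).
pose iv a b := metric_inv (met z) a b; pose ga a b := Gam p z a b.
have Hh l : dder z (ea p) (fun z => h z.2 l i)
    (dh y p l i + \sum_n ga n l * h y n i + \sum_n ga n i * h y l n).
  by have/cov_ten2 := h_cov_space p Oy; apply.
have Hi l : dder z (ea p) (fun z => metric_inv (met z) m l)
  (- \sum_n (ga m n * iv n l + ga l n * iv m n)) by exact: inv.
apply: (dder_eq (dder_sum_ord (fun l => dderM (Hi l) (Hh l)))).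
rewrite -[metric_inv (met z) m]/(iv m) -[h z.2]/(h y).
have T1 : \sum_n ga m n * GamT z n i = \sum_l \sum_n ga m n * iv n l * h y l i.
  rewrite exchange_big; apply: eq_bigr => n _; rewrite /GamT /raise mulr_sumr.
  by apply: eq_bigr => l _; rewrite mulrA.
have T2 : \sum_n ga n i * GamT z m n = \sum_l iv m l * \sum_n ga n i * h y l n.
  under [RHS]eq_bigr do rewrite mulr_sumr.
  rewrite exchange_big; apply: eq_bigr => n _; rewrite /GamT /raise mulr_sumr.
  by apply: eq_bigr => l _; rewrite mulrCA.
have T3 : \sum_l (\sum_n ga l n * iv m n) * h y l i = \sum_l iv m l * \sum_n ga n l * h y n i.
  under eq_bigr do rewrite mulr_suml.
  under [RHS]eq_bigr do rewrite mulr_sumr.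
  rewrite exchange_big; apply: eq_bigr => n _; apply: eq_bigr => l _ /=; ring.
have T4 : \sum_l \sum_n ga m n * iv n l * h y l i = \sum_l (\sum_n ga m n * iv n l) * h y l i.
  by apply: eq_bigr => l _; rewrite mulr_suml.
rewrite T1 T2 T4.
transitivity (\sum_l iv m l * dh y p l i - \sum_l (\sum_n ga m n * iv n l) * h y l i
  - (\sum_l (\sum_n ga l n * iv m n) * h y l i) + \sum_l iv m l * (\sum_n ga n l * h y n i)
  + \sum_l iv m l * (\sum_n ga n i * h y l n)).
  rewrite -!sumrN -!big_split; apply: eq_bigr => l _ /=.
  have -> : \sum_m0 (ga m m0 * iv m0 l + ga l m0 * iv m m0) =
     \sum_n ga m n * iv n l + \sum_n ga l n * iv m n by rewrite big_split.
  move: (\sum_n ga m n * iv n l) (\sum_n ga l n * iv m n) (\sum_n ga n l * h y n i) (\sum_n ga n i * h y l n) => *; ring.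
rewrite T3; ring.
Qed.

Lemma dder_slice (f f' : W -> R) y p d : O y -> (forall y, O y -> f (0, y) = f' (0, y)) ->
  dder ((0, y) : W) (ea p) f d -> dder ((0, y) : W) (ea p) f' d.
Proof. by move=> Oy E /dder_space H; apply/dder_space; apply: dder_nearV H. Qed.

(** The hypotheses of [ricci_identity] for smooth tensors, whose mixed derivatives
    agree. *)
Lemma commute (A : W -> seq 'I_7 -> R) z va vp (Ga Gp : W -> ten2) dGa dGp s :
  (forall s, smooth_on U (fun z => A z s : R^o)) -> U z ->
  (forall m i, dder z vp (fun y => Ga y m i) (dGa m i)) ->
  (forall m i, dder z va (fun y => Gp y m i) (dGp m i)) ->
  let Da y s := 'D_va (fun y => A y s : R^o) y - act (Ga y) (A y) s in
  let Dp y s := 'D_vp (fun y => A y s : R^o) y - act (Gp y) (A y) s in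
  exists2 DaDp, dder z va (fun y => Dp y s) (DaDp + act (Ga z) (Dp z) s) &
  exists2 DpDa, dder z vp (fun y => Da y s) (DpDa + act (Gp z) (Da z) s) &
  DaDp - DpDa = - act (curvature_mx z Ga Gp dGa dGp) (A z) s.
Proof.
move=> As Uz Ha Hp Da Dp.
pose Av y s : R := 'D_va (fun y => A y s : R^o) y.
pose Ap y s : R := 'D_vp (fun y => A y s : R^o) y.
pose Avp s : R := 'D_va ('D_vp (fun y => A y s : R^o)) z.
have H1 t : dder z va (fun y => A y t) (Av z t) by exact: (smooth_dder va (As t) Uz).
have H2 t : dder z vp (fun y => A y t) (Ap z t) by exact: (smooth_dder vp (As t) Uz).
have H3 t : dder z va (fun y => Ap y t) (Avp t).
  by apply: derivableP; exact: (classC_derivable (classC_D _ (As t 2%N)) Uz).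
have H4 t : dder z vp (fun y => Av y t) (Avp t).
  rewrite /Avp (schwarz Uo va vp (As t 2%N) Uz).
  by apply: derivableP; exact: (classC_derivable (classC_D _ (As t 2%N)) Uz).
exact: (ricci_identity Ha Hp H1 H2 H3 H4 s).
Qed.

Lemma phi_seq_smooth s : smooth_on U (fun z => ten_seq3 (phi z) s : R^o).
Proof.
case: s => [|i [|j [|k [|? ?]]]] /= n; try exact: (classC_cst Uo).
exact: F_smooth.
Qed.

Lemma met_seq_smooth s : smooth_on U (fun z => ten_seq2 (met z) s : R^o).
Proof.
case: s => [|i [|j [|? ?]]] /= n; try exact: (classC_cst Uo).
exact: G_sm.
Qed.

Lemma cov_D (z w : W) (Ga : ten2) A B s : cov z w Ga A B ->
  'D_w (fun y => A y s : R^o) z - act Ga (A z) s = B s.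
Proof. by move=> /(_ s) /dder_val ->; rewrite addrK. Qed.

Definition ten_seq5 (A : 'I_7 -> 'I_7 -> 'I_7 -> 'I_7 -> 'I_7 -> R) (s : seq 'I_7) : R :=
  if s is [:: a; b; c; d; e] then A a b c d e else 0.

Definition env (z : W) (id : nat) : seq 'I_7 -> R :=
  match id with
  | 0%N => ten_seq2 (met z) | 1%N => ten_seq3 (phi z) | 2%N => ten_seq2 (tor z)
  | 3%N => ten_seq2 (h z.2) | 4%N => ten_seq1 (X z.2) | 5%N => ten_seq3 (dh z.2)
  | 6%N => ten_seq2 (ricci (G z.1) z.2) | 8%N => ten_seq4 (psi z) | 9%N => ten_seq4 (dphi z)
  | _ => fun=> 0
  end.

Definition half2 (A : ten2) i j : R := A i j / 2.
(** The tensors at a point of the slice of time zero, numbered as in the tensor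
    expressions; 33, 35 and 36 are the halves of [h], [nabla h] and
    [nabla nabla h] whose symmetrisations give them back. *)
Definition prejet (y : V) (id : nat) : seq 'I_7 -> R :=
  match id with
  | 33%N => ten_seq2 (half2 (h y)) | 35%N => ten_seq3 (fun a => half2 (dh y a))
  | 36%N => ten_seq4 (fun b a => half2 (nabla3 (G 0) dh y b a))
  | 11%N => ten_seq4 (dphi (0, y)) | 12%N => ten_seq3 (nabla2 (G 0) (T 0) y)
  | 13%N => ten_seq3 (dh y) | 14%N => ten_seq2 (nabla1 (G 0) X y)
  | 15%N => ten_seq4 (nabla3 (G 0) dh y)
  | 18%N => ten_seq5 (fun a => wedge_of (phi (0, y)) (tor (0, y) a))
  | 21%N => ten_seq3 (hook_of (met (0, y)) (psi (0, y)) (X y))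
  | 28%N => ten_seq4 (wedge_of (phi (0, y)) (X y))
  | _ => env (0, y) id
  end.

Lemma space_compat y a id : O y -> id \in [:: 0; 1; 2; 3; 4; 5; 8]%N ->
  cov ((0, y) : W) (ea a) (Gam a (0, y)) (fun z => env z id) (fun t => prejet y (10 + id)%N (a :: t)).
Proof.
move=> Oy; rewrite !inE; do ![case/orP]; move=> /eqP->.
- by apply: cov_met => i j; apply: met_compat; exact: dom0.
- by apply: (cov_eq (phi_cov_space a (dom0 Oy))) => -[|i [|j [|k [|? ?]]]].
- by apply: (cov_eq (tor_cov_space a Oy)) => -[|i [|j [|? ?]]].
- by apply: (cov_eq (h_cov_space a Oy)) => -[|i [|j [|? ?]]].
- by apply: (cov_eq (X_cov_space a Oy)) => -[|i [|? ?]].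
- by apply: (cov_eq (dh_cov_space a Oy)) => -[|i [|j [|k [|? ?]]]].
- by apply: (cov_eq (psi_cov_space a (dom0 Oy))) => -[|i [|j [|k [|l [|? ?]]]]].
Qed.

Lemma leibniz_space y a s e jet : O y -> wf e -> perm_eq (fv e) (iota 1 (size s)) ->
  0%N \notin bound e -> all (mem [:: 0; 1; 2; 3; 4; 5; 8]%N) (ids e) ->
  (forall id, id < 20 -> id != 7 -> jet id = prejet y id)%N ->
  let r t := nth ord0 (a :: t) in
  dder ((0, y) : W) (ea a) (fun z => den (met z) (env z) (r s) e)
    (den (met (0, y)) jet (r s) (dspace 0 e) +
     act (Gam a (0, y)) (fun t => den (met (0, y)) (env (0, y)) (r t) e) s).
Proof.
move=> Oy we fe be ie jE r; have Uz := dom0 Oy.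
have inv := inv_compat Uz (fun i j => met_compat a i j Uz).
apply: (@leibniz_cov _ _ _ _ _ met inv env jet (addn 10) [:: a] s e) => //.
  by apply/hasPn => -[nb|n _] //; case/negP: be.
move=> id /(seq.allP ie) iid; rewrite inE in iid; split => [t|].
  by move: iid; rewrite !inE; do ![case/orP]; move=> /eqP->; rewrite jE.
rewrite jE; first exact: space_compat; move: iid; rewrite !inE; do ![case/orP]; by move=> /eqP->.
Qed.

Lemma ctr_raise z (c f : 'I_7 -> R) : U z ->
  \sum_m (\sum_l metric_inv (met z) m l * c l) * f m = ctr (met z) (fun p q => f q * c p).
Proof.
move=> Uz; under eq_bigr do rewrite mulr_suml.
rewrite exchange_big; apply: eq_bigr => l _; apply: eq_bigr => m _ /=.
by rewrite (inv_sym m l Uz); ring.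
Qed.

Definition sdot (y : V) p i j k : R :=
  den (met (0, y)) (prejet y) (nth ord0 [:: p; i; j; k]) (sdot_texp 0 1 2 3).

(** The variation of [nabla phi]: the covariant derivatives along time and
    space commute up to the curvature of the spacetime connection. *)
Lemma dphi_cov_time y : O y -> cov ((0, y) : W) et (GamT (0, y)) (fun z => ten_seq4 (dphi z))
  (ten_seq4 (sdot y)).
Proof.
move=> Oy; pose z : W := (0, y); have Uz : U z := dom0 Oy.
apply/cov_ten4 => p i j k.
have [DaDp Ha [DpDa Hp comm]] := commute [:: i; j; k] phi_seq_smooth Uz
  (fun m n => GamT_space p m n Oy) (fun m n => Gam_time p m n Oy).
have E z' s : U z' -> 'D_(ea p) (fun z => ten_seq3 (phi z) s : R^o) z' -
    act (Gam p z') (ten_seq3 (phi z')) s = ten_seq3 (dphi z' p) s.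
  by move=> Uz'; exact: (cov_D s (phi_cov_space p Uz')).
have E' y' s : O y' -> 'D_et (fun z => ten_seq3 (phi z) s : R^o) (0, y') -
    act (GamT (0, y')) (ten_seq3 (phi (0, y'))) s =
    ten_seq3 (hook_of (met (0, y')) (psi (0, y')) (X y')) s.
  by move=> Oy'; exact: (cov_D s (phi_cov_time Oy')).
have {}Ha := dder_near Uz (fun z' => E z' [:: i; j; k]) Ha.
pose Psi (z' : W) : R := ten_seq3 (hook_of (met z') (psi z') (X z'.2)) [:: i; j; k].
have {}Hp := @dder_slice _ Psi y p _ Oy (fun y' => E' y' [:: i; j; k]) Hp.
have L := leibniz_space p (s := [:: i; j; k]) (e := hook_texp 1 2 3) (jet := prejet y) Oy isT isT isT isT.
have {}L := dder_uniq (L (fun _ _ _ => erefl)) Hp.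
set N := den _ _ _ _ in L.
have DE : N = DpDa.
  have aE : act (Gam p z) (fun t => den (met z) (env z) (nth ord0 (p :: t)) (hook_texp 1 2 3)) [:: i; j; k] =
     act (Gam p z) (fun t => 'D_et (fun y0 : W => ten_seq3 (phi y0) t : R^o) z -
     act (GamT z) (ten_seq3 (phi z)) t) [:: i; j; k].
    by apply: act_eq => // t; case: t => [|a [|b [|c [|? ?]]]] // _; rewrite E'.
  by move: L; rewrite aE; exact: addIr.
set cu := curvature_mx _ _ _ _ _ in comm.
have cuE m n : cu m n = \sum_l metric_inv (met z) m l * (dh y n p l - dh y l p n).
  rewrite /cu /curvature_mx sumrB -/z.
  have -> : \sum_k GamT z m k * Gam p z k n = \sum_k Gam p z k n * GamT z m k.
    by apply: eq_bigr => k' _; rewrite mulrC.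
  have -> : \sum_l metric_inv (met z) m l * pal y p n l =
     \sum_l metric_inv (met z) m l * dh y p l n +
     \sum_l metric_inv (met z) m l * (dh y n p l - dh y l p n).
    rewrite -big_split; apply: eq_bigr => l _ /=; rewrite /pal (dh_sym p n l Oy); ring.
  rewrite /z; ring.
apply: (dder_eq Ha).
have {}comm : DaDp = N - act cu (ten_seq3 (phi z)) [:: i; j; k].
  by rewrite DE -comm addrC subrK.
rewrite comm.
have -> : act (GamT z) (fun t => 'D_(ea p) (fun y0 : W => ten_seq3 (phi y0) t : R^o) z -
     act (Gam p z) (ten_seq3 (phi z)) t) [:: i; j; k] = act (GamT z) (ten_seq3 (dphi z p)) [:: i; j; k].
  by apply: act_eq => // t _; rewrite E.
have cE n (f : 'I_7 -> R) : \sum_m cu m n * f m =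
    ctr (met z) (fun a b => f b * (dh y n p a - dh y a p n)).
  by under eq_bigr do rewrite cuE; rewrite ctr_raise.
have hE : ctr (met z) (fun a b => h y a p * dphi z b i j k) = \sum_m GamT z m p * dphi z m i j k.
  by rewrite /GamT /raise ctr_raise //; apply: ctr_ext => a b; rewrite mulrC.
have -> : sdot y p i j k = N - (\sum_m cu m i * phi z m j k
   + (\sum_m cu m j * phi z i m k + \sum_m cu m k * phi z i j m))
   - \sum_m GamT z m p * dphi z m i j k.
  rewrite (cE i (fun b => phi z b j k)) (cE j (fun b => phi z i b k)).
  by rewrite (cE k (fun b => phi z i j b)) -hE.
rewrite [act cu _ _]/= [act (GamT (0, y)) _ [:: p; i; j; k]]/= -/z.
rewrite -[act (GamT z) (ten_seq3 (dphi z p)) _]/(act (GamT z) (fun t => ten_seq3 (dphi z p) t) _) [act (GamT z) _ _]/=.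
ring.
Qed.

Definition tau (y : V) p q : R :=
  den (met (0, y)) (prejet y) (nth ord0 [:: p; q]) (tau_texp 0 1).

Definition rho (y : V) p q : R :=
  den (met (0, y)) (prejet y) (nth ord0 [:: p; q]) (rho_texp 0 1).

Definition riemU (y : V) a p : ten2 :=
  curvature_mx ((0, y) : W) (Gam a) (Gam p)
    (fun m i => pd p (fun y => christoffel (G 0) y m a i) y)
    (fun m i => pd a (fun y => christoffel (G 0) y m p i) y).
Definition riem (y : V) a p i j : R := \sum_m riemU y a p m i * met (0, y) m j.

Definition jet (y : V) (id : nat) : seq 'I_7 -> R :=
  match id with
  | 7%N => ten_seq4 (riem y) | 22%N => ten_seq2 (tau y) | 26%N => ten_seq2 (rho y) | 29%N => ten_seq4 (sdot y)
  | _ => prejet y id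
  end.

Lemma ddh_sym y b a i j : O y -> nabla3 (G 0) dh y b a i j = nabla3 (G 0) dh y b a j i.
Proof.
move=> Oy; rewrite /nabla3.
have -> : pd b (fun y => dh y a i j) y = pd b (fun y => dh y a j i) y.
  have/cov_ten3 H := dh_cov_space b Oy.
  have /dder_space H1 := H a i j; have /dder_space H2 := H a j i.
  rewrite /pd (dder_val H2); apply/dder_val/(dder_nearV Oy _ H2) => y' Oy'; exact: dh_sym.
have E f g : (forall m, f m = g m) -> \sum_(m < 7) (f m : R) = \sum_(m < 7) g m.
  by move=> fg; apply: eq_bigr => m _.
rewrite (E _ _ (fun m => congr1 (fun c => christoffel (G 0) y m b a * c) (dh_sym m i j Oy))).
rewrite (E _ _ (fun m => congr1 (fun c => christoffel (G 0) y m b i * c) (dh_sym a m j Oy))).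
rewrite (E _ _ (fun m => congr1 (fun c => christoffel (G 0) y m b j * c) (dh_sym a i m Oy))).
exact: addrAC.
Qed.

Lemma half2D (A : ten2) i j : A i j = A j i -> A i j = half2 A i j + half2 A j i.
Proof. by move=> E; rewrite /half2 -E; field. Qed.

Lemma jet_pre y id : (id < 20)%N -> id != 7%N -> jet y id = prejet y id.
Proof. by do 20 (case: id => [|id] //). Qed.

Lemma jet_resolves0 y : O y -> resolves (met (0, y)) (jet y)
  [:: 3; 5; 9; 10; 11; 13; 15; 18; 20; 21; 22; 26; 28; 29]%N.
Proof.
move=> Oy id k r; rewrite !inE; do ![case/orP]; move=> /eqP->.
- by case: k => [|[|[|k]]] //=; apply: half2D; exact: hsym.
- by case: k => [|[|[|[|k]]]] //=; apply: half2D; exact: dh_sym.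
- by case: k => [|[|[|[|[|k]]]]] //=; apply: (dphiE _ _ _ _ (dom0 Oy)).
- by rewrite /= /zr /= mulr0z mul0r.
- by case: k => [|[|[|[|[|k]]]]] //=; apply: (dphiE _ _ _ _ (dom0 Oy)).
- by case: k => [|[|[|[|k]]]] //=; apply: half2D; exact: dh_sym.
- by case: k => [|[|[|[|[|k]]]]] //=; apply: half2D; exact: ddh_sym.
- by case: k => [|[|[|[|[|[|k]]]]]].
- by rewrite /= /zr /= mulr0z mul0r.
- by case: k => [|[|[|[|k]]]].
- by case: k => [|[|[|k]]].
- by case: k => [|[|[|k]]].
- by case: k => [|[|[|[|[|k]]]]].
- by case: k => [|[|[|[|[|k]]]]].
Qed.

Lemma jet_identity y D e r : O y -> holds_subst D e -> resolves (met (0, y)) (jet y) D ->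
  den (met (0, y)) (jet y) r e = 0.
Proof.
move=> Oy He res; have [E [ad _]] := frame_exists (dom0 Oy).
exact: (@g2_identity_subst R _ _ (psi (0, y)) E ad (fun _ _ _ _ => erefl) D (jet y) e r He res).
Qed.

(** The torsion is thus as regular in time as [nabla phi]. *)
Lemma torsion_formula z p q : U z ->
  tor z p q = 24^-1 * den (met z) (env z) (nth ord0 [:: p; q]) (torsion24 0 1).
Proof.
move=> Uz; have [E [ad _]] := frame_exists Uz.
have := @g2_identity_subst R _ _ (psi z) E ad (fun _ _ _ _ => erefl) _ (env z) _ (nth ord0 [:: p; q]) torsion24_check.
move=> H; have {}H : den (met z) (env z) (nth ord0 [:: p; q]) (torsion24 0 1) - 24%:R * tor z p q = 0.
  apply: H => // id k r; rewrite inE => /eqP->.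
  by case: k => [|[|[|[|[|k]]]]] //=; apply: dphiE.
move: H => /subr0_eq ->; rewrite mulKf //.
Qed.

Lemma time_compat0 y id : O y -> id \in [:: 0; 1; 8; 9]%N ->
  cov ((0, y) : W) et (GamT (0, y)) (fun z => env z id) (jet y (20 + id)%N).
Proof.
move=> Oy; rewrite !inE; do ![case/orP]; move=> /eqP->.
- by apply: cov_met => i j; exact: met_compat_time.
- exact: phi_cov_time.
- exact: psi_cov_time.
- exact: dphi_cov_time.
Qed.

Lemma leibniz_time y s e (ok : seq nat) : O y ->
  (forall id, id \in ok -> cov ((0, y) : W) et (GamT (0, y)) (fun z => env z id) (jet y (20 + id)%N)) ->
  all (mem [:: 0; 1; 2; 6; 8; 9]%N) ok ->
  wf e -> perm_eq (fv e) (iota 0 (size s)) -> all (mem ok) (ids e) ->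
  dder ((0, y) : W) et (fun z => den (met z) (env z) (nth ord0 s) e)
    (den (met (0, y)) (jet y) (nth ord0 s) (dtime e) +
     act (GamT (0, y)) (fun t => den (met (0, y)) (env (0, y)) (nth ord0 t) e) s).
Proof.
move=> Oy okP ok9 we fe ie; have Uz := dom0 Oy.
have inv := inv_compat Uz (fun i j => met_compat_time i j Oy).
apply: (@leibniz_cov _ _ _ _ _ met inv env (jet y) (addn 20) [::] s e) => //.
  by apply/hasPn.
move=> id /(seq.allP ie) iid; split => [t|]; last exact: okP.
have := seq.allP ok9 _ iid; rewrite !inE; do ![case/orP]; by move=> /eqP->.
Qed.

Lemma actZ (Q : ten2) c A (s : seq 'I_7) : act Q (fun t => c * A t) s = c * act Q A s.
Proof.
elim: s A => [|i s IH] A /=; first by rewrite mulr0.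
rewrite IH mulrDr mulr_sumr; congr (_ + _).
by apply: eq_bigr => m _; rewrite mulrCA.
Qed.

Lemma tor_cov_time y : O y -> cov ((0, y) : W) et (GamT (0, y)) (fun z => ten_seq2 (tor z))
  (ten_seq2 (tau y)).
Proof.
move=> Oy; apply/cov_ten2 => p q.
have L := leibniz_time (s := [:: p; q]) (e := torsion24 0 1) Oy (fun id => @time_compat0 y id Oy) isT isT isT isT.
have {}L := dderM (dder_cst _ _ 24^-1) L.
have E z : U z -> 24^-1 * den (met z) (env z) (nth ord0 [:: p; q]) (torsion24 0 1) = tor z p q.
  by move=> Uz; rewrite -torsion_formula.
apply: (dder_eq (dder_near (dom0 Oy) E L)); rewrite mul0r add0r.
have : den (met (0, y)) (jet y) (nth ord0 [:: p; q]) tau24_texp = 0.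
  apply: (jet_identity _ Oy tau24_check) => id k r idt; apply: jet_resolves0 => //.
  by move: idt; rewrite !inE; do ![case/orP]; move=> /eqP->.
have gen (A B t s1 s2 : R) : A - 24%:R * t = 0 -> 24^-1 * B = s1 + s2 -> 24^-1 * (A + B) = t + s1 + s2.
  by move=> /subr0_eq -> BE; rewrite mulrDr BE mulKf // addrA.
move=> H; apply: gen; first exact: H.
rewrite -actZ (@act_eq _ _ (GamT (0, y)) _ (ten_seq2 (tor (0, y)))) //; first by rewrite /= addr0.
by case=> [|a [|b [|? ?]]] //= _; rewrite -torsion_formula //; exact: dom0.
Qed.

(** * The Ricci tensor and the torsion *)

Lemma Gam_space y a p m i : O y -> dder ((0, y) : W) (ea p) (fun z => Gam a z m i)
  (pd p (fun y => christoffel (G 0) y m a i) y).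
Proof.
move=> Oy; rewrite (@pd_space R (fun z => christoffel (G z.1) z.2 m a i)).
by apply: smooth_dder; [exact: Ga_sm|exact: dom0].
Qed.

Lemma riemU_lower y a p m i : O y ->
  riemU y a p m i = \sum_l metric_inv (met (0, y)) m l * riem y a p i l.
Proof. by move=> Oy; rewrite /riem raise_lower //; exact: dom0. Qed.

Lemma riem12 y a p i j : riem y a p i j = - riem y p a i j.
Proof.
rewrite /riem -sumrN; apply: eq_bigr => m _; rewrite -mulNr; congr (_ * _).
rewrite /riemU /curvature_mx opprD opprB -sumrN; congr (_ + _).
by apply: eq_bigr => n _; rewrite opprB.
Qed.

(** The metric is parallel, so its covariant derivatives commute. *)
Lemma riem34 y a p i j : O y -> riem y a p i j = - riem y a p j i.
Proof.
move=> Oy; pose z : W := (0, y); have Uz : U z := dom0 Oy.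
have [DaDp Ha [DpDa Hp comm]] := commute [:: i; j] met_seq_smooth Uz
  (fun m n => Gam_space a p m n Oy) (fun m n => Gam_space p a m n Oy).
have E b z' s : U z' -> 'D_(ea b) (fun z => ten_seq2 (met z) s : R^o) z' -
    act (Gam b z') (ten_seq2 (met z')) s = 0.
  by move=> Uz'; apply: (cov_D s (cov_met (fun i j => met_compat b i j Uz'))).
have {}Ha := dder_uniq (dder_near Uz (fun z' => E p z' [:: i; j]) Ha) (dder_cst _ _ 0).
have {}Hp := dder_uniq (dder_near Uz (fun z' => E a z' [:: i; j]) Hp) (dder_cst _ _ 0).
rewrite act0 ?addr0 in Ha; last by move=> t _; rewrite E.
rewrite act0 ?addr0 in Hp; last by move=> t _; rewrite E.
rewrite Ha Hp subr0 /= addr0 in comm.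
move/eqP: comm; rewrite eq_sym oppr_eq0 addr_eq0 => /eqP; rewrite -/(riemU y a p) => H.
rewrite [LHS]H; congr (- _); apply: eq_bigr => m _; by rewrite (met_sym m i Uz).
Qed.

Lemma pd_Gam_sym y b m a i : O y ->
  pd b (fun y => christoffel (G 0) y m a i) y = pd b (fun y => christoffel (G 0) y m i a) y.
Proof.
move=> Oy; have /dder_space H1 := Gam_space a b m i Oy.
have /dder_space H2 := Gam_space i b m a Oy.
rewrite /pd (dder_val H2); apply/dder_val/(dder_nearV Oy _ H2) => y' Oy'.
exact: (Gam_sym i m a (dom0 Oy')).
Qed.

Definition dGam (y : V) b m a i := pd b (fun y => christoffel (G 0) y m a i) y.
Definition quad (y : V) m a p i := \sum_n Gam a (0, y) m n * Gam p (0, y) n i.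

Lemma riemUE y a p m i :
  riemU y a p m i = dGam y a m p i - dGam y p m a i + (quad y m a p i - quad y m p a i).
Proof. by rewrite /riemU /curvature_mx sumrB. Qed.

Lemma dGam_sym y b m a i : O y -> dGam y b m a i = dGam y b m i a.
Proof. exact: pd_Gam_sym. Qed.

Lemma quad_sym y m a p i : O y -> quad y m a p i = quad y m a i p.
Proof.
by move=> Oy; apply: eq_bigr => n _; rewrite (Gam_sym p n i (dom0 Oy)).
Qed.

Lemma riem_bianchi y a p i m : O y -> riem y a p i m + riem y p i a m + riem y i a p m = 0.
Proof.
move=> Oy; rewrite /riem -!big_split big1 // => n _ /=; rewrite -!mulrDl !riemUE.
rewrite (dGam_sym p n a i Oy) (dGam_sym i n p a Oy) (dGam_sym a n i p Oy).
rewrite (quad_sym n a p i Oy) (quad_sym n p i a Oy) (quad_sym n i a p Oy).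
have gen (d1 d2 d3 x1 x2 x3 : R) :
    d1 - d2 + (x1 - x2) + (d2 - d3 + (x2 - x3)) + (d3 - d1 + (x3 - x1)) = 0.
  by clear; ring.
by rewrite gen mul0r.
Qed.

Lemma riem_cyclic y a p i m : O y -> riem y a p i m + (riem y a i m p + riem y a m p i) = 0.
Proof.
move=> Oy; apply: bianchi_cyclic => [b c d e|b c d e|b c d e].
- exact: riem12.
- exact: riem34.
- exact: riem_bianchi.
Qed.

Lemma ctrC z A : U z -> ctr (met z) (fun p q => A q p) = ctr (met z) A.
Proof.
move=> Uz; rewrite /ctr exchange_big; apply: eq_bigr => p _; apply: eq_bigr => q _ /=.
by rewrite (inv_sym q p Uz).
Qed.

Lemma ricci_riem y a c : O y ->
  ricci (G 0) y a c = ctr (met (0, y)) (fun p q => riem y a p q c).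
Proof.
move=> Oy; transitivity (\sum_i riemU y i a i c) => //.
apply: eq_bigr => i _; rewrite riemU_lower //; apply: eq_bigr => l _.
by rewrite riem12 riem34 // opprK.
Qed.

(** One side differentiates [nabla phi = T _| psi], the other is [ricci_identity];
    the connection terms in the index of the first derivative cancel by
    symmetry. *)
Lemma commutator_phi y r : O y ->
  den (met (0, y)) (jet y) r (tors_comm_texp 0 1 2 3 4) =
  den (met (0, y)) (jet y) r (riem_act_texp 0 1 2 3 4).
Proof.
move=> Oy; pose z : W := (0, y); have Uz : U z := dom0 Oy.
set a := r 0%N; set p := r 1%N; set i := r 2%N; set j := r 3%N; set k := r 4%N.
have [DaDp Ha [DpDa Hp comm]] := commute [:: i; j; k] phi_seq_smooth Uz
  (fun m n => Gam_space a p m n Oy) (fun m n => Gam_space p a m n Oy).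
have E b z' s : U z' -> 'D_(ea b) (fun z => ten_seq3 (phi z) s : R^o) z' -
    act (Gam b z') (ten_seq3 (phi z')) s = ten_seq3 (dphi z' b) s.
  by move=> Uz'; exact: (cov_D s (phi_cov_space b Uz')).
pose N a p := den (met z) (jet y) (nth ord0 [:: a; p; i; j; k]) (dspace 0 (torsion_texp 1 2 3 4)).
have L b c : dder z (ea b) (fun z => dphi z c i j k)
    (N b c + \sum_m Gam b z m c * dphi z m i j k + act (Gam b z) (ten_seq3 (dphi z c)) [:: i; j; k]).
  have H := leibniz_space b (s := [:: c; i; j; k]) (e := torsion_texp 1 2 3 4) (jet := jet y) Oy isT isT isT isT.
  have {}H := dder_near Uz (fun z' Uz' => esym (dphiE c i j k Uz')) (H (@jet_pre y)).
  apply: (dder_eq H); rewrite -addrA; congr (_ + _).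
  rewrite (@act_eq _ _ (Gam b z) _ (ten_seq4 (dphi z))) // => t.
  by case: t => [|t1 [|t2 [|t3 [|t4 [|? ?]]]]] //= _; rewrite dphiE.
have actE b c : act (Gam b z) (fun t => 'D_(ea c) (fun z => ten_seq3 (phi z) t : R^o) z -
    act (Gam c z) (ten_seq3 (phi z)) t) [:: i; j; k] = act (Gam b z) (ten_seq3 (dphi z c)) [:: i; j; k].
  by apply: act_eq => // t _; rewrite E.
have {}Ha := dder_near Uz (fun z' => E p z' [:: i; j; k]) Ha.
have {}Hp := dder_near Uz (fun z' => E a z' [:: i; j; k]) Hp.
have {}Ha := dder_uniq Ha (L a p); have {}Hp := dder_uniq Hp (L p a).
rewrite actE in Ha; rewrite actE in Hp; move: Ha Hp => /addIr Ha /addIr Hp.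
have cE n (f : 'I_7 -> R) : \sum_m riemU y a p m n * f m =
    ctr (met z) (fun u v => f v * riem y a p n u).
  by under eq_bigr do rewrite riemU_lower //; rewrite ctr_raise.
transitivity (N a p - N p a) => //.
transitivity (DaDp - DpDa).
  rewrite Ha Hp; have -> : \sum_m Gam a z m p * dphi z m i j k = \sum_m Gam p z m a * dphi z m i j k.
    by apply: eq_bigr => m _; rewrite (Gam_sym a m p Uz).
  by rewrite opprD addrACA subrr addr0.
rewrite comm -/(riemU y a p).
transitivity (- (\sum_m riemU y a p m i * phi z m j k + (\sum_m riemU y a p m j * phi z i m k
   + \sum_m riemU y a p m k * phi z i j m))); first by rewrite /= addr0.
by rewrite (cE i (fun m => phi z m j k)) (cE j (fun m => phi z i m k)) (cE k (fun m => phi z i j m)).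
Qed.

(** The Ricci tensor of a G2-structure in terms of its torsion. *)
Lemma jet_ricci y a c : O y ->
  ricci (G 0) y a c = den (met (0, y)) (jet y) (nth ord0 [:: a; c]) (ricci_texp 0 1).
Proof.
move=> Oy; pose z : W := (0, y); have Uz : U z := dom0 Oy.
pose r := nth ord0 [:: a; c].
set Ric := den _ _ _ _.
pose Q := den (met z) (jet y) r (contract_texp tors_comm_texp 0 1).
have QE : den (met z) (jet y) r (contract_texp riem_act_texp 0 1) = Q.
  do 3 (apply: ctr_ext => ? ?); apply: (congr1 (fun x => _ * x)).
  by apply/esym; exact: (commutator_phi (nth ord0 [:: a; _; _; _; _]) Oy).
have H1 : Q + 4%:R * Ric = 0.
  have := jet_identity r Oy ricci_torsion_check; apply.
  by move=> id k r'; rewrite inE => /eqP->; exact: jet_resolves0.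
have Z1 : ctr (met z) (fun p q => riem y a c p q) = 0.
  have Z : ctr (met z) (fun p q => riem y a c p q) = - ctr (met z) (fun p q => riem y a c p q).
    rewrite -[LHS]ctrC // -[RHS]mulN1r -[RHS]addr0 -[X in _ = _ + X](mul0r (ctr (met z) (fun _ _ => 0))).
    rewrite ctr_linear; apply: ctr_ext => p q.
    by rewrite (riem34 a c q p Oy) mulN1r mul0r addr0.
  exact: opp_self0.
have Z2 : ctr (met z) (fun p p' => ctr (met z) (fun j j' => ctr (met z) (fun m m' =>
    psi z p' m' c j' * (riem y a p j m + (riem y a j m p + riem y a m p j))))) = 0.
  apply: ctr0 => p p'; apply: ctr0 => j j'; apply: ctr0 => m m'.
  by rewrite riem_cyclic // mulr0.
have := jet_identity r Oy riem_ricci_check => H2.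
have {}H2 : 3%:R * Q + (12%:R * ricci (G 0) y a c + 6%:R * 0) - 2%:R * 0 = 0.
  by rewrite -[RHS]H2 // -QE -[X in 6%:R * X]Z1 -[X in 2%:R * X]Z2 ricci_riem.
exact: ricci_arith H1 H2.
Qed.

(** * The variation of the Ricci tensor *)

Lemma mixed (f : W -> R) (f' : W -> R) y i d : O y -> smooth_on U (f : W -> R^o) ->
  (forall y, O y -> dder ((0, y) : W) et f (f' (0, y))) -> dder ((0, y) : W) (ea i) f' d ->
  dder ((0, y) : W) et (fun z => 'D_(ea i) (f : W -> R^o) z) d.
Proof.
move=> Oy fs ft fd; have Uz := dom0 Oy; have C2 := fs 2%N.
have -> : d = 'D_et ('D_(ea i) (f : W -> R^o)) (0, y).
  rewrite (schwarz Uo et (ea i) C2 Uz); apply/esym/dder_val.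
  by apply: (dder_slice Oy _ fd) => y' Oy'; rewrite (dder_val (ft y' Oy')).
apply: derivableP; exact: (classC_derivable (classC_D _ C2) Uz).
Qed.

Definition gam_dot (z : W) m a i := \sum_l metric_inv (met z) m l * pal z.2 a i l.
Definition dpal (y : V) a j k l : R :=
  den (met (0, y)) (jet y) (nth ord0 [:: a; j; k; l]) (dspace 0 (palatini_texp 1 2 3)).

Lemma pal_space y a j k l : O y -> dder ((0, y) : W) (ea a) (fun z => pal z.2 j k l)
  (dpal y a j k l + \sum_n Gam a (0, y) n j * pal y n k l + \sum_n Gam a (0, y) n k * pal y j n l
   + \sum_n Gam a (0, y) n l * pal y j k n).
Proof.
move=> Oy.
have H := leibniz_space a (s := [:: j; k; l]) (e := palatini_texp 1 2 3) (jet := jet y) Oy isT isT isT isT (@jet_pre y).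
apply: (dder_eq H).
transitivity (dpal y a j k l + act (Gam a (0, y)) (ten_seq3 (pal y)) [:: j; k; l]); last first.
  by rewrite /= addr0 !addrA.
apply: (congr1 (fun c => dpal y a j k l + c)); apply: act_eq => //.
by case=> [|t1 [|t2 [|t3 [|? ?]]]].
Qed.

(** The derivative of [iv m l * p l], where [iv] has connection terms in both
    indices: those in the contracted index [l] cancel. *)
Lemma gam_dot_arith (iv : ten2) (g : ten2) (p : 'I_7 -> R) (m : 'I_7) (a b c : 'I_7 -> R) :
  \sum_l ((- \sum_n (g m n * iv n l + g l n * iv m n)) * p l
    + iv m l * (a l + b l + c l + \sum_n g n l * p n)) =
  \sum_l iv m l * a l - \sum_n g m n * (\sum_l iv n l * p l)
  + \sum_l iv m l * b l + \sum_l iv m l * c l.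
Proof.
have T1 : \sum_n g m n * (\sum_l iv n l * p l) = \sum_l (\sum_n g m n * iv n l) * p l.
  under [RHS]eq_bigr do rewrite mulr_suml.
  rewrite [RHS]exchange_big; apply: eq_bigr => n _; rewrite mulr_sumr.
  by apply: eq_bigr => l _; rewrite mulrA.
have T3 : \sum_l (\sum_n g l n * iv m n) * p l = \sum_l iv m l * \sum_n g n l * p n.
  under eq_bigr do rewrite mulr_suml.
  under [RHS]eq_bigr do rewrite mulr_sumr.
  rewrite exchange_big; apply: eq_bigr => n _; apply: eq_bigr => l _ /=; ring.
transitivity (\sum_l iv m l * a l - \sum_l (\sum_n g m n * iv n l) * p l
  - (\sum_l (\sum_n g l n * iv m n) * p l) + \sum_l iv m l * b l + \sum_l iv m l * c l
  + \sum_l iv m l * (\sum_n g n l * p n)).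
  rewrite -!sumrN -!big_split; apply: eq_bigr => l _ /=.
  have -> : \sum_n (g m n * iv n l + g l n * iv m n) =
     \sum_n g m n * iv n l + \sum_n g l n * iv m n by rewrite big_split.
  move: (\sum_n g m n * iv n l) (\sum_n g l n * iv m n) (\sum_n g n l * p n) => *; ring.
rewrite T1 T3; ring.
Qed.

Lemma gam_dot_space y a m j k : O y -> let z := (0, y) : W in
  dder z (ea a) (fun z => gam_dot z m j k)
    (\sum_l metric_inv (met z) m l * dpal y a j k l - \sum_n Gam a z m n * gam_dot z n j k
     + \sum_n Gam a z n j * gam_dot z m n k + \sum_n Gam a z n k * gam_dot z m j n).
Proof.
move=> Oy z; have Uz : U z := dom0 Oy.
have inv := inv_compat Uz (fun i j => met_compat a i j Uz).
apply: (dder_eq (dder_sum_ord (fun l => dderM (inv m l) (pal_space a j k l Oy)))).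
rewrite (gam_dot_arith (metric_inv (met z)) (Gam a z) (fun l => pal y j k l) m (fun l => dpal y a j k l)
  (fun l => \sum_n Gam a z n j * pal y n k l) (fun l => \sum_n Gam a z n k * pal y j n l)).
have C (f : 'I_7 -> R) (p : 'I_7 -> 'I_7 -> R) : \sum_l metric_inv (met z) m l * (\sum_n f n * p n l) =
    \sum_n f n * \sum_l metric_inv (met z) m l * p n l.
  under eq_bigr do rewrite mulr_sumr.
  rewrite exchange_big; apply: eq_bigr => n _; rewrite mulr_sumr.
  by apply: eq_bigr => l _; rewrite mulrCA.
by congr (_ + _ + _); [exact: (C _ (fun n l => pal y n k l))|exact: (C _ (fun n l => pal y j n l))].
Qed.

Lemma ricci_dot_arith (d1 d2 : R) (f1 f2 f3 f4 f5 f6 f7 f8 f9 f10 : 'I_7 -> R) :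
  (forall n, f3 n = f7 n) -> (forall n, f1 n = f10 n) ->
  (forall n, f4 n = f9 n) -> (forall n, f2 n = f6 n) -> (forall n, f8 n = f5 n) ->
  d1 - \sum_n f1 n + \sum_n f3 n + \sum_n f4 n - (d2 - \sum_n f2 n + \sum_n f7 n + \sum_n f5 n)
  + \sum_n (f8 n + f10 n - (f9 n + f6 n)) = d1 - d2.
Proof.
move=> E1 E2 E3 E4 E5.
have -> : \sum_n (f8 n + f10 n - (f9 n + f6 n)) = \sum_n (f5 n + f1 n - (f4 n + f2 n)).
  by apply: eq_bigr => n _; rewrite E5 E2 E3 E4.
have -> : \sum_n f3 n = \sum_n f7 n by apply: eq_bigr => n _; rewrite E1.
rewrite sumrB !big_split /=; ring.
Qed.

(** The variation of the Ricci tensor: the terms without derivatives of the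
    variation of the connection cancel, the connection being symmetric. *)
Lemma ricci_time y j k : O y ->
  dder ((0, y) : W) et (fun z => ricci (G z.1) z.2 j k)
    (den (met (0, y)) (jet y) (nth ord0 [:: j; k]) (ricci_dot_texp 0 1)).
Proof.
move=> Oy; pose z : W := (0, y); have Uz : U z := dom0 Oy.
have GD a m i y' (Oy' : O y') : dder ((0, y') : W) et (fun z => Gam a z m i) (gam_dot (0, y') m a i).
  exact: Gam_time.
have PD b a m i : dder z et (fun z => pd b (fun y => christoffel (G z.1) y m a i) z.2)
   (\sum_l metric_inv (met z) m l * dpal y b a i l - \sum_n Gam b z m n * gam_dot z n a i
     + \sum_n Gam b z n a * gam_dot z m n i + \sum_n Gam b z n i * gam_dot z m a n).
  have H := mixed Oy (Ga_sm m a i) (GD a m i) (gam_dot_space b m a i Oy).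
  apply: (dder_near Uz _ H) => -[t y'] _; by rewrite -(@pd_space R (fun z => christoffel (G z.1) z.2 m a i)).
have H i := dderD (dderD (PD i j i k) (dderN (PD j i i k)))
  (dder_sum_ord (fun m => dderD (dderM (GD i i m y Oy) (GD j m k y Oy))
      (dderN (dderM (GD j i m y Oy) (GD i m k y Oy))))).
apply: (dder_eq (dder_sum_ord H)).
transitivity (\sum_i (\sum_l metric_inv (met z) i l * dpal y i j k l -
    \sum_l metric_inv (met z) i l * dpal y j i k l)); last by rewrite sumrB.
apply: eq_bigr => i _; apply: ricci_dot_arith => n.
- by rewrite (Gam_sym i n j Uz).
- by [].
- by rewrite mulrC.
- by [].
- by rewrite mulrC.
Qed.

Lemma ricci_cov_time y : O y -> cov ((0, y) : W) et (GamT (0, y))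
  (fun z => ten_seq2 (ricci (G z.1) z.2)) (ten_seq2 (rho y)).
Proof.
move=> Oy; have Uz := dom0 Oy; apply/cov_ten2 => j k; apply: (dder_eq (ricci_time j k Oy)).
set N := den _ _ _ _.
have c1 n (f : 'I_7 -> R) : \sum_m GamT (0, y) m n * f m = ctr (met (0, y)) (fun p q => h y p n * f q).
  by rewrite /GamT /raise ctr_raise //; apply: ctr_ext => a b; rewrite mulrC.
rewrite (c1 j (fun m => ricci (G 0) y m k)) (c1 k (fun m => ricci (G 0) y j m)).
have -> : rho y j k = N - (ctr (met (0, y)) (fun p q => h y p j * ricci (G 0) y q k)
  + ctr (met (0, y)) (fun p q => h y p k * ricci (G 0) y j q)) by [].
by rewrite -addrA subrK.
Qed.

(** * The variation of the Lagrangian *)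

Lemma jet_resolves y D : O y -> {subset D <= [:: 6; 3; 5; 9; 10; 11; 13; 15; 18; 20; 21; 22; 26; 28; 29]%N} ->
  resolves (met (0, y)) (jet y) D.
Proof.
move=> Oy sub id k r /sub; rewrite in_cons => /orP[/eqP->|idD]; last exact: jet_resolves0.
by case: k => [|[|[|k]]] //; exact: jet_ricci.
Qed.

Lemma time_compat y id : O y -> id \in [:: 0; 1; 2; 6; 8; 9]%N ->
  cov ((0, y) : W) et (GamT (0, y)) (fun z => env z id) (jet y (20 + id)%N).
Proof.
move=> Oy iD; have [i2|n2] := eqVneq id 2%N; first by rewrite i2; exact: tor_cov_time.
have [i6|n6] := eqVneq id 6%N; first by rewrite i6; exact: ricci_cov_time.
apply: time_compat0 => //; move: iD n2 n6; rewrite !inE.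
by do ![case/orP]; move=> /eqP->.
Qed.

Lemma ctrZ (c : R) (g A : ten2) : c * ctr g A = ctr g (fun p q => c * A p q).
Proof.
rewrite /ctr mulr_sumr; apply: eq_bigr => p _; rewrite mulr_sumr.
by apply: eq_bigr => q _; rewrite mulrCA.
Qed.

Lemma nabla1_den (Y : V -> 'I_7 -> R) (c : R) e y a k : O y ->
  wf e -> perm_eq (fv e) [:: 1%N] -> 0%N \notin bound e -> all (mem [:: 0; 1; 2; 3; 4; 5; 8]%N) (ids e) ->
  (forall y k, O y -> Y y k = c * den (met (0, y)) (env (0, y)) (nth ord0 [:: ord0; k]) e) ->
  dder y (dv a) (fun y => Y y k) (nabla1 (G 0) Y y a k + \sum_m Gam a (0, y) m k * Y y m) /\
  nabla1 (G 0) Y y a k = c * den (met (0, y)) (jet y) (nth ord0 [:: a; k]) (dspace 0 e).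
Proof.
move=> Oy we fe be ie YE.
have Er (b : 'I_7) t z : den (met z) (env z) (nth ord0 (b :: t)) e = den (met z) (env z) (nth ord0 (ord0 :: t)) e.
  by apply: den_eq => // n; rewrite (perm_mem fe) inE => /eqP->.
have H := leibniz_space a (s := [:: k]) (e := e) (jet := jet y) Oy we fe be ie (@jet_pre y).
have {}H := dderM (dder_cst _ _ c) H.
move: H; rewrite mul0r add0r => /dder_space H.
have {}H : dder y (dv a) (fun y => Y y k) (c * den (met (0, y)) (jet y) (nth ord0 [:: a; k]) (dspace 0 e)
    + \sum_m Gam a (0, y) m k * Y y m).
  have E y' : O y' -> c * den (met (0, y')) (env (0, y')) (nth ord0 [:: a; k]) e = Y y' k.
    by move=> Oy'; rewrite YE // Er.
  apply: (dder_eq (dder_nearV Oy E H)).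
  rewrite mulrDr; congr (_ + _); rewrite /= addr0 mulr_sumr; apply: eq_bigr => m _.
  by rewrite YE // mulrCA Er.
have N : nabla1 (G 0) Y y a k = c * den (met (0, y)) (jet y) (nth ord0 [:: a; k]) (dspace 0 e).
  by rewrite /nabla1 /pd (dder_val H) addrK.
by split=> //; rewrite N.
Qed.

Lemma grad_den (f : V -> R) e y k : O y ->
  wf e -> perm_eq (fv e) [::] -> 0%N \notin bound e -> all (mem [:: 0; 1; 2; 3; 4; 5; 8]%N) (ids e) ->
  (forall y, O y -> f y = den (met (0, y)) (env (0, y)) (nth ord0 [::]) e) ->
  pd k f y = den (met (0, y)) (jet y) (nth ord0 [:: k]) (dspace 0 e).
Proof.
move=> Oy we fe be ie fE.
have H := leibniz_space k (s := [::]) (e := e) (jet := jet y) Oy we fe be ie (@jet_pre y).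
move: H; cbv zeta; rewrite [act _ _ _]/= addr0 => /dder_space H; apply/dder_val/(dder_nearV Oy _ H) => y' Oy'.
by rewrite fE //; apply: den_eq => // n; rewrite (perm_mem fe).
Qed.

(** The Levi-Civita connection being symmetric, Lie derivatives of the metric are
    symmetrised covariant derivatives. *)
Lemma lie_metricE (Y : V -> 'I_7 -> R) y i j : O y ->
  (forall a k, dder y (dv a) (fun y => Y y k) (nabla1 (G 0) Y y a k + \sum_m Gam a (0, y) m k * Y y m)) ->
  lie_metric (G 0) Y y i j = nabla1 (G 0) Y y i j + nabla1 (G 0) Y y j i.
Proof.
move=> Oy HY; pose z : W := (0, y); have Uz : U z := dom0 Oy.
pose up k y := \sum_l metric_inv (G 0 y) k l * Y y l.
have Hup a k : pd a (up k) y = \sum_l metric_inv (met z) k l * nabla1 (G 0) Y y a l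
    - \sum_n Gam a z k n * up n y.
  have inv l := (dder_space _ _ _ _ _).1 (inv_compat Uz (fun i j => met_compat a i j Uz) k l).
  have H := dder_sum_ord (fun l => dderM (inv l) (HY a l)).
  rewrite /pd [LHS](dder_val H).
  transitivity (\sum_l ((- \sum_n (Gam a z k n * metric_inv (met z) n l + Gam a z l n * metric_inv (met z) k n)) * Y y l
     + metric_inv (met z) k l * (nabla1 (G 0) Y y a l + 0 + 0 + \sum_n Gam a z n l * Y y n))).
    by apply: eq_bigr => l _; rewrite !addr0.
  rewrite (gam_dot_arith (metric_inv (met z)) (Gam a z) (Y y) k (fun l => nabla1 (G 0) Y y a l) (fun=> 0) (fun=> 0)).
  have -> : \sum_l metric_inv (met z) k l * (0 : R) = 0 by rewrite big1 // => l _; rewrite mulr0.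
  by rewrite !addr0.
have dg k : pd k (fun y => G 0 y i j) y = \sum_m Gam k z m i * met z m j + \sum_m Gam k z m j * met z i m.
  exact: (dder_uniq (met_space k i j Uz) (met_compat k i j Uz)).
rewrite /lie_metric -/(up _ _).
have L a b : \sum_k met z k b * pd a (up k) y = nabla1 (G 0) Y y a b - \sum_k up k y * \sum_m Gam k z m a * met z m b.
  under eq_bigr do rewrite Hup mulrBr.
  rewrite sumrB lower_raise //; congr (_ - _).
  under eq_bigr do rewrite mulr_sumr.
  rewrite exchange_big; apply: eq_bigr => n _ /=; rewrite mulr_sumr; apply: eq_bigr => m _.
  by rewrite (Gam_sym a m n Uz); ring.
transitivity (\sum_k up k y * pd k (fun y => G 0 y i j) y + \sum_k met z k j * pd i (up k) y
   + \sum_k met z k i * pd j (up k) y).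
  rewrite -!big_split; apply: eq_bigr => k _ /=; congr (_ + _ * _); exact: (met_sym i k Uz).
rewrite !L; under eq_bigr do rewrite dg mulrDr.
rewrite big_split /=.
have -> : \sum_k up k y * (\sum_m Gam k z m j * met z i m) = \sum_k up k y * (\sum_m Gam k z m j * met z m i).
  by apply: eq_bigr => k _; congr (_ * _); apply: eq_bigr => m _; rewrite (met_sym i m Uz).
ring.
Qed.

Definition lvt (y : V) := vecV (G 0 y) (F 0 y) (T 0 y).
Definition ltr (y : V) := trace2 (G 0 y) (T 0 y).

Definition lP1 (y : V) : ten2 := fun a b =>
  - ricci (G 0) y a b - 1 / 3 * lie_metric (G 0) lvt y a b
  - 2 / 3 * sym_part (compose2 (G 0 y) (T 0 y) (hook3 (G 0 y) (lvt y) (F 0 y))) a b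
  + ltr y * sym_part (T 0 y) a b.

Definition lP2 (y : V) : 'I_7 -> R := fun k =>
  2 / 3 * div2 (G 0) (T 0) y k + 1 / 3 * grad ltr y k + 1 / 3 * (ltr y * lvt y k).

Definition ldiv (y : V) : 'I_7 -> R := fun k =>
  - (1 / 3 * grad (fun y => trace2 (G 0 y) (h y)) y k) + 1 / 3 * div2 (G 0) h y k
  - 2 / 3 * vecV (G 0 y) (F 0 y) (compose2 (G 0 y) (h y) (T 0 y)) k
  - 2 / 3 * apply2 (G 0 y) (T 0 y) (X y) k - 1 / 3 * (ltr y * X y k).

Definition llagr (t : R) (y : V) : R :=
  1 / 6 * scalar_curvature (G t) y - 1 / 6 * trace2 (G t y) (T t y) ^+ 2
  - 1 / 3 * inner2 (G t y) (T t y) (T t y).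

Lemma lvt_den y a k : O y ->
  dder y (dv a) (fun y => lvt y k) (nabla1 (G 0) lvt y a k + \sum_m Gam a (0, y) m k * lvt y m) /\
  nabla1 (G 0) lvt y a k = den (met (0, y)) (jet y) (nth ord0 [:: a; k]) (dspace 0 (vt_texp 1)).
Proof.
move=> Oy; have := @nabla1_den lvt 1 (vt_texp 1) y a k Oy isT isT isT isT.
by rewrite mul1r; apply=> y' k' _; rewrite mul1r.
Qed.

Lemma P1_arith (a b c d e f : R) :
  6%:R * (- a - 1 / 3 * b - 2 / 3 * ((c + d) / 2) + e * (f / 2)) =
  - (6%:R * a) - 2%:R * b - 2%:R * (c + d) + 3%:R * (e * f).
Proof. by field. Qed.

Lemma P2_arith (a b c : R) : 3%:R * (2 / 3 * a + 1 / 3 * b + 1 / 3 * c) = 2%:R * a + b + c.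
Proof. by field. Qed.

Lemma div_arith (a b c d e : R) :
  - (1 / 3 * a) + 1 / 3 * b - 2 / 3 * c - 2 / 3 * d - 1 / 3 * e =
  3^-1 * (- a + b - 2%:R * c - 2%:R * d - e).
Proof. by field. Qed.

Lemma lP1_den y a b : O y ->
  6%:R * lP1 y a b = den (met (0, y)) (jet y) (nth ord0 [:: a; b]) (p1_texp 0 1).
Proof.
move=> Oy; rewrite /lP1 lie_metricE //; last by move=> c k; exact: (lvt_den c k Oy).1.
rewrite (lvt_den a b Oy).2 (lvt_den b a Oy).2 /sym_part.
by rewrite P1_arith.
Qed.

Lemma lP2_den y k : O y ->
  3%:R * lP2 y k = den (met (0, y)) (jet y) (nth ord0 [:: k]) (p2_texp 0).
Proof.
move=> Oy; rewrite /lP2 /grad (@grad_den ltr trT_texp y k Oy) //.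
by rewrite P2_arith.
Qed.

Lemma ldiv_den y a k : O y ->
  nabla1 (G 0) ldiv y a k = 3^-1 * den (met (0, y)) (jet y) (nth ord0 [:: a; k]) (dspace 0 (divergence_texp 1)).
Proof.
move=> Oy; apply: (@nabla1_den ldiv 3^-1 (divergence_texp 1) y a k Oy isT isT isT isT _).2.
move=> y' k' Oy'; rewrite /ldiv /grad.
rewrite (@grad_den (fun y => trace2 (G 0 y) (h y)) (Ctr 5 6 (hE 5 6)) y' k' Oy') //.
by rewrite div_arith.
Qed.

(** Both sides are expressions in the tensors at the point; by [final_check] their
    difference vanishes. *)
Lemma lagrangian_variation y : O y ->
  dder (0 : R^o) (1 : R^o) (fun t => llagr t y)
    (inner2 (G 0 y) (h y) (lP1 y) + inner1 (G 0 y) (X y) (lP2 y) + div1 (G 0) ldiv y).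
Proof.
move=> Oy.
have L := leibniz_time (s := [::]) (e := lagr_texp) Oy (fun id => @time_compat y id Oy) isT isT isT isT.
move: (dderM (dder_cst _ _ 6^-1) L); rewrite mul0r add0r [act _ _ _]/= addr0 => /dder_time H.
have fE : (fun t : R => 6^-1 * den (met (t, y)) (env (t, y)) (nth ord0 [::]) lagr_texp) = (fun t => llagr t y).
  apply/funext => t; rewrite /llagr.
  have gen (a b c : R) : 6^-1 * (a - b * b - 2%:R * c) = 1 / 6 * a - 1 / 6 * b ^+ 2 - 1 / 3 * c by field.
  by rewrite -gen.
rewrite -fE; apply: (dder_eq H).
have Fin : den (met (0, y)) (jet y) (nth ord0 [::]) (dtime lagr_texp) =
    den (met (0, y)) (jet y) (nth ord0 [::]) rhs_texp.
  apply/eqP; rewrite -subr_eq0; apply/eqP.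
  by apply: (jet_identity _ Oy final_check); apply: jet_resolves => // id; rewrite !inE; do ![case/orP]; move=> /eqP->.
rewrite Fin.
have gen (a b c A B C : R) : 6%:R * a = A -> 3%:R * b = B -> 3%:R * c = C ->
    6^-1 * (A + 2%:R * B + 2%:R * C) = a + b + c.
  by move=> <- <- <-; field.
apply: gen.
- rewrite /inner2 ctrZ; apply: ctr_ext => p p'; rewrite ctrZ; apply: ctr_ext => q q'.
  by rewrite mulrCA lP1_den.
- rewrite /inner1 ctrZ; apply: ctr_ext => p p'.
  by rewrite mulrCA lP2_den.
- rewrite /div1 ctrZ; apply: ctr_ext => p q.
  by rewrite ldiv_den // mulVKf // pnatr_eq0.
Qed.

End Family.
End Spacetime2.

(** * The variation formula *)

Set Strict Implicit.
Unset Implicit Arguments.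

Theorem proposition4p1 (R : realType) (M : topologicalType)
    (A : smooth_structure R M) (phi : G2_structure A)
    (eps : R) (Phi : R -> G2_structure A)
    (T : R -> tensor2 A) (h : tensor2 A) (X : tensor1 A) :
  0 < eps ->
  smooth_family eps Phi ->
  Phi 0 = phi ->
  (forall t, `|t| < eps -> is_torsion (Phi t) (T t)) ->
  symmetric_tensor h ->
  (forall i x, chart_img (A i) x -> forall a b c,
     is_derive (0 : R^o) (1 : R^o) (fun t : R^o => Phi t i x a b c : R^o)
       (diamond (g2_metric phi i x) (h i x) (phi i x) a b c
        + hook4 (g2_metric phi i x) (X i x) (g2_psi phi i x) a b c)) ->
  forall i x, chart_img (A i) x ->
    is_derive (0 : R^o) (1 : R^o)
      (fun t : R^o => lagrangian (Phi t) (T t) i x : R^o)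
      (inner2 (g2_metric phi i x) (h i x) (P1_hat phi (T 0) i x)
       + inner1 (g2_metric phi i x) (X i x) (P2 phi (T 0) i x)
       + div1 (g2_metric phi i) (divergence_form phi (T 0) h X i) x).

Proof.
move=> eps0 Psm <- tors hs dphi0 i x Ox.
pose O := chart_img (A i).
have Oo : open O by exact: chart_img_open.
have := @lagrangian_variation R eps O Oo (fun t => Phi t i) (fun t => g2_metric (Phi t) i)
  (fun t => g2_vol (Phi t) i) _ _ _ _ _ _ _ (h i) (X i) _ _ _ (fun t => T t i) _ _ _ _ x Ox.
apply.
- by move=> t y [_ Oy]; exact: g2_metric_sym.
- by move=> t y [_ Oy]; exact: g2_metric_pos.
- by move=> t y [_ Oy]; exact: g2_vol_unit.
- by move=> t y [_ Oy]; exact: g2_alt12.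
- by move=> t y [_ Oy]; exact: g2_alt23.
- by move=> t y [_ Oy]; exact: g2_compat.
- by move=> a b c; exact: Psm.
- exact: eps0.
- by move=> y Oy; exact: hs.
- by move=> y Oy a b c; exact: dphi0.
- by move=> t y [te Oy] p a b c; exact: tors.
- by move=> a b; exact: smooth2.
- by move=> a b; exact: smooth2.
- by move=> a; exact: smooth1.
Qed.
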